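(* Let $V_{\mathbb{R}}$ be a finite dimensional real vector space and $V_{\mathbb{C}} := V_{\mathbb{R}}\otimes_{\mathbb{R}}\mathbb{C}$. There is a one to one correspondence between real mixed Hodge structures on $V_{\mathbb{R}}$ and strongly pseudo-real $\sigma$-operators on $V_{\mathbb{C}}$. Explicitly: for every strongly pseudo-real $\sigma$-operator $A$ on $V_{\mathbb{C}}$, the filtration $W^A_\bullet$ is the complexification of a unique filtration $W^{A,\mathbb{R}}_\bullet$ of $V_{\mathbb{R}}$, the pair $(W^{A,\mathbb{R}}_\bullet, F_A^\bullet)$ is a real mixed Hodge structure on $V_{\mathbb{R}}$, and the map $A\mapsto (W^{A,\mathbb{R}}_\bullet, F_A^\bullet)$ is a bijection from the set of strongly pseudo-real $\sigma$-operators on $V_{\mathbb{C}}$ onto the set of real mixed Hodge structures on $V_{\mathbb{R}}$.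
   Context: Lattice and Weierstrass function: let $\omega_1=1-i$, $\omega_2=1+i$, $\Lambda=\mathbb{Z}\omega_1+\mathbb{Z}\omega_2$, $\lambda_{p,q}=p\omega_1+q\omega_2$ for $p,q\in\mathbb{Z}$, and let $\sigma$ be the entire function $$\sigma(z)=z\prod_{(p,q)\neq(0,0)}\left(1-\frac{z}{\lambda_{p,q}}\right)\exp\left[\frac{z}{\lambda_{p,q}}+\frac12\left(\frac{z}{\lambda_{p,q}}\right)^2\right].$$ For $(m,n)\in\mathbb{Z}\times\mathbb{Z}$ put $\sigma_{m,n}(z)=\sigma(z)/(z-\lambda_{m,n})$, which is again an entire function. An entire function is applied to an endomorphism of a finite dimensional complex vector space via its power series. A $\sigma$-operator on $V_{\mathbb{C}}$ is $A\in\mathrm{End}_{\mathbb{C}}(V_{\mathbb{C}})$ with $\sigma(A)=0$. Complex conjugation on $V_{\mathbb{C}}=V_{\mathbb{R}}\otimes\mathbb{C}$ is denoted by a bar, and $\overline{A}$ is the endomorphism $\overline{A}(x)=\overline{A(\overline{x})}$. For a $\sigma$-operator $A$ one has the eigenspace decomposition $V_{\mathbb{C}}=\bigoplus_{p,q}I_A^{p,q}$ with $I_A^{p,q}=\{x\in V_{\mathbb{C}}: Ax=\lambda_{p,q}x\}$, and one defines $$W_n^A=\bigoplus_{p+q\le n}I_A^{p,q},\qquad F_A^p=\bigoplus_{k\ge p,\ q\in\mathbb{Z}}I_A^{k,q}.$$ A $\sigma$-operator $A$ on $V_{\mathbb{C}}$ is strongly pseudo-real if $\sigma_{r,s}(A)(\overline{A}-A)\sigma_{p,q}(A)=0$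 for all integers $p,q,r,s$ with $r\ge p$ or $s\ge q$. A real mixed Hodge structure on $V_{\mathbb{R}}$ consists of a finite increasing filtration $W^{\mathbb{R}}_\bullet$ of $V_{\mathbb{R}}$ (weight filtration) and a finite decreasing filtration $F^\bullet$ of $V_{\mathbb{C}}$ (Hodge filtration) such that for every $n$ the filtration induced by $F^\bullet$ on the complexification of $\mathrm{Gr}^W_n(V_{\mathbb{R}})=W^{\mathbb{R}}_n/W^{\mathbb{R}}_{n-1}$ is a pure real Hodge structure of weight $n$. Filtrations are indexed by $\mathbb{Z}$; finite means equal to $0$ far enough in one direction and to the whole space far enough in the other. *)

(* Defs.v *)
From HB Require Import structures.
From mathcomp Require Import all_boot all_order all_algebra finmap.
From mathcomp Require Import complex.
From mathcomp Require Import all_classical all_reals all_analysis.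
From mathcomp Require Import summability.

Set Implicit Arguments.
Unset Strict Implicit.
Unset Printing Implicit Defensive.

Import Order.TTheory GRing.Theory Num.Theory.
Import numFieldNormedType.Exports VectorInternalTheory.

Local Open Scope classical_set_scope.
Local Open Scope complex_scope.
Local Open Scope ring_scope.

(* Topological notions on the complex numbers R[i] are taken in the normed
   module R[i]^o: they are not attached to the type R[i] itself. *)

Section WeierstrassSigma.
Variable R : realType.
Local Notation C := R[i].
Implicit Types (z : C) (f : C -> C).

Definition cexp z : C :=
  limn (series (fun k => z ^+ k / k`!%:R : C^o)).

Definition lattice_pt (p q : int) : C :=
  p%:~R * (1 -i* 1) + q%:~R * (1 +i* 1).

Definition sigma_factor z (pq : int * int) : C :=
  let w := z / lattice_pt pq.1 pq.2 in (1 - w) * cexp (w + 2^-1 * w ^+ 2).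

(* The product over the lattice is the unconditional one: the limit of the
   finite products along the directed set of finite subsets of int * int. *)
Definition sigma z : C :=
  z * lim ((fun D : {fset int * int} =>
    (\prod_(pq <- D | pq != (0, 0)) sigma_factor z pq : C^o)) @ totally).

(* Quotient of f by z - a, with its limit as value at a. *)
Definition div_root f (a : C) z : C :=
  if z == a then lim ((f w / (w - a) : C^o) @[w --> (a : C^o)^'])
  else f z / (z - a).

Definition sigma_quot (m n : int) : C -> C := div_root sigma (lattice_pt m n).

Definition power_series_of f : set (nat -> C) :=
  [set a | forall z, series (fun k => a k * z ^+ k : C^o) @ \oo --> (f z : C^o)].

(* For an entire f, the set power_series_of f is a singleton; the value 0 is
   only used when f is not entire. *)
Definition entire_coef f : nat -> C := xget (fun=> 0) (power_series_of f).

End WeierstrassSigma.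

Section FunctionalCalculus.
Variable R : realType.
Local Notation C := R[i].

(* Limits in a finite dimensional complex vector space, for its canonical
   topology: coordinatewise in a basis. *)
Definition vlim (E : vectType C) (u : nat -> E) : E :=
  let e := vbasis {:E} in
  \sum_(i < \dim {:E}) limn (fun n => coord e i (u n) : C^o) *: e`_i.

Variable E : vectType C.
Implicit Types A : 'End(E).

Definition lfun_exp A (k : nat) : 'End(E) :=
  iter k (fun B => (A \o B)%VF) \1%VF.

Definition entire_app (f : C -> C) A : 'End(E) :=
  vlim (fun n => \sum_(k < n) entire_coef f k *: lfun_exp A k).

Definition sigma_operator A : Prop := entire_app (@sigma R) A = 0.

Definition eigen_pq A (pq : int * int) : {vspace E} :=
  passmx.leigenspace A (lattice_pt R pq.1 pq.2).

(* The sums are indexed by infinite sets, but A has finitely many eigenvalues,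
   hence they have finitely many nonzero terms. *)
Definition weight_of A (n : int) : {vspace E} :=
  (\big[addv/0%VS]_(pq \in [set pq : int * int | (pq.1 + pq.2 <= n)%R])
     eigen_pq A pq)%VS.

Definition hodge_of A (p : int) : {vspace E} :=
  (\big[addv/0%VS]_(kq \in [set kq : int * int | (p <= kq.1)%R]) eigen_pq A kq)%VS.

End FunctionalCalculus.

(* The complexification of V: the pair (v, w) stands for v (x) 1 + w (x) i. *)
Definition cplx (R : realType) (V : vectType R) : Type := (V * V)%type.

Section Complexification.
Variables (R : realType) (V : vectType R).
Local Notation C := R[i].

HB.instance Definition _ := GRing.Zmodule.copy (cplx V) (V * V)%type.

Definition cplx_scale (a : C) (x : cplx V) : cplx V :=
  (complex.Re a *: x.1 - complex.Im a *: x.2,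
   complex.Im a *: x.1 + complex.Re a *: x.2).

Fact cplx_scaleA a b (x : cplx V) :
  cplx_scale a (cplx_scale b x) = cplx_scale (a * b) x.
Proof.
case: a b x => [a1 a2] [b1 b2] [x1 x2].
rewrite /cplx_scale/= !scalerBr !scalerDr !scalerA.
rewrite !(scalerBl, scalerDl) !opprD.
congr (_, _).
  by rewrite addrACA.
by rewrite [LHS]addrC addrACA.
Qed.

Fact cplx_scale1 : left_id 1 cplx_scale.
Proof.
by case=> x1 x2; rewrite /cplx_scale/= !scale1r !scale0r subr0 add0r.
Qed.

Fact cplx_scaleDr : right_distributive cplx_scale +%R.
Proof.
move=> a [x1 x2] [y1 y2]; rewrite /cplx_scale/=; congr (_, _) => /=.
  by rewrite !scalerDr opprD addrACA.
by rewrite !scalerDr addrACA.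
Qed.

Fact cplx_scaleDl (x : cplx V) : {morph cplx_scale^~ x : a b / a + b}.
Proof.
case: x => x1 x2 [a1 a2] [b1 b2]; rewrite /cplx_scale/=; congr (_, _) => /=.
  by rewrite !scalerDl opprD addrACA.
by rewrite !scalerDl addrACA.
Qed.

HB.instance Definition _ := GRing.Zmodule_isLmodule.Build C (cplx V)
  cplx_scaleA cplx_scale1 cplx_scaleDr cplx_scaleDl.

Fact cplx_vect_iso : Vector.axiom (dim V) (cplx V).
Proof.
pose f (x : cplx V) : 'rV[C]_(dim V) :=
  \row_j (v2r x.1 0 j +i* v2r x.2 0 j).
pose g (w : 'rV[C]_(dim V)) : cplx V :=
  (r2v (map_mx (@complex.Re R) w), r2v (map_mx (@complex.Im R) w)).
exists f.
  move=> a [x1 x2] [y1 y2]; apply/rowP => j; case: a => a1 a2.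
  rewrite !mxE /= !linearD /= !linearN /= !linearZ /= !mxE.
  by apply/eqP; rewrite eq_complex /= mulrN eqxx /= [a1 * _ + _]addrC.
exists g => [[x1 x2]|w].
  by congr (_, _); apply: (canLR v2rK); apply/rowP => j; rewrite !mxE.
by apply/rowP => j; rewrite !mxE !r2vK !mxE; case: (w 0 j).
Qed.

HB.instance Definition _ := Lmodule_hasFinDim.Build C (cplx V) cplx_vect_iso.

Definition of_real (v : V) : cplx V := (v, 0).

Definition cconj (x : cplx V) : cplx V := (x.1, - x.2).

Definition conjv (U : {vspace cplx V}) : {vspace cplx V} :=
  <<map cconj (vbasis U)>>%VS.

Definition cplxv (W : {vspace V}) : {vspace cplx V} :=
  <<map of_real (vbasis W)>>%VS.

Lemma mem_conjv x U : (x \in conjv U) = (cconj x \in U).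
Proof.
have cconjK : involutive cconj by case=> y z; rewrite /cconj /= opprK.
have cconj_sum (I : Type) (r : seq I) (k : I -> C) (h : I -> cplx V) :
    cconj (\sum_(i <- r) k i *: h i) = \sum_(i <- r) conjc (k i) *: cconj (h i).
  elim: r => [|i r IHr]; first by rewrite !big_nil /cconj /= oppr0.
  rewrite !big_cons -IHr; case: (k i) => a b.
  rewrite /cconj /= /GRing.scale /= /cplx_scale /=; congr (_, _) => /=.
    by rewrite !scaleNr scalerN opprK.
  by rewrite scalerN scaleNr !opprD.
have le_mem y (W : {vspace cplx V}) : y \in conjv W -> cconj y \in W.
  pose X := in_tuple (map cconj (vbasis W)).
  rewrite -[conjv W]/(<<X>>%VS) => /coord_span->; rewrite cconj_sum.
  apply: memv_suml => i _; apply: memvZ.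
  have /mapP[z zW ->] : X`_i \in map cconj (vbasis W) by rewrite mem_nth.
  by rewrite cconjK vbasis_mem.
have mem_le y (W : {vspace cplx V}) : cconj y \in W -> y \in conjv W.
  move=> Wy; rewrite -[y]cconjK (coord_vbasis Wy) cconj_sum.
  apply: memv_suml => i _; apply/memvZ/memv_span/map_f.
  by rewrite mem_nth // size_tuple.
by apply/idP/idP; [apply: le_mem|apply: mem_le].
Qed.

Lemma mem_cplxv x W : (x \in cplxv W) = (x.1 \in W) && (x.2 \in W).
Proof.
have in_real v : v \in W -> of_real v \in cplxv W.
  move=> Wv; have -> : of_real v =
      \sum_i (coord (vbasis W) i v)%:C *: of_real (vbasis W)`_i.
    rewrite {1}(coord_vbasis Wv).
    elim: (index_enum _) => [|i r IHr]; first by rewrite !big_nil.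
    rewrite !big_cons -IHr /of_real /GRing.scale /= /cplx_scale /=.
    by congr (_, _) => /=; rewrite !(scaler0, scale0r, subr0, add0r, addr0).
  apply: memv_suml => i _; apply/memvZ/memv_span/map_f.
  by rewrite mem_nth // size_tuple.
apply/idP/andP => [|[W1 W2]].
  pose X := in_tuple (map of_real (vbasis W)).
  rewrite -[cplxv W]/(<<X>>%VS) => /coord_span->.
  pose P (y : cplx V) := y.1 \in W /\ y.2 \in W.
  apply: (big_ind P) => [|y z [? ?] [? ?]|i _].
  - by split; apply: mem0v.
  - by split; apply: memvD.
  have /mapP[z /vbasis_mem zW ->] : X`_i \in map of_real (vbasis W)
    by rewrite mem_nth.
  by split; rewrite /= scaler0 ?subr0 ?addr0 memvZ.
have -> : x = of_real x.1 + 'i *: of_real x.2.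
  case: x {W1 W2} => x1 x2; rewrite /of_real /GRing.scale /= /cplx_scale /=.
  by congr (_, _) => /=; rewrite !(scaler0, scale0r, scale1r, subr0, addr0, add0r).
by apply: memvD; rewrite ?memvZ ?in_real.
Qed.

Definition conj_end (A : 'End(cplx V)) : 'End(cplx V) :=
  linfun (fun x => cconj (A (cconj x))).

Lemma conj_endE A x : conj_end A x = cconj (A (cconj x)).
Proof.
have cconjD : {morph cconj : x y / x + y}.
  by move=> [? ?] [? ?]; rewrite /cconj /= opprD.
have cconjZ a y : cconj (a *: y) = conjc a *: cconj y.
  case: a y => a b [u v]; rewrite /cconj /GRing.scale /= /cplx_scale /=.
  congr (_, _); first by rewrite scaleNr scalerN opprK.
  by rewrite scalerN scaleNr opprD.
have cconjA_linear : linear (fun x => cconj (A (cconj x))).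
  by move=> a u v; rewrite cconjD cconjZ linearD linearZ cconjD cconjZ conjcK.
pose cA := GRing.isLinear.Build _ _ _ _ _ cconjA_linear.
pose cAL : {linear _ -> _} := HB.pack (fun x => cconj (A (cconj x))) cA.
exact: (lfunE cAL).
Qed.

End Complexification.

Definition cplx_hom (R : realType) (V H : vectType R) (f : 'Hom(V, H)) :
  'Hom(cplx V, cplx H) := linfun (fun x : cplx V => (f x.1, f x.2) : cplx H).

Lemma cplx_homE (R : realType) (V H : vectType R) (f : 'Hom(V, H)) x :
  cplx_hom f x = (f x.1, f x.2).
Proof.
have f_linear : linear (fun x : cplx V => (f x.1, f x.2) : cplx H).
  move=> a u v; rewrite /GRing.scale /= /cplx_scale /=.
  by congr (_, _); rewrite /= !linearD ?linearN !linearZ.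
pose fl := GRing.isLinear.Build _ _ _ _ _ f_linear.
pose fL : {linear _ -> _} :=
  HB.pack (fun x : cplx V => (f x.1, f x.2) : cplx H) fl.
exact: (lfunE fL).
Qed.

Definition strongly_pseudo_real (R : realType) (V : vectType R)
    (A : 'End(cplx V)) : Prop :=
  forall p q r s : int, p <= r \/ q <= s ->
    (entire_app (@sigma_quot R r s) A \o
      ((conj_end A - A) \o entire_app (@sigma_quot R p q) A))%VF = 0.

Definition strongly_pseudo_real_sigma_operators (R : realType)
    (V : vectType R) : set 'End(cplx V) :=
  [set A | sigma_operator A /\ strongly_pseudo_real A].

Section Filtrations.
Variables (K : fieldType) (E : vectType K).
Implicit Types W F : int -> {vspace E}.

Definition increasing_filtration W : Prop :=
  forall m n : int, m <= n -> (W m <= W n)%VS.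

Definition decreasing_filtration F : Prop :=
  forall p q : int, p <= q -> (F q <= F p)%VS.

Definition finite_increasing_filtration W : Prop :=
  [/\ increasing_filtration W,
      exists a : int, forall n, n <= a -> W n = 0%VS &
      exists b : int, forall n, b <= n -> W n = fullv].

Definition finite_decreasing_filtration F : Prop :=
  [/\ decreasing_filtration F,
      exists a : int, forall p, p <= a -> F p = fullv &
      exists b : int, forall p, b <= p -> F p = 0%VS].

End Filtrations.

Definition pure_real_hodge (R : realType) (H : vectType R) (n : int)
    (F : int -> {vspace cplx H}) : Prop :=
  finite_decreasing_filtration F /\
  forall p q : int, p + q = n + 1 ->
    (F p + conjv (F q))%VS = fullv /\ (F p :&: conjv (F q))%VS = 0%VS.

Section MixedHodge.
Variables (R : realType) (V : vectType R).
Implicit Types (W : int -> {vspace V}) (F : int -> {vspace cplx V}).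

(* There is no quotient vector space in the library: W n / W (n - 1) is
   represented by a complement of W (n - 1) in W n, together with the
   projection along W (n - 1) as quotient map (gr_proj_eq0, gr_proj_onto). *)
Definition Gr W (n : int) : vectType R := subvs_of (W n :\: W (n - 1))%VS.

Definition gr_proj W n : 'Hom(V, Gr W n) :=
  (linfun (vsproj (W n :\: W (n - 1))%VS) \o addv_pi1 (W n) (W (n - 1)))%VF.

Lemma gr_proj_eq0 W n v : v \in W n ->
  (gr_proj W n v == 0) = (v \in W (n - 1)).
Proof.
move=> Wv; rewrite comp_lfunE lfunE /= -(inj_eq val_inj) /= vsprojK ?memv_pi //.
have Wv' : v \in (W n + W (n - 1))%VS by rewrite (subvP (addvSl _ _)).
apply/eqP/idP => [v0|W'v].
  by rewrite -(addv_pi1_pi2 Wv') v0 add0r memv_pi2.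
have := addv_pi1_pi2 Wv'; rewrite (addv_pi2_id _ W'v).
by move/(canRL (addrK v)); rewrite subrr => ->.
Qed.

Lemma gr_proj_onto W n y : exists2 v, v \in W n & gr_proj W n v = y.
Proof.
exists (val y); first exact: (subvP (diffvSl _ (W (n - 1)))) (subvsP y).
rewrite comp_lfunE lfunE /=; apply: val_inj; rewrite /= vsprojK ?memv_pi //.
by rewrite daddv_pi_id ?subvsP // capv_diff.
Qed.

Definition gr_hodge W F (n p : int) : {vspace cplx (Gr W n)} :=
  (cplx_hom (gr_proj W n) @: (F p :&: cplxv (W n)))%VS.

Definition real_mhs W F : Prop :=
  [/\ finite_increasing_filtration W,
      finite_decreasing_filtration F &
      forall n, pure_real_hodge n (gr_hodge W F n)].

End MixedHodge.

(* Main.v *)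
Require Import Defs.
From HB Require Import structures.
From mathcomp Require Import all_boot all_order all_algebra finmap.
From mathcomp Require Import complex.
From mathcomp Require Import all_classical all_reals all_analysis.
From mathcomp Require Import summability.
From mathcomp Require Import separable cyclic cyclotomic.
From mathcomp Require Import ring lra zify.

Set Implicit Arguments.
Unset Strict Implicit.
Unset Printing Implicit Defensive.

Import Order.TTheory GRing.Theory Num.Theory.
Import numFieldNormedType.Exports.
Import ComplexField.Normc.

Local Open Scope classical_set_scope.
Local Open Scope complex_scope.
Local Open Scope ring_scope.

(** The statement has an analytic half and a linear algebra half, which meet in
    the notion of a grading by pairs of integers.

    Analytic half.  The sum of |lambda|^-3 over the lattice converges, so the
    product defining sigma converges locally uniformly; sigma is entire, it
    vanishes exactly on the lattice, and all its zeros are simple.  Hence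
    sigma(A) = 0 if and only if A is diagonalizable with eigenvalues in the
    lattice, and then sigma_{m,n}(A) is a nonzero multiple of the projection
    onto the eigenspace I^{m,n}.  To keep complex analysis elementary, an
    entire function is handled as a locally uniform limit of polynomials
    (disc_approx): this class is visibly closed under products, composition
    with polynomials and locally uniform limits, and power series come back
    through the Cauchy estimate, which for polynomials is an average over roots
    of unity (cauchy_estimate, disc_approx_power_series).  The same estimate
    shows that p |-> p(A) is continuous for the sup norm on a large disc, so
    f(A) is the limit of p(A) for any polynomials p tending to f
    (entire_app_approx); this gives f(A)v = f(mu)v on eigenvectors and
    f(A) = h(A)(A - mu) when f = (z - mu)h, which is all the functional calculus
    that is needed (annihilator_decomp, sigma_factorization,
    sigma_operator_grading, sigma_quot_op).

    Linear algebra half.  By the above a sigma-operator is the same thing as a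
    grading of V_C by pairs (p,q), namely A = lambda_{p,q} on I^{p,q}.  Strong
    pseudo-reality says that conj(A) - A lowers both indices strictly, and this
    is equivalent to the property of the bigrading that Deligne attached to a
    mixed Hodge structure:
      conj(I^{p,q}) is contained in I^{q,p} + sum_{r < q, s < p} I^{r,s}
    (spr_sigma_deligne).  So the theorem becomes Deligne's theorem that mixed
    Hodge structures correspond to such bigradings.

    - A bigrading with this property gives a mixed Hodge structure: modulo
      W_{n-1} conjugation exchanges I^{p,q} and I^{q,p} (sigma_operator_mhs).
    - The bigrading is determined by the filtrations.  The components of an
      element of I^{p,q} for another bigrading with the same filtrations are
      bounded on one side because it lies in F^p and in W_{p+q}, and on the other
      because its conjugate lies in I^{q,p} up to smaller indices; only the index
      (p,q) is left (eigen_le_of_filtrations).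
    - Every mixed Hodge structure has such a bigrading.  With
      T(p,m) = sum_{s <= m+1-p} conj(F^s) /\ W_{s+p-1}, purity of the graded
      pieces gives W_m = (F^p /\ W_m) (+) T(p,m) (weight_decomp,
      hodge_opp_cap), and then
      I^{p,q} = F^p /\ W_n /\ (conj(F^q) /\ W_n + T(p,n-1)) with n = p + q
      works (deligne_splitting). *)

(** * The modulus and limits in the complex numbers *)

Section ComplexBasics.
Variable R : realType.
Local Notation C := R[i].
Implicit Types (x y z : C).

Lemma normc_ge0 x : 0 <= normc x.
Proof. by case: x => a b; apply: sqrtr_ge0. Qed.

Lemma normr_normc x : `|x| = (normc x)%:C.
Proof. by case: x. Qed.

Lemma normcD_le x y : normc (x + y) <= normc x + normc y.
Proof. exact: le_normcD. Qed.

Lemma normc_opp x : normc (- x) = normc x.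
Proof. exact: normcN. Qed.

Lemma normc_distC x y : normc (x - y) = normc (y - x).
Proof. by rewrite -normc_opp opprB. Qed.

Lemma normcX x n : normc (x ^+ n) = normc x ^+ n.
Proof. by elim: n => [|n IH]; rewrite ?normc1 // !exprS normcM IH. Qed.

Lemma normc_sum (I : Type) (r : seq I) (P : pred I) (F : I -> C) :
  normc (\sum_(i <- r | P i) F i) <= \sum_(i <- r | P i) normc (F i).
Proof.
elim/big_rec2: _ => [|i y1 y2 _ le12]; first by rewrite normc0.
by rewrite (le_trans (normcD_le _ _)) // lerD2l.
Qed.

Lemma normc_real (a : R) : normc a%:C = `|a|.
Proof. by rewrite /= expr0n /= addr0 sqrtr_sqr. Qed.

Lemma normc_nat n : normc (n%:R : C) = n%:R.
Proof.
have -> : (n%:R : C) = (n%:R : R)%:C by rewrite rmorph_nat.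
by rewrite normc_real ger0_norm.
Qed.

Lemma normc_eq0 x : (normc x == 0) = (x == 0).
Proof. by apply/eqP/eqP => [/eq0_normc//|->]; rewrite normc0. Qed.

Lemma normc_gt0 x : (0 < normc x) = (x != 0).
Proof. by rewrite lt_def normc_ge0 andbT normc_eq0. Qed.

Lemma normc_dist_triangle x y z : normc (x - z) <= normc (x - y) + normc (y - z).
Proof. by apply: le_trans (normcD_le _ _); rewrite addrA subrK. Qed.

Lemma Re_le_normc x : `|complex.Re x| <= normc x.
Proof. by have := normc_ge_Re x; rewrite normr_normc lecR. Qed.

Lemma Im_le_normc x : `|complex.Im x| <= normc x.
Proof.
have := Re_le_normc (x * 'i); rewrite ReiNIm normrN normcM.
by rewrite /= expr0n /= add0r expr1n sqrtr1 mulr1.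
Qed.

Lemma normc_le_ReIm x : normc x <= `|complex.Re x| + `|complex.Im x|.
Proof.
rewrite {1}(complexE x) (le_trans (normcD_le _ _))// normcM !normc_real.
by rewrite /= expr0n /= add0r expr1n sqrtr1 mul1r.
Qed.

Lemma normc_eps_eq (x y : C) : (forall e : R, 0 < e -> normc (x - y) <= e) -> x = y.
Proof.
move=> H; apply/eqP; rewrite -subr_eq0 -normc_eq0 eq_le normc_ge0 andbT.
by apply/ler_addgt0Pr => e e0; rewrite add0r H.
Qed.

(** Norms in the complex numbers have complex values; this lets every later
    estimate be a real inequality between values of normc. *)
Lemma cvgC_distP (T : Type) (F : set_system T) (FF : Filter F) (f : T -> C) l :
  (f x : C^o) @[x --> F] --> (l : C^o) <->
  (forall e : R, 0 < e -> \forall x \near F, normc (l - f x) <= e).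
Proof.
split=> [/cvgrPdist_le fl e e0|H].
  have := fl e%:C; rewrite ltcR => /(_ e0); apply: filterS => x.
  by rewrite normr_normc lecR.
apply/cvgrPdist_le => e e0.
have eE : e = (complex.Re e)%:C by rewrite RRe_real // gtr0_real.
move: e0; rewrite eE ltcR => /H; apply: filterS => x.
by rewrite normr_normc lecR.
Qed.

Lemma cvgC_lim (T : Type) (F : set_system T) (FF : ProperFilter F)
    (f : T -> C) l :
  (forall e : R, 0 < e -> \forall x \near F, normc (l - f x) <= e) ->
  lim ((f x : C^o) @[x --> F]) = l.
Proof.
move=> /(cvgC_distP FF) fl; apply: cvg_lim fl.
exact: norm_hausdorff.
Qed.

(** Completeness is inherited from the real numbers through the real and
    imaginary parts. *)
Lemma cauchyC (T : Type) (F : set_system T) (FF : ProperFilter F) (f : T -> C) :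
  (forall e : R, 0 < e -> exists c, \forall x \near F, normc (c - f x) <= e) ->
  exists l, forall e : R, 0 < e -> \forall x \near F, normc (l - f x) <= e.
Proof.
move=> fC.
have cvR (g : C -> R) : (forall x y, `|g x - g y| <= normc (x - y)) ->
    exists l : R, forall e : R, 0 < e -> \forall x \near F, `|l - g (f x)| <= e.
  move=> glip.
  have /cauchy_cvgP : cauchy (g (f x) @[x --> F]).
    apply/cauchy_exP => e e0.
    have [c fc] := fC (e / 2) (divr_gt0 e0 (ltr0Sn _ 1)).
    exists (g c); rewrite /= /nbhs /=; apply: filterS fc => x cx.
    rewrite /ball /= (le_lt_trans (glip _ _)) // (le_lt_trans cx) //.
    by rewrite ltr_pdivrMr // ltr_pMr // ltr1n.
  move=> /cvg_ex[l /cvgrPdist_le ?]; by exists l.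
have [a Ha] : exists l : R, forall e : R, 0 < e ->
    \forall x \near F, `|l - complex.Re (f x)| <= e.
  apply: (cvR (@complex.Re R)) => x y; rewrite -raddfB; exact: Re_le_normc.
have [b Hb] : exists l : R, forall e : R, 0 < e ->
    \forall x \near F, `|l - complex.Im (f x)| <= e.
  apply: (cvR (@complex.Im R)) => x y; rewrite -raddfB; exact: Im_le_normc.
exists (a +i* b) => e e0.
have e20 : 0 < e / 2 by rewrite divr_gt0.
near=> x.
rewrite (le_trans (normc_le_ReIm _)) //.
have -> : e = e / 2 + e / 2 by rewrite -splitr.
by rewrite !raddfB /= lerD //; near: x; [apply: Ha|apply: Hb].
Unshelve. all: by end_near.
Qed.

Lemma cauchyC_seq (u : nat -> C) :
  (forall e : R, 0 < e -> exists N, forall n, (N <= n)%N -> normc (u N - u n) <= e) ->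
  exists l, forall e : R, 0 < e ->
    exists N, forall n, (N <= n)%N -> normc (l - u n) <= e.
Proof.
move=> uC; have [|l ul] := @cauchyC _ \oo _ u.
  by move=> e /uC[N HN]; exists (u N); exists N.
by exists l => e /ul[N _ HN]; exists N.
Qed.

Lemma seqC_cvg (u : nat -> C) l : (forall e : R, 0 < e ->
    exists N, forall n, (N <= n)%N -> normc (l - u n) <= e) ->
  (u n : C^o) @[n --> \oo] --> (l : C^o).
Proof. by move=> ul; apply/cvgC_distP => e /ul[N HN]; exists N. Qed.

Lemma seqC_cvgP (u : nat -> C) l : (u n : C^o) @[n --> \oo] --> (l : C^o) ->
  forall e : R, 0 < e -> exists N, forall n, (N <= n)%N -> normc (l - u n) <= e.
Proof. by move=> /cvgC_distP ul e /ul[N _ HN]; exists N. Qed.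

Lemma seqC_lim (u : nat -> C) l : (forall e : R, 0 < e ->
    exists N, forall n, (N <= n)%N -> normc (l - u n) <= e) ->
  limn (fun n => u n : C^o) = l.
Proof. by move=> ul; apply: cvgC_lim => e /ul[N HN]; exists N. Qed.

End ComplexBasics.

(** * Locally uniform limits of polynomials and power series *)

Section DiscApproximation.
Variable R : realType.
Local Notation C := R[i].
Implicit Types (z : C) (f g : C -> C) (p q : {poly C}) (r e : R).

Lemma horner_bounded p r : exists2 M, 0 < M &
  forall z, normc z <= r -> normc p.[z] <= M.
Proof.
exists (1 + \sum_(i < size p) normc p`_i * `|r| ^+ i) => [|z zr].
  by rewrite ltr_pwDl // sumr_ge0 // => i _; rewrite mulr_ge0 ?normc_ge0.
rewrite horner_coef (le_trans (normc_sum _ _ _)) //.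
rewrite (@le_trans _ _ (\sum_(i < size p) normc p`_i * `|r| ^+ i)) ?lerDr //.
apply: ler_sum => i _; rewrite normcM normcX ler_wpM2l ?normc_ge0 //.
by rewrite lerXn2r ?nnegrE ?normc_ge0 // (le_trans zr) ?ler_norm.
Qed.

Lemma prim_rootC n : (0 < n)%N -> exists z : C, n.-primitive_root z.
Proof.
move=> n0; pose p : {poly C} := 'X^n - 1.
have [s Dp] := closed_field_poly_normal p.
rewrite (monicP _) ?monicXnsubC // scale1r in Dp.
have sn1 : all n.-unity_root s.
  by apply/allP=> z; rewrite -root_prod_XsubC -Dp.
have sz_s : (n < (size s).+1)%N by rewrite -(size_prod_XsubC s id) -Dp size_XnsubC.
have [|z] := hasP (has_prim_root n0 sn1 _ sz_s); last by exists z.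
by rewrite -separable_prod_XsubC -Dp separable_Xn_sub_1 // pnatr_eq0 -lt0n.
Qed.

(** Orthogonality of characters: when i differs from k the sum is geometric of
    ratio w^(i-k), an n-th root of unity other than 1. *)
Lemma prim_root_sum n (w : C) (i k : 'I_n) : n.-primitive_root w ->
  \sum_(j < n) w ^+ (i * j) / w ^+ (k * j) = (n * (i == k))%:R.
Proof.
move=> wn; have w0 : w != 0.
  by rewrite (prim_root_eq0 wn) -lt0n (leq_ltn_trans _ (ltn_ord i)).
have [->|nik] := eqVneq i k.
  under eq_bigr do rewrite divff ?expf_neq0 //.
  by rewrite big_const_ord iter_addr addr0 muln1.
pose u := w ^+ i / w ^+ k.
have -> : \sum_(j < n) w ^+ (i * j) / w ^+ (k * j) = \sum_(j < n) u ^+ j.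
  by apply: eq_bigr => j _; rewrite /u exprMn exprVn !exprM.
have un : u ^+ n = 1.
  by rewrite exprMn exprVn -!exprM ![(_ * n)%N]mulnC !exprM (prim_expr_order wn) !expr1n divr1.
have u1 : u - 1 != 0.
  rewrite subr_eq0; apply: contra nik => /eqP/(canRL (divfK _)).
  rewrite expf_neq0 // mul1r => /(_ isT)/eqP.
  by rewrite (eq_prim_root_expr wn) !modn_small // => /eqP/val_inj ->.
by rewrite muln0; apply/(mulfI u1); rewrite -subrX1 un subrr mulr0.
Qed.

(** Averaging p(r w^j) w^(-kj) over the powers of a primitive root of unity w
    of order the size of p isolates the coefficient of degree k. *)
Lemma cauchy_estimate p r M k : 0 < r ->
  (forall z, normc z <= r -> normc p.[z] <= M) -> normc p`_k * r ^+ k <= M.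
Proof.
move=> r0 pM; have M0 : 0 <= M.
  by rewrite (le_trans (normc_ge0 p.[0])) // pM // normc0 ltW.
have [kp|/(nth_default 0)->] := ltnP k (size p); last by rewrite normc0 mul0r.
set n := size p in kp; have n0 : (0 < n)%N by apply: leq_ltn_trans kp.
have [w wn] := prim_rootC n0; pose k' := Ordinal kp.
have w1 : normc w = 1.
  apply/eqP; rewrite -(@eqrXn2 _ n) ?normc_ge0 // -normcX.
  by rewrite (prim_expr_order wn) normc1 expr1n.
have key : n%:R * (p`_k * r%:C ^+ k) =
    \sum_(j < n) p.[r%:C * w ^+ j] / w ^+ (k * j).
  under eq_bigr do rewrite horner_coef mulr_suml.
  rewrite exchange_big /=.
  transitivity (\sum_(i < n) p`_i * r%:C ^+ i *
      \sum_(j < n) w ^+ (i * j) / w ^+ (k' * j)).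
    under eq_bigr do rewrite (prim_root_sum _ _ wn).
    rewrite (bigD1 k') //= eqxx muln1 big1 ?addr0 1?mulrC // => i /negPf ->.
    by rewrite muln0 mulr0.
  apply: eq_bigr => i _; rewrite mulr_sumr; apply: eq_bigr => j _.
  by rewrite exprMn -exprM mulrA mulnC [(k * j)%N]mulnC !mulrA.
have : n%:R * (normc p`_k * r ^+ k) <= n%:R * M.
  have -> : n%:R * (normc p`_k * r ^+ k) = normc (n%:R * (p`_k * r%:C ^+ k)).
    by rewrite !normcM normc_nat normcX normc_real gtr0_norm.
  rewrite key (le_trans (normc_sum _ _ _)) // mulr_natl -[X in M *+ X]card_ord -sumr_const.
  apply: ler_sum => j _; rewrite normcM normcV normcX w1 expr1n invr1 mulr1.
  by rewrite pM // normcM normcX w1 expr1n mulr1 normc_real gtr0_norm.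
by rewrite ler_pM2l // ltr0n.
Qed.

(** Entire functions, as locally uniform limits of polynomials: no power series
    has to be multiplied or composed to see that the class is stable. *)
Definition disc_approx f : Prop :=
  forall r e, 0 < e -> exists p, forall z, normc z <= r -> normc (f z - p.[z]) <= e.

Lemma disc_approx_poly p : disc_approx (fun z => p.[z]).
Proof. by move=> r e e0; exists p => z _; rewrite subrr normc0 ltW. Qed.

Lemma disc_approx_lim f : (forall r e, 0 < e -> exists2 g, disc_approx g &
    forall z, normc z <= r -> normc (f z - g z) <= e) -> disc_approx f.
Proof.
move=> fg r e e0; have e20 : 0 < e / 2 by rewrite divr_gt0.
have [g gH gr] := fg r _ e20; have [p pr] := gH r _ e20; exists p => z zr.
by rewrite (le_trans (normc_dist_triangle _ (g z) _)) // (splitr e) lerD ?gr ?pr.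
Qed.

Lemma disc_approx_bounded f r : disc_approx f ->
  exists2 M, 0 < M & forall z, normc z <= r -> normc (f z) <= M.
Proof.
move=> fH; have [p pr] := fH r 1 ltr01; have [M M0 pM] := horner_bounded p r.
exists (1 + M) => [|z zr]; first by rewrite addr_gt0.
by rewrite -(subrK p.[z] (f z)) (le_trans (normcD_le _ _)) // lerD ?pr ?pM.
Qed.

Lemma disc_approxM f g : disc_approx f -> disc_approx g ->
  disc_approx (fun z => f z * g z).
Proof.
move=> fH gH r e e0; have [Mf Mf0 fM] := disc_approx_bounded r fH.
have [q0 q0r] := gH r 1 ltr01.
have [Mg Mg0 gM] := disc_approx_bounded r gH.
have [p pr] := fH r (e / 2 / (Mg + 1)) ltac:(by rewrite !divr_gt0 ?addr_gt0).
have [q qr] := gH r (Num.min 1 (e / 2 / Mf)) ltac:(by rewrite lt_min ltr01 !divr_gt0).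
exists (p * q) => z zr; rewrite hornerM.
have -> : f z * g z - p.[z] * q.[z] =
  f z * (g z - q.[z]) + (f z - p.[z]) * q.[z] by ring.
have := qr z zr; rewrite le_min => /andP[q1 q2].
have qM : normc q.[z] <= Mg + 1.
  rewrite -(subrK (g z) q.[z]) (le_trans (normcD_le _ _)) // addrC lerD ?gM //.
  by rewrite normc_distC.
rewrite (le_trans (normcD_le _ _)) // !normcM (splitr e) lerD //.
  by rewrite -(@divfK _ Mf _ (e / 2)) ?gt_eqF // mulrC ler_pM ?normc_ge0 ?fM.
by rewrite -(@divfK _ (Mg + 1) _ (e / 2)) ?gt_eqF ?addr_gt0 // ler_pM ?normc_ge0 ?pr.
Qed.

Lemma disc_approx_prod (I : Type) (s : seq I) (P : pred I) (F : I -> C -> C) :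
  (forall i, disc_approx (F i)) ->
  disc_approx (fun z => \prod_(i <- s | P i) F i z).
Proof.
move=> FH; elim: s => [|i s IH].
  move=> r e e0; exists 1 => z _.
  by rewrite big_nil hornerE subrr normc0 ltW.
have [Pi|nPi] := boolP (P i); last first.
  by move=> r e /(IH r)[p pr]; exists p => z zr; rewrite big_cons (negPf nPi) pr.
move=> r e /(disc_approxM (FH i) IH r)[p pr].
by exists p => z zr; rewrite big_cons Pi pr.
Qed.

Lemma disc_approx_comp f p : disc_approx f -> disc_approx (fun z => f p.[z]).
Proof.
move=> fH r e e0; have [M _ pM] := horner_bounded p r.
have [q qM] := fH M e e0; exists (q \Po p) => z zr.
by rewrite horner_comp qM ?pM.
Qed.

(** A polynomial approximating f near a is Lipschitz there, because
    p - p(a) is divisible by X - a. *)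
Lemma disc_approx_cont f (a : C) e : disc_approx f -> 0 < e ->
  exists2 d, 0 < d & forall w, normc (w - a) <= d -> normc (f w - f a) <= e.
Proof.
move=> fH e0; have e30 : 0 < e / 3 by rewrite divr_gt0.
have [p pr] := fH (normc a + 1) (e / 3) e30.
have /factor_theorem[q qE] : root (p - p.[a]%:P) a by rewrite /root !hornerE subrr.
have [M M0 qM] := horner_bounded q (normc a + 1).
exists (Num.min 1 (e / 3 / M)) => [|w]; first by rewrite lt_min ltr01 divr_gt0.
rewrite le_min => /andP[w1 w2].
have wa : normc w <= normc a + 1.
  by rewrite -(subrK a w) addrC (le_trans (normcD_le _ _)) // lerD2l.
have pwa : normc (p.[w] - p.[a]) <= e / 3.
  have -> : p.[w] - p.[a] = q.[w] * (w - a).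
    by have /(congr1 (horner^~ w)) := qE; rewrite !hornerE.
  by rewrite normcM -(@divfK _ M _ (e / 3)) ?gt_eqF // mulrC ler_pM ?normc_ge0 ?qM.
have -> : f w - f a = (f w - p.[w]) + (p.[w] - p.[a]) + (p.[a] - f a) by ring.
have -> : e = e / 3 + e / 3 + e / 3 by field.
rewrite (le_trans (normcD_le _ _)) // lerD //; last first.
  by rewrite normc_distC pr // lerDl.
by rewrite (le_trans (normcD_le _ _)) // lerD // pr.
Qed.

Lemma geometric_half_le (K L : nat) : (K <= L)%N ->
  \sum_(K <= k < L) (2^-1 : R) ^+ k <= 2 * 2^-1 ^+ K.
Proof.
move=> /subnK <-; set m := (L - K)%N.
suff -> : \sum_(K <= k < m + K) (2^-1 : R) ^+ k = 2 * 2^-1 ^+ K - 2 * 2^-1 ^+ (m + K).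
  by rewrite gerBl mulr_ge0 // exprn_ge0.
elim: m => [|m IH]; first by rewrite big_geq // subrr.
by rewrite big_nat_recr ?leq_addl //= IH addSn exprS; field.
Qed.

(** Take polynomials P n at distance 1/(n+1) from f on the disc of radius n+1.
    By the Cauchy estimate their coefficients of a fixed degree form a Cauchy
    sequence, and the limits c satisfy |c_k - (P n)_k| (n+1)^k <= 2/(n+1); on the
    disc of half that radius, summing a geometric series bounds the distance from
    P n to the partial sums of c. *)
Lemma disc_approx_power_series f : disc_approx f ->
  exists a : nat -> C, power_series_of f a.
Proof.
move=> fH.
have /choice[P fP] (n : nat) : exists p, forall z, normc z <= n.+1%:R ->
    normc (f z - p.[z]) <= n.+1%:R^-1.
  by apply: fH; rewrite invr_gt0.
have Pdist n m k : (n <= m)%N ->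
    normc ((P n)`_k - (P m)`_k) * n.+1%:R ^+ k <= 2 / n.+1%:R.
  move=> nm; rewrite -coefB; apply: cauchy_estimate => [//|z zn].
  have -> : (P n - P m).[z] = ((P n).[z] - f z) + (f z - (P m).[z]).
    by rewrite hornerD hornerN addrA subrK.
  rewrite (le_trans (normcD_le _ _)) // mulr2n mulrDl mul1r lerD //.
    by rewrite normc_distC fP.
  rewrite (le_trans (fP _ _ _)) ?(le_trans zn) ?ler_nat //.
  by rewrite lef_pV2 ?posrE // ler_nat.
have n1X n k : 1 <= n.+1%:R ^+ k :> R by rewrite exprn_ege1 // ler1n.
have arch e : 0 < e -> exists n : nat, e^-1 <= n.+1%:R.
  move=> e0; exists (Num.bound e^-1).
  have := archi_boundP (ltW e0 : 0 <= e); have := @archi_boundP R e^-1.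
  rewrite invr_ge0 ltW // => /(_ isT)/ltW h _.
  by rewrite (le_trans h) // ler_nat.
have /choice[c cP] (k : nat) : exists l : C, forall e, 0 < e ->
    exists N, forall n, (N <= n)%N -> normc (l - (P n)`_k) <= e.
  apply: cauchyC_seq => e e0.
  have [N eN] := arch (e / 2) (divr_gt0 e0 (ltr0Sn _ 1)); exists N => n Nn.
  have h := Pdist N n k Nn.
  have {}h : normc ((P N)`_k - (P n)`_k) <= 2 / N.+1%:R.
    by apply: le_trans h; rewrite ler_peMr ?normc_ge0.
  apply: le_trans h _; rewrite ler_pdivrMr //.
  by move: eN; rewrite invf_div ler_pdivrMr // mulrC.
have cdist n k : normc (c k - (P n)`_k) * n.+1%:R ^+ k <= 2 / n.+1%:R.
  apply/ler_addgt0Pr => e e0.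
  have nk0 : 0 < n.+1%:R ^+ k :> R by rewrite exprn_gt0.
  have [N HN] := cP k (e / n.+1%:R ^+ k) (divr_gt0 e0 nk0).
  pose m := maxn N n; have := HN m (leq_maxl _ _).
  rewrite ler_pdivlMr // => cm.
  have h := Pdist n m k (leq_maxr _ _).
  rewrite [leRHS]addrC (le_trans _ (lerD cm h)) // -mulrDl ler_pM2r //.
  by rewrite [normc ((P n)`_k - _)]normc_distC normc_dist_triangle.
exists c => z; apply: seqC_cvg => e e0.
have [n en] := arch (Num.min (e / 5) (normc z * 2 + 1)^-1) ltac:(
  by rewrite lt_min divr_gt0 //= invr_gt0 ltr_wpDl // mulr_ge0 ?normc_ge0).
exists (size (P n)) => K nK.
have n0 : 0 < n.+1%:R :> R by [].
have [e5 zn] : 5 / n.+1%:R <= e /\ normc z * 2 <= n.+1%:R.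
  move: en; rewrite -[X in _ <= X -> _]invrK lef_pV2 ?posrE ?invr_gt0 //; last first.
    by rewrite lt_min divr_gt0 //= invr_gt0 ltr_wpDl // mulr_ge0 ?normc_ge0.
  rewrite le_min ler_pdivlMr // mulrC => /andP[-> h]; split => //.
  move: h; rewrite lef_pV2 ?posrE ?ltr_wpDl ?mulr_ge0 ?normc_ge0 //.
  by apply: le_trans; rewrite lerDl.
rewrite /series /= big_mkord.
have zn1 : normc z <= n.+1%:R by rewrite (le_trans _ zn) // ler_peMr ?normc_ge0 // ler1n.
rewrite (le_trans (normc_dist_triangle _ (P n).[z] _)) // (le_trans _ e5) //.
have -> : 5 / n.+1%:R = n.+1%:R^-1 + 4 / n.+1%:R :> R by field; rewrite addrC natr1.
rewrite lerD ?fP // (horner_coef_wide z nK) -sumrB.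
rewrite (le_trans (normc_sum _ _ _)) //.
apply: (@le_trans _ _ (\sum_(k < K) (2 / n.+1%:R) * 2^-1 ^+ k)).
  apply: ler_sum => k _; rewrite -mulrBl normcM normcX normc_distC.
  have zk : normc z ^+ k <= n.+1%:R ^+ k * 2^-1 ^+ k.
    rewrite -exprMn lerXn2r ?nnegrE ?normc_ge0 ?mulr_ge0 //.
    by rewrite ler_pdivlMr.
  rewrite (le_trans (ler_wpM2l (normc_ge0 _) zk)) // mulrA ler_wpM2r //.
rewrite -mulr_sumr -(big_mkord xpredT (fun k => (2^-1 : R) ^+ k)).
have := geometric_half_le (leq0n K); rewrite expr0 mulr1 => h.
rewrite (le_trans (ler_wpM2l _ h)) ?divr_ge0 //.
by rewrite mulrAC -natrM.
Qed.

(** Convergence at the single point 2r bounds the terms there, hence makes the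
    series geometrically small on the disc of radius r. *)
Lemma power_series_unif f (a : nat -> C) r e : power_series_of f a -> 0 < e ->
  exists K0, forall K, (K0 <= K)%N -> forall z, normc z <= r ->
    normc (f z - \sum_(k < K) a k * z ^+ k) <= e.
Proof.
move=> fa e0; pose r1 := `|r| + 1.
have r10 : 0 < r1 by rewrite ltr_wpDl.
(* The comparison point: the series converges there, at twice the radius. *)
pose w : C := (2 * r1)%:C.
have wE : normc w = 2 * r1 by rewrite normc_real gtr0_norm // mulr_gt0.
have [M M0 aM] : exists2 M, 0 < M & forall k, normc (a k * w ^+ k) <= M.
  have [N HN] := seqC_cvgP (fa w) (@ltr01 R).
  exists (2 + \sum_(k < N) normc (a k * w ^+ k)).
    by rewrite ltr_pwDl // sumr_ge0 // => k _; rewrite normc_ge0.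
  move=> k; have [kN|Nk] := ltnP k N.
    rewrite (bigD1 (Ordinal kN)) //= addrCA lerDl addr_ge0 // sumr_ge0 // => i _.
    exact: normc_ge0.
  have -> : a k * w ^+ k = (f w - \sum_(k < k) a k * w ^+ k) -
     (f w - \sum_(k < k.+1) a k * w ^+ k) by rewrite big_ord_recr /=; ring.
  rewrite (le_trans (normcD_le _ _)) // normc_opp.
  rewrite -[leRHS]addr0 -addrA -[2]/(1 + 1) -addrA lerD ?addr_ge0 //.
  - by have := HN k Nk; rewrite /series /= big_mkord.
  - rewrite addr0 (@le_trans _ _ 1) //; first by have := HN _ (leqW Nk); rewrite /series /= big_mkord.
    by rewrite lerDl sumr_ge0 // => i _; rewrite normc_ge0.
pose K0 := Num.bound (2 * M / e).
exists K0 => K K0K z zr.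
have Ke : M * (2 * 2^-1 ^+ K) <= e.
  have h : 0 <= 2 * M / e by rewrite divr_ge0 ?mulr_ge0 ?ltW.
  rewrite mulrCA mulrA exprVn ler_pdivrMr ?exprn_gt0 // -ler_pdivrMl // mulrC.
  apply: ltW; apply: (lt_le_trans (archi_boundP h)).
  by rewrite -natrX ler_nat (leq_trans K0K) // ltnW // ltn_expl.
apply/ler_addgt0Pr => d d0.
have [N HN] := seqC_cvgP (fa z) d0.
pose L := maxn N K; have := HN L (leq_maxl _ _); rewrite /series /= big_mkord => fL.
rewrite [leRHS]addrC (le_trans (normc_dist_triangle _ (\sum_(k < L) a k * z ^+ k) _)) // lerD //.
rewrite -!(big_mkord xpredT (fun k => a k * z ^+ k)) (big_cat_nat (leq0n K) (leq_maxr N K)) /= addrAC subrr add0r.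
rewrite (le_trans (normc_sum _ _ _)) // (le_trans _ Ke) //.
apply: le_trans (ler_wpM2l (ltW M0) (geometric_half_le (leq_maxr N K))).
rewrite mulr_sumr; apply: ler_sum => k _.
have := aM k; rewrite !normcM !normcX wE => ak.
apply: le_trans (ler_wpM2r _ ak); last by rewrite exprn_ge0.
rewrite -mulrA ler_wpM2l ?normc_ge0 // -exprMn lerXn2r ?nnegrE ?normc_ge0 //.
  by rewrite mulr_ge0 // mulr_ge0 // ltW.
rewrite mulrAC divff // mul1r (le_trans zr) // /r1.
by rewrite (le_trans (ler_norm r)) // lerDl.
Qed.

End DiscApproximation.

(** * Linear forms on finite dimensional spaces *)

Section LinearForms.
Variable R : realType.
Local Notation C := R[i].
Variable X : vectType C.
Implicit Types (phi : X -> C) (u x y : X).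

Lemma scalar_lincomb phi n (a : 'I_n -> C) (u : 'I_n -> X) : scalar phi ->
  phi (\sum_i a i *: u i) = \sum_i a i * phi (u i).
Proof.
move=> phiL; have phi0 : phi 0 = 0.
  by have := phiL (-1) 0 0; rewrite scaler0 addr0 mulN1r addNr.
by elim/big_rec2: _ => // i y1 y2 _ <-; rewrite phiL.
Qed.

Lemma scalarB phi x y : scalar phi -> phi (x - y) = phi x - phi y.
Proof. by move=> phiL; rewrite addrC -scaleN1r phiL mulN1r addrC. Qed.

Lemma coord_scalar i : scalar (coord (vbasis {:X}) i).
Proof. by move=> a x y; rewrite linearP. Qed.

(** Limits in a vector space are only ever compared through linear forms. *)
Lemma vect_sep x y : (forall phi, scalar phi -> phi x = phi y) -> x = y.
Proof.
move=> xy; rewrite (coord_vbasis (memvf x)) (coord_vbasis (memvf y)).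
by apply: eq_bigr => i _; rewrite (xy _ (coord_scalar i)).
Qed.

(** Any linear map is bounded for the l^1 norm N of the coordinates in a
    basis. *)
Lemma iter_scalar_bound (T : {linear X -> X}) u phi : scalar phi ->
  exists c r : R, [/\ 0 < c, 0 < r & forall k, normc (phi (iter k T u)) <= c * r ^+ k].
Proof.
move=> phiL; pose e := vbasis {:X}.
pose N x : R := \sum_i normc (coord e i x).
have N0 x : 0 <= N x by rewrite sumr_ge0 // => i _; rewrite normc_ge0.
have bound (g : X -> R) : (forall x, 0 <= g x) ->
    (forall x, g x <= \sum_i normc (coord e i x) * g e`_i) ->
    exists2 m : R, 0 < m & forall x, g x <= m * N x.
  move=> g0 gS; exists (1 + \sum_(i < \dim {:X}) g e`_i).
    by rewrite ltr_pwDl // sumr_ge0.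
  move=> x; rewrite (le_trans (gS x)) // /N mulr_sumr; apply: ler_sum => i _.
  rewrite mulrC ler_wpM2r ?normc_ge0 // (bigD1 i) //= addrCA lerDl.
  by rewrite addr_ge0 // sumr_ge0.
have [c c0 cP] : exists2 m : R, 0 < m & forall x, normc (phi x) <= m * N x.
  apply: bound => x; rewrite ?normc_ge0 // {1}(coord_vbasis (memvf x)).
  rewrite scalar_lincomb // (le_trans (normc_sum _ _ _)) //.
  by apply: ler_sum => i _; rewrite normcM.
have [m m0 mP] : exists2 m : R, 0 < m & forall x, N (T x) <= m * N x.
  apply: bound => // x; rewrite {1}(coord_vbasis (memvf x)) linear_sum /N.
  under eq_bigr do rewrite linear_sum.
  under [leRHS]eq_bigr do rewrite mulr_sumr.
  rewrite [leRHS]exchange_big /=; apply: ler_sum => j _.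
  rewrite (le_trans (normc_sum _ _ _)) //; apply: ler_sum => i _.
  by rewrite linearZ /= linearZ /= normcM.
exists (c * (N u + 1)), m; split=> //.
  by rewrite mulr_gt0 // ltr_wpDl.
move=> k; rewrite (le_trans (cP _)) // -mulrA ler_pM2l //.
elim: k => [|k IH]; first by rewrite expr0 mulr1 lerDl.
by rewrite iterS (le_trans (mP _)) // exprS mulrCA ler_pM2l.
Qed.

End LinearForms.

(** * Entire functions of an endomorphism *)

Section PolynomialCalculus.
Variable R : realType.
Local Notation C := R[i].
Variable E : vectType C.
Implicit Types (A : 'End(E)) (p q : {poly C}) (phi : 'End(E) -> C) (x y v : E).
Implicit Types (f h : C -> C) (s t : seq C) (mu : C).

(** The endomorphism p(A); endomorphisms of a space of dimension 0 are not a
    nontrivial ring, so it is not obtained by evaluation in an algebra. *)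
Definition lpoly p A : 'End(E) := \sum_(k < size p) p`_k *: lfun_exp A k.

Lemma lpoly_wide p A n : (size p <= n)%N ->
  lpoly p A = \sum_(k < n) p`_k *: lfun_exp A k.
Proof.
move=> pn; rewrite /lpoly (big_ord_widen _ (fun k => p`_k *: lfun_exp A k) pn).
rewrite big_mkcond; apply: eq_bigr => k _; case: ltnP => // h.
by rewrite nth_default // scale0r.
Qed.

Lemma lpolyD p q A : lpoly (p + q) A = lpoly p A + lpoly q A.
Proof.
pose n := maxn (size p) (size q).
rewrite (lpoly_wide A (leq_maxl _ _ : size p <= n)%N).
rewrite (lpoly_wide A (leq_maxr _ _ : size q <= n)%N).
rewrite (lpoly_wide A (size_polyD _ _ : _ <= n)%N) -big_split /=.
by apply: eq_bigr => k _; rewrite coefD scalerDl.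
Qed.

Lemma lpolyZ a p A : lpoly (a *: p) A = a *: lpoly p A.
Proof.
rewrite (lpoly_wide A (size_scale_leq a p)) scaler_sumr.
by apply: eq_bigr => k _; rewrite coefZ scalerA.
Qed.

Lemma lpolyB p q A : lpoly (p - q) A = lpoly p A - lpoly q A.
Proof. by rewrite lpolyD -scaleN1r lpolyZ scaleN1r. Qed.

Lemma lpoly1 A : lpoly 1 A = \1%VF.
Proof. by rewrite /lpoly size_poly1 big_ord1 coefC scale1r. Qed.

Lemma lpolyMX p A : lpoly (p * 'X) A = (A \o lpoly p A)%VF.
Proof.
have sz : (size (p * 'X)%R <= (size p).+1)%N.
  by rewrite (leq_trans (size_polyMleq _ _)) // size_polyX addn2.
rewrite (lpoly_wide A sz) big_ord_recl coefMX /= scale0r add0r /lpoly.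
apply/lfunP => x; rewrite comp_lfunE !sum_lfunE linear_sum.
by apply: eq_bigr => k _; rewrite coefMX /= !scale_lfunE linearZ /= comp_lfunE.
Qed.

Lemma lfun_expSr A k : lfun_exp A k.+1 = (lfun_exp A k \o A)%VF.
Proof.
elim: k => [|k IH]; first by rewrite /lfun_exp /= comp_lfun1l comp_lfun1r.
by rewrite -[LHS]/(A \o lfun_exp A k.+1)%VF {1}IH comp_lfunA.
Qed.

Lemma lpolyXM p A : (A \o lpoly p A = lpoly p A \o A)%VF.
Proof.
apply/lfunP => x; rewrite !comp_lfunE !sum_lfunE linear_sum.
apply: eq_bigr => k _; rewrite !scale_lfunE linearZ /=; congr (_ *: _).
by rewrite -!comp_lfunE -lfun_expSr.
Qed.

Lemma lpolyMXsubC p A mu :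
  lpoly (p * ('X - mu%:P)) A = ((A - mu *: \1) \o lpoly p A)%VF.
Proof.
rewrite mulrBr lpolyB lpolyMX mulrC mul_polyC lpolyZ.
by rewrite comp_lfunDl comp_lfunNl -comp_lfunZl comp_lfun1l.
Qed.

Lemma lpolyMXsubCr p A mu :
  lpoly (p * ('X - mu%:P)) A = (lpoly p A \o (A - mu *: \1))%VF.
Proof.
rewrite mulrBr lpolyB lpolyMX mulrC mul_polyC lpolyZ.
by rewrite comp_lfunDr comp_lfunNr -comp_lfunZr comp_lfun1r lpolyXM.
Qed.

Lemma lpoly_eigen p A v mu : A v = mu *: v -> lpoly p A v = p.[mu] *: v.
Proof.
move=> Av; rewrite sum_lfunE horner_coef scaler_suml.
apply: eq_bigr => k _; rewrite scale_lfunE -scalerA; congr (_ *: _).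
elim: (k : nat) => [|n IH]; first by rewrite expr0 scale1r /lfun_exp /= id_lfunE.
by rewrite -[lfun_exp _ _]/(A \o lfun_exp A n)%VF comp_lfunE IH linearZ /= Av scalerA -exprSr.
Qed.

Lemma lpoly_scalar p A phi : scalar phi ->
  phi (lpoly p A) = \sum_(k < size p) p`_k * phi (lfun_exp A k).
Proof. exact: scalar_lincomb. Qed.

(** By the Cauchy estimate on a disc of radius twice the growth rate of the
    powers of A, the terms of p(A) are dominated by a geometric series. *)
Lemma lpoly_small A phi : scalar phi -> exists c r : R, [/\ 0 < c, 0 < r &
  forall p e, (forall z, normc z <= r -> normc p.[z] <= e) ->
    normc (phi (lpoly p A)) <= c * e].
Proof.
move=> phiL.
have compL : linear (fun B : 'End(E) => (A \o B)%VF).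
  by move=> a B B'; rewrite comp_lfunDr comp_lfunZr.
pose cA := GRing.isLinear.Build _ _ _ _ _ compL.
pose T : {linear 'End(E) -> 'End(E)} := HB.pack (fun B : 'End(E) => (A \o B)%VF) cA.
have [c [r [c0 r0 cr]]] := iter_scalar_bound T \1%VF phiL.
have {}cr k : normc (phi (lfun_exp A k)) <= c * r ^+ k := cr k.
(* Radius twice the growth rate, so that the sum of ratio 1/2 is at most 2. *)
exists (c * 2), (2 * r); split; rewrite ?mulr_gt0 // => p e pe.
have e0 : 0 <= e by rewrite (le_trans (normc_ge0 p.[0])) // pe // normc0 ltW // mulr_gt0.
rewrite lpoly_scalar // (le_trans (normc_sum _ _ _)) //.
apply: (@le_trans _ _ (\sum_(k < size p) c * e * 2^-1 ^+ k)); last first.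
  rewrite -mulr_sumr -(big_mkord xpredT (fun k => (2^-1 : R) ^+ k)).
  have := geometric_half_le R (leq0n (size p)); rewrite expr0 mulr1 => h.
  by rewrite [c * 2 * e]mulrAC ler_wpM2l // mulr_ge0 // ltW.
apply: ler_sum => k _; rewrite normcM.
have h := cauchy_estimate k (mulr_gt0 (ltr0Sn _ 1) r0) pe.
have {h} h : normc p`_k * r ^+ k <= e * 2^-1 ^+ k.
  by rewrite exprVn ler_pdivlMr ?exprn_gt0 // -mulrA -exprMn mulrC [r * 2]mulrC mulrC.
rewrite (le_trans (ler_wpM2l (normc_ge0 _) (cr k))) //.
by rewrite mulrCA -mulrA ler_pM2l.
Qed.

(** f(A) is defined by the Taylor polynomials of f, but any polynomials
    approximating f on a large disc compute it.  This frees the functional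
    calculus from power series. *)
Lemma entire_app_approx f A phi : disc_approx f -> scalar phi ->
  forall e : R, 0 < e -> exists r d : R, 0 < d /\
    forall p, (forall z, normc z <= r -> normc (f z - p.[z]) <= d) ->
    normc (phi (entire_app f A) - phi (lpoly p A)) <= e.
Proof.
move=> fH phiL e e0.
have fa : power_series_of f (entire_coef f).
  by apply: xgetPex; apply: disc_approx_power_series.
set a := entire_coef f in fa *.
pose P n : {poly C} := \poly_(k < n) a k.
have PE n : \sum_(k < n) a k *: lfun_exp A k = lpoly (P n) A.
  rewrite (lpoly_wide A (size_poly n _)); apply: eq_bigr => k _.
  by rewrite coef_poly ltn_ord.
have PU (r d : R) : 0 < d -> exists K0, forall K, (K0 <= K)%N ->
    forall z, normc z <= r -> normc (f z - (P K).[z]) <= d.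
  move=> d0; have [K0 HK] := power_series_unif r fa d0.
  by exists K0 => K KK z zr; rewrite horner_poly HK.
have close psi : scalar psi -> exists c r : R, [/\ 0 < c, 0 < r &
    forall p q d, (forall z, normc z <= r -> normc (f z - p.[z]) <= d) ->
    (forall z, normc z <= r -> normc (f z - q.[z]) <= d) ->
    normc (psi (lpoly p A) - psi (lpoly q A)) <= c * (d + d)].
  move=> psiL; have [c [r [c0 r0 cr]]] := lpoly_small A psiL.
  exists c, r; split=> // p q d pd qd.
  rewrite -scalarB // -lpolyB; apply: cr => z zr.
  rewrite hornerD hornerN (le_trans (normc_dist_triangle _ (f z) _)) // lerD ?qd //.
  by rewrite normc_distC pd.
pose b := vbasis {:'End(E)}.
have /choice[l lP] (i : 'I_(\dim {:'End(E)})) : exists l : C, forall e, 0 < e ->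
    exists N, forall n, (N <= n)%N -> normc (l - coord b i (lpoly (P n) A)) <= e.
  apply: cauchyC_seq => d d0.
  have [c [r [c0 r0 cr]]] := close _ (coord_scalar i).
  have d20 : 0 < d / c / 2 by rewrite !divr_gt0.
  have [K0 HK] := PU r _ d20; exists K0 => n Kn.
  rewrite (le_trans (cr _ _ _ (HK _ (leqnn _)) (HK _ Kn))) //.
  by rewrite -splitr mulrC divfK ?gt_eqF.
have entE : entire_app f A = \sum_i l i *: b`_i.
  rewrite /entire_app /vlim; apply: eq_bigr => i _; congr (_ *: _).
  apply: seqC_lim => d /(lP i)[N HN]; exists N => n Nn; rewrite PE; exact: HN.
have [c [r [c0 r0 cr]]] := close _ phiL.
pose d := e / 2 / c / 2.
have d0 : 0 < d by rewrite !divr_gt0.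
exists r, d; split=> // p pd.
pose m := 1 + \sum_(i < \dim {:'End(E)}) normc (phi b`_i).
have m0 : 0 < m by rewrite ltr_pwDl // sumr_ge0 // => i _; rewrite normc_ge0.
have /choice[N HN] i := lP i (e / 2 / m) ltac:(by rewrite !divr_gt0).
have [K0 HK] := PU r d d0.
pose K := maxn K0 (\max_i N i).
rewrite (le_trans (normc_dist_triangle _ (phi (lpoly (P K) A)) _)) // (splitr e) lerD //; last first.
  rewrite (le_trans (cr _ _ d (HK _ (leq_maxl _ _)) pd)) //.
  by rewrite /d -splitr mulrC divfK ?gt_eqF.
rewrite entE {1}(coord_vbasis (memvf (lpoly (P K) A))) !scalar_lincomb // -sumrB.
rewrite (le_trans (normc_sum _ _ _)) //.
apply: (@le_trans _ _ (\sum_(i < \dim {:'End(E)}) e / 2 / m * normc (phi b`_i))).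
  apply: ler_sum => i _; rewrite -mulrBl normcM ler_wpM2r ?normc_ge0 // HN //.
  by rewrite (leq_trans _ (leq_maxr _ _)) // leq_bigmax.
rewrite -mulr_sumr -[leRHS](@divfK _ m) ?gt_eqF // ler_wpM2l //.
  by rewrite ltW // !divr_gt0.
by rewrite /m lerDr.
Qed.

Lemma entire_app_eigen f A v mu : disc_approx f -> A v = mu *: v ->
  entire_app f A v = f mu *: v.
Proof.
move=> fH Av; apply: vect_sep => psi psiL; apply: normc_eps_eq => e e0.
have phiL : scalar (fun B : 'End(E) => psi (B v)).
  by move=> a B B'; rewrite add_lfunE scale_lfunE psiL.
have psiZ a x : psi (a *: x) = a * psi x.
  by have := scalar_lincomb (fun=> a) (fun=> x) psiL (n := 1); rewrite !big_ord1.
have [r [d [d0 H]]] := entire_app_approx A fH phiL (divr_gt0 e0 (ltr0Sn _ 1)).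
pose d' := Num.min d (e / 2 / (normc (psi v) + 1)).
have pv0 : 0 < normc (psi v) + 1 by rewrite ltr_wpDl ?normc_ge0.
have d'0 : 0 < d' by rewrite lt_min d0 !divr_gt0.
have [p pd] := fH (Num.max r (normc mu)) d' d'0.
rewrite (le_trans (normc_dist_triangle _ (psi (lpoly p A v)) _)) // (splitr e) lerD //.
  by apply: H => z zr; rewrite (le_trans (pd z _)) ?le_max ?zr ?ge_min ?lexx.
rewrite (lpoly_eigen _ Av) !psiZ -mulrBl normcM normc_distC.
rewrite -[leRHS](@divfK _ (normc (psi v) + 1)) ?gt_eqF //.
rewrite ler_pM ?normc_ge0 ?lerDl //.
by rewrite (le_trans (pd mu _)) ?le_max ?lexx ?orbT // ge_min lexx orbT.
Qed.

(** If p approximates h then (X - mu)p approximates f, and polynomials in A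
    multiply as they should. *)
Lemma entire_app_factor f h A mu : disc_approx f -> disc_approx h ->
  (forall z, f z = (z - mu) * h z) ->
  entire_app f A = (entire_app h A \o (A - mu *: \1))%VF.
Proof.
move=> fH hH fh; apply: vect_sep => phi phiL; apply: normc_eps_eq => e e0.
have e20 : 0 < e / 2 by rewrite divr_gt0.
have phi'L : scalar (fun B : 'End(E) => phi (B \o (A - mu *: \1))%VF).
  by move=> a B B'; rewrite comp_lfunDl -comp_lfunZl phiL.
have [r [d [d0 H]]] := entire_app_approx A fH phiL e20.
have [r' [d' [d'0 H']]] := entire_app_approx A hH phi'L e20.
have [M M0 pM] := horner_bounded ('X - mu%:P) r.
have [p pd] := hH (Num.max r r') (Num.min d' (d / M)) ltac:(by rewrite lt_min d'0 divr_gt0).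
rewrite (le_trans (normc_dist_triangle _ (phi (lpoly (p * ('X - mu%:P)) A)) _)) // (splitr e) lerD //.
  apply: H => z zr; rewrite fh hornerM mulrC -[X in _ * X](_ : ('X - mu%:P).[z] = _); last by rewrite hornerXsubC.
  rewrite -mulrBl normcM -[leRHS](@divfK _ M) ?gt_eqF // ler_pM ?normc_ge0 ?pM //.
  by rewrite (le_trans (pd z _)) ?le_max ?zr // ge_min lexx orbT.
rewrite lpolyMXsubCr normc_distC; apply: H' => z zr.
by rewrite (le_trans (pd z _)) ?le_max ?zr ?orbT // ge_min lexx.
Qed.

End PolynomialCalculus.

(** * Endomorphisms annihilated by an entire function with simple zeros *)

Section EntireAnnihilator.
Variable R : realType.
Local Notation C := R[i].
Variable E : vectType C.
Implicit Types (A : 'End(E)) (x y : E) (f h : C -> C) (s t : seq C) (mu : C).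

Definition simple_zeros f : Prop := forall mu, f mu = 0 ->
  exists h, [/\ disc_approx h, forall z, f z = (z - mu) * h z & h mu != 0].

Definition root_poly s : {poly C} := \prod_(mu <- s) ('X - mu%:P).

Lemma subr_scalarE A mu x : (A - mu *: \1)%VF x = A x - mu *: x.
Proof. by rewrite add_lfunE opp_lfunE scale_lfunE id_lfunE. Qed.

Lemma annihilator_eigen f A mu y : disc_approx f -> entire_app f A = 0 ->
  f mu != 0 -> A y = mu *: y -> y = 0.
Proof.
move=> fH fA fmu /(entire_app_eigen fH); rewrite fA zero_lfunE => /esym/eqP.
by rewrite scaler_eq0 (negPf fmu) => /eqP.
Qed.

(** With f = (z - mu)h, the hypothesis says that w = Ay - mu y is an eigenvector;
    then 0 = f(A)y = h(A)w = h(mu)w and h(mu) is nonzero. *)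
Lemma annihilator_semisimple f A mu y : disc_approx f -> simple_zeros f ->
  entire_app f A = 0 -> f mu = 0 ->
  A (A y - mu *: y) = mu *: (A y - mu *: y) -> A y = mu *: y.
Proof.
move=> fH fS fA /fS[h [hH fh hmu]] Aw.
have := entire_app_factor A fH hH fh; rewrite fA => /lfunP/(_ y).
rewrite zero_lfunE comp_lfunE subr_scalarE (entire_app_eigen hH Aw) => /esym/eqP.
by rewrite scaler_eq0 (negPf hmu) subr_eq0 => /eqP.
Qed.

(** The powers of A up to the dimension of the endomorphism space are linearly
    dependent. *)
Lemma lpoly_annihilator A : exists2 p, p != 0 & lpoly p A = 0.
Proof.
pose N := \dim {:'End(E)}; pose X := [tuple lfun_exp A i | i < N.+1].
have : ~~ free X.
  by rewrite /free size_tuple neq_ltn ltnS dimvS ?subvf.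
case: freeP => // notfree _.
have [k [kX [i ki]]] : exists k : 'I_N.+1 -> C,
    \sum_i k i *: X`_i = 0 /\ exists i, k i != 0.
  apply: contrapT => H; apply: notfree => k kX i; apply/eqP; apply: contrapT => ki.
  by apply: H; exists k; split=> //; exists i; apply/negP.
pose p : {poly C} := \poly_(j < N.+1) (if insub j is Some j' then k j' else 0).
have pE (j : 'I_N.+1) : p`_j = k j.
  by rewrite coef_poly ltn_ord; case: insubP (ltn_ord j) => [j' _ /val_inj->|/negPf->].
exists p; first by apply: contraNneq ki => p0; rewrite -pE p0 coef0.
rewrite (lpoly_wide A (size_poly _ _)) -[RHS]kX; apply: eq_bigr => j _.
by rewrite pE -tnth_nth tnth_mktuple.
Qed.

Lemma root_poly_cons mu s A y :
  lpoly (root_poly (mu :: s)) A y = lpoly (root_poly s) A (A y - mu *: y).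
Proof. by rewrite /root_poly big_cons mulrC lpolyMXsubCr comp_lfunE subr_scalarE. Qed.

Lemma root_poly_consl mu s A y :
  lpoly (root_poly (mu :: s)) A y =
  A (lpoly (root_poly s) A y) - mu *: lpoly (root_poly s) A y.
Proof. by rewrite /root_poly big_cons mulrC lpolyMXsubC comp_lfunE subr_scalarE. Qed.

(** In a product of factors A - mu that kills y, a factor at a nonzero of f is
    injective and can be dropped, and a repeated factor can be dropped by
    semisimplicity. *)
Lemma annihilator_squarefree f A s : disc_approx f -> simple_zeros f ->
  entire_app f A = 0 -> exists t, [/\ uniq t, {in t, forall mu, f mu = 0} &
    forall y, lpoly (root_poly s) A y = 0 -> lpoly (root_poly t) A y = 0].
Proof.
move=> fH fS fA; elim: s => [|mu s [t [tu tf tP]]]; first by exists [::].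
have key y : lpoly (root_poly (mu :: s)) A y = 0 ->
    A (lpoly (root_poly t) A y) = mu *: lpoly (root_poly t) A y.
  by rewrite root_poly_cons => /tP; rewrite -root_poly_cons root_poly_consl => /subr0_eq.
have [fmu|fmu] := eqVneq (f mu) 0; last first.
  by exists t; split=> // y /key/(annihilator_eigen fH fA fmu).
have [mut|mut] := boolP (mu \in t); last first.
  exists (mu :: t); split; first by rewrite /= mut.
    by move=> nu; rewrite inE => /predU1P[->|/tf].
  by move=> y /key h; rewrite root_poly_consl h subrr.
exists t; split=> // y /key.
have -> : root_poly t = root_poly (mu :: rem mu t).
  by rewrite /root_poly (big_rem mu mut) /= big_cons.
by rewrite root_poly_consl => /(annihilator_semisimple fH fS fA fmu) ->; rewrite subrr.
Qed.

(** Partial fractions, one root at a time: a decomposition of Ax - mu x into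
    eigenvectors lifts to one of x up to an eigenvector for mu. *)
Lemma root_poly_decomp A s x : uniq s -> lpoly (root_poly s) A x = 0 ->
  exists c : C -> E, (forall mu, A (c mu) = mu *: c mu) /\ x = \sum_(mu <- s) c mu.
Proof.
elim: s x => [|mu s IH] x /=.
  move=> _; rewrite /root_poly big_nil lpoly1 id_lfunE => ->.
  by exists (fun=> 0); split=> [mu|]; rewrite ?linear0 ?scaler0 ?big_nil.
case/andP=> mus su; rewrite root_poly_cons => /(IH _ su)[c [cA cS]].
pose y := \sum_(nu <- s) (nu - mu)^-1 *: c nu.
have yE : A y - mu *: y = A x - mu *: x.
  rewrite cS linear_sum scaler_sumr -sumrB big_seq [RHS]big_seq.
  apply: eq_bigr => nu nus; rewrite linearZ /= cA !scalerA -scalerBl.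
  rewrite [mu * _]mulrC -mulrBr mulVf ?scale1r // subr_eq0.
  by apply: contraNneq mus => <-.
exists (fun nu => if nu == mu then x - y else (nu - mu)^-1 *: c nu); split.
  move=> nu; have [->|_] := eqVneq nu mu; last by rewrite linearZ /= cA scalerA mulrC -scalerA.
  apply/eqP; rewrite -subr_eq0 linearB /= scalerBr opprB.
  by rewrite [mu *: y - _]addrC addrACA -yE [- A y + _]addrC addrA subrK subrr.
rewrite big_cons eqxx -[LHS](subrK y); congr (_ + _); rewrite /y big_seq [RHS]big_seq.
apply: eq_bigr => nu nus; case: eqVneq => // nm.
by rewrite -nm nus in mus.
Qed.

(** Applying A - mu removes the term of the first eigenvalue. *)
Lemma eigen_independent A s (c : C -> E) : uniq s ->
  (forall mu, A (c mu) = mu *: c mu) -> \sum_(mu <- s) c mu = 0 ->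
  {in s, forall mu, c mu = 0}.
Proof.
move=> su cA; elim: s su c cA => [|mu s IH] //= /andP[mus su] c cA.
rewrite big_cons => cS.
have c0 : {in s, forall nu, c nu = 0}.
  move=> nu nus; pose c' nu := (nu - mu) *: c nu.
  have c'A xi : A (c' xi) = xi *: c' xi by rewrite linearZ /= cA !scalerA mulrC.
  have c'S : \sum_(xi <- s) c' xi = 0.
    have := congr1 (fun z => A z - mu *: z) cS.
    rewrite linear0 scaler0 subrr linearD /= cA scalerDr opprD addrACA subrr add0r.
    rewrite linear_sum scaler_sumr -sumrB => hS; rewrite -[RHS]hS.
    by apply: eq_bigr => xi _; rewrite /= cA -scalerBl.
  have /eqP := IH su c' c'A c'S nu nus; rewrite scaler_eq0 subr_eq0.
  by case/predU1P => [nm|/eqP//]; rewrite -nm nus in mus.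
move=> nu; rewrite inE => /predU1P[->|/c0//].
by move: cS; rewrite big_seq big1 ?addr0 // => xi /c0.
Qed.

(** Applied to sigma this is the eigenspace decomposition of a
    sigma-operator. *)
Lemma annihilator_decomp f A : disc_approx f -> simple_zeros f ->
  entire_app f A = 0 -> exists s, [/\ uniq s, {in s, forall mu, f mu = 0} &
    forall x, exists c : C -> E,
      (forall mu, A (c mu) = mu *: c mu) /\ x = \sum_(mu <- s) c mu].
Proof.
move=> fH fS fA; have [p p0 pA] := lpoly_annihilator A.
have [s0 ps] := closed_field_poly_normal p.
have [t [tu tf tP]] := annihilator_squarefree s0 fH fS fA.
exists t; split=> // x; apply: root_poly_decomp => //; apply: tP.
have : lpoly p A x = 0 by rewrite pA zero_lfunE.
rewrite ps lpolyZ scale_lfunE => /eqP; rewrite scaler_eq0 lead_coef_eq0.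
by rewrite (negPf p0) => /eqP.
Qed.

End EntireAnnihilator.

(** * The complex exponential *)

Section ComplexExponential.
Variable R : realType.
Local Notation C := R[i].
Implicit Types (z u w : C) (r e : R).

Definition exp_poly n : {poly C} := \poly_(k < n) (k`!%:R)^-1.

Definition exp_sum r n : R := \sum_(k < n) r ^+ k / k`!%:R.

Lemma exp_polyE n z : (exp_poly n).[z] = \sum_(k < n) z ^+ k / k`!%:R.
Proof. by rewrite horner_poly; apply: eq_bigr => k _; rewrite mulrC. Qed.

Lemma exp_sum_nat r n : exp_sum r n = \sum_(0 <= k < n) r ^+ k / k`!%:R.
Proof. by rewrite big_mkord. Qed.

Lemma exp_sum_series r : exp_sum r = series (exp_coeff r).
Proof. by apply/funext => n; rewrite exp_sum_nat. Qed.

Lemma exp_sum_homo r : 0 <= r -> {homo exp_sum r : n m / (n <= m)%N >-> n <= m}.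
Proof.
move=> r0 n m nm; rewrite !exp_sum_nat (big_cat_nat (leq0n n) nm) /= lerDl.
by rewrite sumr_ge0 // => k _; rewrite divr_ge0 // exprn_ge0.
Qed.

Lemma exp_sum_le r n : 0 <= r -> exp_sum r n <= expR r.
Proof.
move=> r0; rewrite /expR -exp_sum_series.
apply: nondecreasing_cvgn_le; first exact: exp_sum_homo.
by rewrite exp_sum_series; exact: is_cvg_series_exp_coeff.
Qed.

Lemma exp_sum_tail r e : 0 <= r -> 0 < e ->
  exists N, forall n, (N <= n)%N -> expR r - exp_sum r n <= e.
Proof.
move=> r0 e0; have /cvgrPdist_le/(_ e e0)[N _ HN] := is_cvg_series_exp_coeff r.
exists N => n Nn; rewrite exp_sum_series (le_trans (ler_norm _)) //.
exact: HN.
Qed.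

Lemma exp_poly_dist z r n m : normc z <= r -> (n <= m)%N ->
  normc ((exp_poly m).[z] - (exp_poly n).[z]) <= exp_sum r m - exp_sum r n.
Proof.
move=> zr nm; rewrite !exp_polyE !exp_sum_nat.
rewrite -!(big_mkord xpredT (fun k => z ^+ k / k`!%:R)).
rewrite !(big_cat_nat (leq0n n) nm) /= ![_ + \big[_/_]_(_ <= i < m) _ ]addrC !addrK.
rewrite (le_trans (normc_sum _ _ _)) //; apply: ler_sum => k _.
rewrite normcM normcV normc_nat normcX ler_wpM2r ?invr_ge0 //.
by rewrite lerXn2r ?nnegrE ?normc_ge0 // (le_trans (normc_ge0 z)).
Qed.

(** The tail of the series at z is dominated by that of the real exponential at
    the radius. *)
Lemma cexp_poly r e : 0 < e -> exists N, forall n, (N <= n)%N ->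
  forall z, normc z <= r -> normc (cexp z - (exp_poly n).[z]) <= e.
Proof.
move=> e0; have [rN|r0] := ltP r 0.
  by exists 0%N => n _ z /le_lt_trans/(_ rN); rewrite ltNge normc_ge0.
have cauchy d z : 0 < d -> normc z <= r -> exists N, forall n m, (N <= n)%N ->
    (n <= m)%N -> normc ((exp_poly m).[z] - (exp_poly n).[z]) <= d.
  move=> d0 zr; have [N HN] := exp_sum_tail r0 d0.
  exists N => n m Nn nm; rewrite (le_trans (exp_poly_dist zr nm)) //.
  by rewrite (le_trans _ (HN n Nn)) // lerD2r exp_sum_le.
have [N HN] := exp_sum_tail r0 (divr_gt0 e0 (ltr0Sn _ 1)).
exists N => n Nn z zr.
have [l lP] : exists l : C, forall e, 0 < e ->
    exists N, forall n, (N <= n)%N -> normc (l - (exp_poly n).[z]) <= e.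
  apply: cauchyC_seq => d d0; have [K HK] := cauchy d z d0 zr.
  by exists K => m Km; rewrite normc_distC HK.
have -> : cexp z = l.
  apply: seqC_lim => d /lP[K HK]; exists K => m /HK.
  by rewrite exp_polyE /series /= big_mkord.
have [K HK] := lP _ (divr_gt0 e0 (ltr0Sn _ 1)).
rewrite (le_trans (normc_dist_triangle _ (exp_poly (maxn K n)).[z] _)) // (splitr e) lerD //.
  by rewrite HK // leq_maxl.
rewrite (le_trans (exp_poly_dist zr (leq_maxr _ _))) //.
by rewrite (le_trans _ (HN n Nn)) // lerD2r exp_sum_le.
Qed.

Lemma cexp_approx : disc_approx (@cexp R).
Proof.
move=> r e e0; have [N HN] := cexp_poly r e0.
by exists (exp_poly N) => z zr; apply: HN.
Qed.

Lemma inv_fact_mul (F : numFieldType) k i : (i <= k)%N ->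
  (i`!%:R)^-1 * ((k - i)`!%:R)^-1 = 'C(k, i)%:R / k`!%:R :> F.
Proof.
move=> ik; rewrite -(bin_fact ik) !natrM !invfM mulVKf //.
by rewrite pnatr_eq0 -lt0n bin_gt0.
Qed.

Definition exp_polyN n : {poly C} := \poly_(k < n) ((-1) ^+ k / k`!%:R).

Lemma exp_polyNE n z : (exp_polyN n).[z] = (exp_poly n).[- z].
Proof.
rewrite exp_polyE horner_poly; apply: eq_bigr => k _.
by rewrite [(- z) ^+ k]exprNn mulrAC.
Qed.

(** The coefficients below the truncation are (1 - 1)^k / k!. *)
Lemma exp_polyM_coef n k : (k < n)%N ->
  (exp_poly n * exp_polyN n)`_k = (k == 0)%:R.
Proof.
move=> kn; rewrite coefM.
transitivity (\sum_(i < k.+1) (((-1) ^+ (k - i) * 1 ^+ i) *+ 'C(k, i)) / k`!%:R : C).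
  apply: eq_bigr => i _; have ik : (i <= k)%N by rewrite -ltnS.
  rewrite !coef_poly (leq_ltn_trans ik kn) (leq_ltn_trans (leq_subr _ _) kn).
  by rewrite mulrCA inv_fact_mul // expr1n mulr1 -[in RHS]mulr_natr mulrA.
rewrite -mulr_suml -exprDn addNr expr0n.
by case: k kn => [|k] _; rewrite ?fact0 ?divr1 ?mul0r.
Qed.

(** Beyond the truncation the coefficient is a partial sum of the expansion of
    (1 + 1)^k / k!, up to signs. *)
Lemma exp_polyM_bound n k :
  normc (exp_poly n * exp_polyN n)`_k <= 2 ^+ k / k`!%:R.
Proof.
have -> : 2 ^+ k = \sum_(i < k.+1) (1 ^+ (k - i) * 1 ^+ i) *+ 'C(k, i) :> R.
  by rewrite -exprDn.
rewrite coefM mulr_suml (le_trans (normc_sum _ _ _)) //.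
apply: ler_sum => i _; have ik : (i <= k)%N by rewrite -ltnS.
rewrite !expr1n mulr1 -inv_fact_mul // normcM !coef_poly ler_pM ?normc_ge0 //.
  by case: ifP => _; rewrite ?normc0 ?invr_ge0 // normcV normc_nat.
case: ifP => _; rewrite ?normc0 ?invr_ge0 // normcM normcV normc_nat normcX.
by rewrite normc_opp normc1 expr1n mul1r.
Qed.

Lemma exp_polyM_dist n z : (0 < n)%N ->
  normc ((exp_poly n).[z] * (exp_poly n).[- z] - 1) <=
  expR (2 * normc z) - exp_sum (2 * normc z) n.
Proof.
move=> n0; rewrite -exp_polyNE -hornerM.
set q := _ * _; pose N := maxn n (size q).
rewrite (horner_coef_wide z (leq_maxr n _ : _ <= N)%N).
rewrite -(big_mkord xpredT (fun k => q`_k * z ^+ k)).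
rewrite (big_cat_nat (leq0n n) (leq_maxl n _ : n <= N)%N) /=.
have -> : \sum_(0 <= i < n) q`_i * z ^+ i = 1.
  rewrite big_mkord (bigD1 (Ordinal n0)) //= exp_polyM_coef // expr0 mulr1.
  rewrite big1 ?addr0 // => i i0; rewrite exp_polyM_coef //.
  by rewrite -[(i : nat) == 0]/(i == Ordinal n0) (negPf i0) mul0r.
rewrite addrAC subrr add0r.
have r0 : 0 <= 2 * normc z by rewrite mulr_ge0 ?normc_ge0.
rewrite (@le_trans _ _ (exp_sum (2 * normc z) N - exp_sum (2 * normc z) n)) //; last first.
  by rewrite lerD2r exp_sum_le.
rewrite !exp_sum_nat (big_cat_nat (leq0n n) (leq_maxl n _ : n <= N)%N) /= addrAC subrr add0r.
rewrite (le_trans (normc_sum _ _ _)) //; apply: ler_sum => k _.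
rewrite normcM normcX exprMn mulrAC ler_wpM2r ?exprn_ge0 ?normc_ge0 //.
exact: exp_polyM_bound.
Qed.

(** The truncations at z and -z have product 1 plus terms dominated by the tail of
    the real exponential at 2|z|. *)
Lemma cexpMN z : cexp z * cexp (- z) = 1.
Proof.
apply: normc_eps_eq => e e0.
set a := cexp z; set b := cexp (- z).
pose m := normc a + normc b + 1.
have m0 : 0 < m by rewrite ltr_wpDl // addr_ge0 ?normc_ge0.
pose d := Num.min 1 (e / 2 / m).
have d0 : 0 < d by rewrite lt_min ltr01 !divr_gt0.
have [N1 H1] := cexp_poly (normc z) d0.
have r0 : 0 <= 2 * normc z by rewrite mulr_ge0 ?normc_ge0.
have [N2 H2] := exp_sum_tail r0 (divr_gt0 e0 (ltr0Sn _ 1)).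
pose n := maxn N1 (maxn N2 1).
have aP : normc (a - (exp_poly n).[z]) <= d by rewrite H1 ?leq_maxl.
have bP : normc (b - (exp_poly n).[- z]) <= d by rewrite H1 ?leq_maxl ?normc_opp.
rewrite (le_trans (normc_dist_triangle _ ((exp_poly n).[z] * (exp_poly n).[- z]) _)) //.
rewrite (splitr e) lerD //; last first.
  by rewrite (le_trans (exp_polyM_dist _ _)) ?H2 // /n ?leq_max ?leqnn ?orbT.
set an := (exp_poly n).[z] in aP *; set bn := (exp_poly n).[- z] in bP *.
have -> : a * b - an * bn = a * (b - bn) + (a - an) * bn by ring.
have bn1 : normc bn <= normc b + 1.
  rewrite -[bn](subKr b) (le_trans (normcD_le _ _)) // lerD2l normc_opp.
  by rewrite (le_trans bP) // ge_min lexx.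
have dm : d * m <= e / 2 by rewrite -ler_pdivlMr // ge_min lexx orbT.
rewrite (le_trans _ dm) // (le_trans (normcD_le _ _)) // !normcM.
have -> : d * m = normc a * d + d * (normc b + 1).
  by rewrite /m -addrA mulrDr [d * normc a]mulrC.
by rewrite lerD // ler_pM ?normc_ge0.
Qed.

Lemma cexp_neq0 z : cexp z != 0.
Proof.
by apply/eqP => z0; have /eqP := cexpMN z; rewrite z0 mul0r eq_sym oner_eq0.
Qed.

Lemma cexp_order3 u :
  normc (cexp u - (1 + u + u ^+ 2 / 2)) <= normc u ^+ 3 * expR (normc u).
Proof.
apply/ler_addgt0Pr => e e0; have [N HN] := cexp_poly (normc u) e0.
pose n := maxn N 3; have un := HN n (leq_maxl _ _) u (lexx _).
rewrite [leRHS]addrC (le_trans (normc_dist_triangle _ (exp_poly n).[u] _)) // lerD //.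
have -> : 1 + u + u ^+ 2 / 2 = (exp_poly 3).[u].
  by rewrite exp_polyE !big_ord_recl big_ord0 /= expr0 !divr1 expr1 addr0 !addrA.
rewrite (le_trans (exp_poly_dist (lexx _) (leq_maxr N 3))) //.
set m := (maxn N 3 - 3)%N.
have -> : maxn N 3 = (m + 3)%N by rewrite subnK // leq_maxr.
rewrite !exp_sum_nat (big_cat_nat (leq0n 3) (leq_addl _ _)) /= addrAC subrr add0r.
rewrite -{1}[3%N]add0n big_addn addnK.
have h := exp_sum_le m (normc_ge0 u).
rewrite (le_trans _ (ler_wpM2l _ h)) ?exprn_ge0 ?normc_ge0 //.
rewrite exp_sum_nat mulr_sumr; apply: ler_sum => k _.
rewrite exprD [normc u ^+ k * _]mulrC -mulrA !ler_wpM2l ?exprn_ge0 ?normc_ge0 //.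
by rewrite lef_pV2 ?posrE ?ltr0n ?fact_gt0 // ler_nat leq_fact // leq_addr.
Qed.

End ComplexExponential.

(** * Unconditional infinite products *)

Section InfiniteProduct.
Variable R : realType.
Local Notation C := R[i].
Variables (K : choiceType) (g : K -> C -> C).
Implicit Types (D : {fset K}) (s : seq K) (r e : R) (z : C).

(** Comparison with the product of the real numbers exp(b k), using
    1 + x <= exp x. *)
Lemma prod_sub1_le s (u : K -> C) (b : K -> R) :
  (forall k, normc (u k - 1) <= b k) ->
  normc (\prod_(k <- s) u k) <= expR (\sum_(k <- s) b k) /\
  normc (\prod_(k <- s) u k - 1) <= expR (\sum_(k <- s) b k) - 1.
Proof.
move=> ub; have u1 k : normc (u k) <= expR (b k).
  rewrite -(subrK 1 (u k)) (le_trans (normcD_le _ _)) // normc1.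
  by rewrite (le_trans _ (expR_ge1Dx _)) // addrC lerD2l.
elim: s => [|k s [IH1 IH2]].
  by rewrite !big_nil expR0 !subrr normc1 normc0.
have P1 : normc (\prod_(j <- k :: s) u j) <= expR (\sum_(j <- k :: s) b j).
  by rewrite !big_cons normcM expRD ler_pM ?normc_ge0.
split=> //; rewrite !big_cons expRD.
have -> : u k * \prod_(j <- s) u j - 1 =
  u k * (\prod_(j <- s) u j - 1) + (u k - 1) by ring.
rewrite (le_trans (normcD_le _ _)) // normcM.
have -> : expR (b k) * expR (\sum_(j <- s) b j) - 1 =
  expR (b k) * (expR (\sum_(j <- s) b j) - 1) + (expR (b k) - 1) by ring.
rewrite lerD ?ler_pM ?normc_ge0 // (le_trans (ub k)) //.
by rewrite lerBrDl expR_ge1Dx.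
Qed.

(** D is a finite set whose sum nearly attains the supremum. *)
Lemma small_tails (B : K -> R) (S : R) : (forall k, 0 <= B k) ->
  (forall s, uniq s -> \sum_(k <- s) B k <= S) ->
  forall d : R, 0 < d -> exists D : {fset K}, forall s, uniq s ->
    {in s, forall k, k \notin D} -> \sum_(k <- s) B k <= d.
Proof.
move=> B0 BS d d0.
pose T : set R := [set x | exists2 s, uniq s & x = \sum_(k <- s) B k].
have supT : has_sup T.
  split; first by exists 0; exists [::] => //; rewrite big_nil.
  by exists S => _ [s su ->]; apply: BS.
have [_ [s0 s0u ->] s0d] := sup_adherent d0 supT.
exists [fset k in s0]%fset => s su sD.
have su0 : uniq (s ++ s0).
  rewrite cat_uniq su s0u andbT /=; apply/hasPn => k ks0; apply/negP => /sD.
  by rewrite in_fset ks0.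
have /(sup_upper_bound supT) : T (\sum_(k <- s ++ s0) B k) by exists (s ++ s0).
rewrite big_cat /= => h.
rewrite -(lerD2r (\sum_(k <- s0) B k)) (le_trans h) // -lerBlDl ltW //.
Qed.

Hypothesis gH : forall k, disc_approx (g k).
Hypothesis gS : forall r, exists B : K -> R, [/\ forall k, 0 <= B k,
  exists S : R, forall s, uniq s -> \sum_(k <- s) B k <= S &
  forall k z, normc z <= r -> normc (g k z - 1) <= B k].

Lemma prod_tail r e : 0 < e -> exists D, forall s, uniq s ->
  {in s, forall k, k \notin D} -> forall z, normc z <= r ->
  normc (\prod_(k <- s) g k z - 1) <= e.
Proof.
move=> e0; have [B [B0 [S BS] gB]] := gS r.
pose d := ln (1 + e).
have d0 : 0 < d by rewrite ln_gt0 // ltrDl.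
have [D HD] := small_tails B0 BS d0; exists D => s su sD z zr.
have [_ h] := prod_sub1_le s (fun k => gB k z zr).
rewrite (le_trans h) // lerBlDl -[leRHS]lnK ?posrE ?addr_gt0 //.
by rewrite ler_expR HD.
Qed.

Lemma fset_split_perm D0 D : (D0 `<=` D)%fset -> perm_eq D (D0 ++ (D `\` D0)%fset).
Proof.
move=> sub; apply: uniq_perm; rewrite ?fset_uniq //.
  rewrite cat_uniq !fset_uniq /= andbT; apply/hasPn => k.
  by rewrite in_fsetD => /andP[].
by move=> k; rewrite mem_cat in_fsetD; case: (boolP (k \in D0)) => //= /(fsubsetP sub).
Qed.

Lemma prod_cauchy r e : 0 < e -> exists D0, forall D, (D0 `<=` D)%fset ->
  forall z, normc z <= r ->
  normc (\prod_(k <- D) g k z - \prod_(k <- D0) g k z) <= e.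
Proof.
move=> e0; have [B [B0 [S BS] gB]] := gS r.
have [D0 HD] := prod_tail r (divr_gt0 e0 (expR_gt0 S)).
exists D0 => D sub z zr.
rewrite (perm_big _ (fset_split_perm sub)) big_cat /=.
rewrite -[X in _ - X]mulr1 -mulrBr normcM.
rewrite -[leRHS](@divfK _ (expR S)) ?gt_eqF ?expR_gt0 // mulrC.
rewrite ler_pM ?normc_ge0 //.
  by apply: HD => // k; rewrite in_fsetD => /andP[].
have [h _] := prod_sub1_le D0 (fun k => gB k z zr).
by rewrite (le_trans h) // ler_expR BS.
Qed.

(** Summability of the distances to 1, locally uniformly in z, makes the finite
    products a Cauchy net uniformly on discs.  The limit vanishes only if a factor
    does: outside a large finite set the product stays within 1/2 of 1. *)
Lemma infinite_product : exists G : C -> C, [/\ disc_approx G,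
  forall z e, 0 < e -> exists D0, forall D, (D0 `<=` D)%fset ->
    normc (G z - \prod_(k <- D) g k z) <= e &
  forall z, (forall k, g k z != 0) -> G z != 0].
Proof.
have /choice[G GP] z : exists l : C, forall e, 0 < e ->
    totally [set D : {fset K} | normc (l - \prod_(k <- D) g k z) <= e].
  apply: (cauchyC totally_filter) => e e0.
  have [D0 HD] := prod_cauchy (normc z) e0.
  exists (\prod_(k <- D0) g k z); exists D0 => // D /= sub.
  by rewrite normc_distC HD.
have GP' z e : 0 < e -> exists D0, forall D, (D0 `<=` D)%fset ->
    normc (G z - \prod_(k <- D) g k z) <= e.
  by move=> /(GP z)[D0 _ HD]; exists D0.
have Gunif r e : 0 < e -> exists D0, forall z, normc z <= r ->
    normc (G z - \prod_(k <- D0) g k z) <= e.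
  move=> e0; have [D0 HD] := prod_cauchy r e0; exists D0 => z zr.
  apply/ler_addgt0Pr => d /(GP' z)[D1 HD1].
  rewrite [leRHS]addrC (le_trans (normc_dist_triangle _ (\prod_(k <- (D0 `|` D1)%fset) g k z) _)) //.
  by rewrite lerD ?HD1 ?HD // ?fsubsetUr ?fsubsetUl.
exists G; split=> //.
  apply: disc_approx_lim => r e /(Gunif r)[D0 HD].
  by exists (fun z => \prod_(k <- D0) g k z) => //; apply: disc_approx_prod.
move=> z gz; apply/eqP => Gz.
have [D0 HD] := prod_tail (normc z) (ltac:(by rewrite invr_gt0) : 0 < 2^-1 :> R).
pose P0 := \prod_(k <- D0) g k z.
have P00 : P0 != 0 by rewrite prodf_seq_neq0; apply/allP => k _; rewrite gz.
have nP0 : 0 < normc P0 by rewrite normc_gt0.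
have [D1 HD1] := GP' z (normc P0 / 4) (divr_gt0 nP0 (ltr0Sn _ 3)).
have := HD1 (D0 `|` D1)%fset (fsubsetUr _ _).
rewrite Gz sub0r normc_opp (perm_big _ (fset_split_perm (fsubsetUl _ _))) big_cat /=.
rewrite -/P0 normcM; set s := (_ `\` _)%fset.
have sD : {in s, forall k, k \notin D0} by move=> k; rewrite in_fsetD => /andP[].
have := HD s (fset_uniq _) sD z (lexx _).
set P1 := \prod_(k <- _) _ => P1h.
have P1b : 2^-1 <= normc P1.
  have := normc_dist_triangle 1 P1 0; rewrite !subr0 normc1 normc_distC => h.
  have := le_trans h (lerD P1h (lexx _)) => {}h; lra.
have := ler_pM2l nP0 2^-1 (normc P1); rewrite P1b => h1 h2.
have := le_trans h1 h2; lra.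
Qed.

End InfiniteProduct.

(** * The lattice and the sum of its inverse cubes *)

Section LatticeSums.
Variable R : realType.
Local Notation C := R[i].

(** (n + 1)^(-3/2).  The sum over the lattice is bounded by a product of two sums
    over the integers, and the exponent has to exceed 1 in both. *)
Definition inv_sqrt3 n : R := (Num.sqrt n.+1%:R ^+ 3)^-1.

(** Telescoping: (n + 1)^(-3/2) <= 2 n^(-1/2) - 2 (n + 1)^(-1/2). *)
Lemma inv_sqrt3_sum N : \sum_(n < N.+1) inv_sqrt3 n <= 3 - 2 / Num.sqrt N.+1%:R.
Proof.
elim: N => [|N IH].
  by rewrite big_ord1 /inv_sqrt3 sqrtr1 expr1n invr1; lra.
rewrite big_ord_recr /= (le_trans (lerD IH (lexx _))) // /inv_sqrt3.
set t := Num.sqrt N.+1%:R; set s := Num.sqrt N.+2%:R.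
have t0 : 0 < t by rewrite sqrtr_gt0.
have s0 : 0 < s by rewrite sqrtr_gt0.
have st : s ^+ 2 = t ^+ 2 + 1.
  by rewrite !sqr_sqrtr // -[in LHS]natr1.
rewrite -addrA lerD2l -lerBrDl opprK addrC -(ler_pM2l (exprn_gt0 3 s0)) divff ?gt_eqF ?exprn_gt0 //.
rewrite -(ler_pM2l t0).
have -> : t * (s ^+ 3 * (2 / t - 2 / s)) = 2 * s ^+ 2 * (s - t) by field; rewrite ?gt_eqF.
have ts : (s - t) * (s + t) = 1 by rewrite -subr_sqr st; ring.
have s_t : t <= s by rewrite ler_wsqrtr // ler_nat.
rewrite -(ler_pM2r (addr_gt0 s0 t0)) -[leRHS]mulrA ts mulr1.
nra.
Qed.

Lemma sum_uniq_sub (T : eqType) (s t : seq T) (F : T -> R) : uniq s ->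
  {subset s <= t} -> (forall x, 0 <= F x) ->
  \sum_(x <- s) F x <= \sum_(x <- t) F x.
Proof.
move=> su st F0; elim: s t su st => [|x s IH] t /=.
  by rewrite big_nil sumr_ge0.
case/andP=> xs su st; have xt : x \in t by rewrite st ?mem_head.
rewrite big_cons (big_rem x xt) /= lerD2l; apply: IH => // y ys.
have yx : y != x by apply: contraNneq xs => <-.
have : y \in t by rewrite st // inE ys orbT.
by rewrite (perm_mem (perm_to_rem xt)) inE (negPf yx).
Qed.

Lemma lattice_ptE (p q : int) :
  lattice_pt R p q = (p%:~R + q%:~R) +i* (q%:~R - p%:~R).
Proof.
rewrite /lattice_pt.
have zE (n : int) : (n%:~R : C) = (n%:~R : R)%:C by rewrite rmorph_int.
rewrite !zE; apply/eqP; rewrite eq_complex /= !mul0r !mulr1 !subr0 mulrN1 !addr0.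
by rewrite eqxx /= addrC.
Qed.

Lemma lattice_pt_inj p q p' q' :
  lattice_pt R p q = lattice_pt R p' q' -> p = p' /\ q = q'.
Proof.
rewrite !lattice_ptE => -[e1 e2].
have pp : (p%:~R : R) = p'%:~R by lra.
have qq : (q%:~R : R) = q'%:~R by lra.
by move: pp qq => /eqP; rewrite eqr_int => /eqP-> /eqP; rewrite eqr_int => /eqP->.
Qed.

Lemma lattice_pt0 : lattice_pt R 0 0 = 0.
Proof. by rewrite /lattice_pt !mul0r addr0. Qed.

(** The squared modulus of the lattice point is 2(p^2 + q^2), which dominates
    (|p| + 1)(|q| + 1) / 4 away from the origin. *)
Lemma normc_lattice_ge p q : (p, q) != (0, 0) ->
  2^-1 * (Num.sqrt (`|p|%N.+1%:R) * Num.sqrt (`|q|%N.+1%:R)) <= normc (lattice_pt R p q).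
Proof.
move=> pq0; rewrite -(@ler_pXn2r _ 2) // ?nnegrE ?normc_ge0 ?mulr_ge0 ?sqrtr_ge0 //.
rewrite !exprMn !sqr_sqrtr // lattice_ptE /= sqr_sqrtr ?addr_ge0 ?sqr_ge0 //.
set P := `|p|%N; set Q := `|q|%N.
have pP : (p%:~R : R) ^+ 2 = P%:R ^+ 2.
  by rewrite -[LHS]real_normK ?num_real // -intr_norm -abszE.
have qQ : (q%:~R : R) ^+ 2 = Q%:R ^+ 2.
  by rewrite -[LHS]real_normK ?num_real // -intr_norm -abszE.
have -> : ((p%:~R + q%:~R) ^+ 2 + (q%:~R - p%:~R) ^+ 2 : R) = 2 * (P%:R ^+ 2 + Q%:R ^+ 2).
  by rewrite -pP -qQ; ring.
have PQ : (P.+1 * Q.+1 <= 8 * (P ^ 2 + Q ^ 2))%N.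
  have : (P + Q > 0)%N.
    rewrite lt0n addn_eq0 !absz_eq0; apply: contra pq0 => /andP[/eqP-> /eqP->].
    by rewrite eqxx.
  rewrite !expnS !expn0 !muln1; nia.
have : (P.+1 * Q.+1)%:R <= (8 * (P ^ 2 + Q ^ 2))%:R :> R by rewrite ler_nat.
rewrite !natrM natrD !natrX; lra.
Qed.

Lemma lattice_term_le p q : (p, q) != (0, 0) ->
  (normc (lattice_pt R p q) ^+ 3)^-1 <= 8 * (inv_sqrt3 `|p|%N * inv_sqrt3 `|q|%N).
Proof.
move=> /normc_lattice_ge; rewrite /inv_sqrt3.
set a := Num.sqrt _; set b := Num.sqrt _; set l := normc _ => h.
have a0 : 0 < a by rewrite sqrtr_gt0.
have b0 : 0 < b by rewrite sqrtr_gt0.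
have -> : 8 * ((a ^+ 3)^-1 * (b ^+ 3)^-1) = ((2^-1 * (a * b)) ^+ 3)^-1.
  by field; rewrite ?gt_eqF.
have ab0 : 0 < 2^-1 * (a * b) by rewrite !mulr_gt0.
rewrite lef_pV2 ?posrE ?exprn_gt0 ?(lt_le_trans ab0 h) //.
by rewrite lerXn2r ?nnegrE ?(ltW ab0) // (le_trans (ltW ab0) h).
Qed.

Lemma lattice_sum_bound : exists S : R, forall s : seq (int * int), uniq s ->
  \sum_(k <- s | k != (0, 0)) (normc (lattice_pt R k.1 k.2) ^+ 3)^-1 <= S.
Proof.
pose F (n : int) := inv_sqrt3 `|n|%N.
have F0 n : 0 <= F n by rewrite invr_ge0 exprn_ge0 // sqrtr_ge0.
pose line N : seq int := [seq Posz n | n <- iota 0 N.+1] ++ [seq - Posz n | n <- iota 0 N.+1].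
have lineS N : \sum_(n <- line N) F n <= 6.
  have h : \sum_(n <- iota 0 N.+1) inv_sqrt3 n <= 3.
    rewrite -[iota _ _]/(index_iota 0 N.+1) big_mkord (le_trans (inv_sqrt3_sum N)) //.
    by rewrite gerBl divr_ge0 // sqrtr_ge0.
  rewrite big_cat !big_map /= /F.
  under [X in _ + X]eq_bigr do rewrite abszN.
  by rewrite (le_trans (lerD h h)) // -natrD.
have in_line n N : (`|n|%N <= N)%N -> n \in line N.
  move=> nN; rewrite mem_cat; case: (intP n) nN => [|m|m] nN.
  - by rewrite map_f // mem_iota.
  - by rewrite map_f // mem_iota add0n ltnS.
  - apply/orP; right; apply/mapP; exists m.+1 => //.
    by rewrite mem_iota add0n ltnS; move: nN; rewrite abszN.
(* Each of the two sums over the integers is at most 3 + 3. *)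
exists (8 * (6 * 6)) => s su.
pose N := \max_(k <- s) maxn `|k.1|%N `|k.2|%N.
apply: (@le_trans _ _ (\sum_(k <- s) 8 * (F k.1 * F k.2))).
  rewrite big_mkcond; apply: ler_sum => -[p q] _ /=.
  case: ifP => [/lattice_term_le//|_].
  by rewrite mulr_ge0 // mulr_ge0.
rewrite -mulr_sumr ler_pM2l //.
apply: (@le_trans _ _ (\sum_(k <- allpairs pair (line N) (line N)) F k.1 * F k.2)).
  apply: sum_uniq_sub => // [[p q] pqs|k]; last by rewrite mulr_ge0.
  have : (maxn `|p| `|q| <= N)%N.
    exact: (@leq_bigmax_seq _ s xpredT (fun k : int * int => maxn `|k.1|%N `|k.2|%N) (p, q) pqs isT).
  rewrite geq_max => /andP[pN qN].
  by apply/allpairsP; exists (p, q); rewrite !in_line.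
rewrite big_allpairs /=.
under eq_bigr do rewrite -mulr_sumr.
by rewrite -mulr_suml ler_pM // sumr_ge0.
Qed.

End LatticeSums.

(** * Zeros of the sigma function *)

Section SigmaFunction.
Variable R : realType.
Local Notation C := R[i].
Implicit Types (z w : C) (k : int * int) (r e : R).

Local Notation lam k := (lattice_pt R k.1 k.2).

Lemma lattice_pt_eq0 k : (lam k == 0) = (k == (0, 0)).
Proof.
case: k => p q; apply/eqP/eqP => [|[-> ->]]; last exact: lattice_pt0.
by rewrite -lattice_pt0 => /lattice_pt_inj[/= -> ->].
Qed.

(** The Weierstrass factor of order 2. *)
Definition primary_factor w : C := (1 - w) * cexp (w + 2^-1 * w ^+ 2).

Lemma primary_factor_approx (a : C) : disc_approx (fun z => primary_factor (z / a)).
Proof.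
pose p : {poly C} := a^-1 *: 'X + (2^-1 * a^-1 ^+ 2) *: 'X^2.
move=> r e e0; have [q qr] := disc_approxM
  (disc_approx_poly (1%:P - a^-1 *: 'X)) (disc_approx_comp p (@cexp_approx R)) r e0.
exists q => z /qr; rewrite /primary_factor.
have -> : (1%:P - a^-1 *: 'X).[z] = 1 - z / a by rewrite
    !(hornerD, hornerN, hornerZ, hornerXn, hornerX, hornerC) mulrC.
suff -> : p.[z] = z / a + 2^-1 * (z / a) ^+ 2 by [].
by rewrite !(hornerD, hornerN, hornerZ, hornerXn, hornerX, hornerC); ring.
Qed.

(** With u = w + w^2/2, the product (1 - w)(1 + u + u^2/2) equals 1 up to a
    multiple of w^3, and exp u differs from 1 + u + u^2/2 by O(u^3). *)
Lemma primary_factor_order3 r : exists2 c : R, 0 < c &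
  forall w, normc w <= r -> normc (primary_factor w - 1) <= c * normc w ^+ 3.
Proof.
pose p : {poly C} := - (2^-1%:P + (3 / 8) *: 'X + 8^-1 *: 'X^2).
pose q : {poly C} := 1%:P + 2^-1 *: 'X.
have [M1 M10 pM] := horner_bounded p r.
have [M2 M20 qM] := horner_bounded q r.
have [M3 M30 sM] := horner_bounded (1%:P - 'X : {poly C}) r.
exists (M1 + M3 * (M2 ^+ 3 * expR (r * M2))).
  by rewrite ltr_pwDl // !mulr_ge0 ?expR_ge0 ?exprn_ge0 ?ltW.
move=> w wr; pose u := w * q.[w].
have uE : w + 2^-1 * w ^+ 2 = u by rewrite /u
    !(hornerD, hornerN, hornerZ, hornerXn, hornerX, hornerC); ring.
have -> : primary_factor w - 1 = w ^+ 3 * p.[w] +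
    (1%:P - 'X).[w] * (cexp u - (1 + u + u ^+ 2 / 2)).
  by rewrite /primary_factor uE /u /q /p
    !(hornerD, hornerN, hornerZ, hornerXn, hornerX, hornerC); field.
rewrite (le_trans (normcD_le _ _)) // mulrDl lerD //.
  by rewrite normcM normcX mulrC ler_wpM2r ?exprn_ge0 ?normc_ge0 ?pM.
rewrite normcM -[leRHS]mulrA ler_pM ?normc_ge0 ?sM //.
rewrite (le_trans (cexp_order3 _)) //.
have uM : normc u <= normc w * M2 by rewrite normcM ler_wpM2l ?normc_ge0 ?qM.
have -> : M2 ^+ 3 * expR (r * M2) * normc w ^+ 3 =
  (normc w * M2) ^+ 3 * expR (r * M2) by ring.
rewrite ler_pM ?exprn_ge0 ?normc_ge0 ?expR_ge0 //.
  by rewrite lerXn2r ?nnegrE ?normc_ge0 ?mulr_ge0 ?normc_ge0 ?(ltW M20).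
by rewrite ler_expR (le_trans uM) // ler_pM2r.
Qed.

Lemma primary_factor_neq0 w : w != 1 -> primary_factor w != 0.
Proof. by move=> w1; rewrite mulf_neq0 ?cexp_neq0 // subr_eq0 eq_sym. Qed.

Lemma lattice_normc_ge1 k : k != (0, 0) -> 1 <= normc (lam k).
Proof.
case: k => p q /= pq0; rewrite lattice_ptE /=.
rewrite -[X in X <= _]sqrtr1 ler_wsqrtr //.
have pq1 : (1 <= p ^+ 2 + q ^+ 2 :> int).
  rewrite -gtz0_ge1 lt_def addr_ge0 ?sqr_ge0 // andbT.
  apply: contra pq0; rewrite paddr_eq0 ?sqr_ge0 // !sqrf_eq0.
  by move=> /andP[/eqP-> /eqP->].
have : (1%:~R <= (p ^+ 2 + q ^+ 2)%:~R :> R) by rewrite ler_int.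
rewrite rmorphD /= !rmorphXn /= => h.
have := sqr_ge0 (p%:~R : R); have := sqr_ge0 (q%:~R : R); nra.
Qed.

(** Leaving out the factors at X isolates the zero at a chosen lattice
    point. *)
Definition lattice_factor (X : pred (int * int)) k z : C :=
  if k \in X then 1 else primary_factor (z / lam k).

Lemma lattice_product (X : pred (int * int)) : (0, 0) \in X ->
  exists G : C -> C, [/\ disc_approx G,
  forall z e, 0 < e -> exists D0 : {fset int * int}, forall D : {fset int * int},
    (D0 `<=` D)%fset ->
    normc (G z - \prod_(k <- D) lattice_factor X k z) <= e &
  forall z, (forall k, k \notin X -> z != lam k) -> G z != 0].
Proof.
move=> X0.
have H1 k : disc_approx (lattice_factor X k).
  rewrite /lattice_factor; case: (k \in X); last exact: primary_factor_approx.
  by move=> r e e0; exists 1 => z _; rewrite hornerE subrr normc0 ltW.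
have H2 r : exists B : int * int -> R, [/\ forall k, 0 <= B k,
    exists S : R, forall s, uniq s -> \sum_(k <- s) B k <= S &
    forall k z, normc z <= r -> normc (lattice_factor X k z - 1) <= B k].
  have [c c0 cP] := primary_factor_order3 r.
  exists (fun k => if k == (0, 0) then 0 else
    (c * `|r| ^+ 3) * (normc (lam k) ^+ 3)^-1); split.
  - move=> k; case: ifP => // _.
    by rewrite !mulr_ge0 ?invr_ge0 ?exprn_ge0 ?normc_ge0 ?(ltW c0).
  - have [S SP] := lattice_sum_bound R; exists ((c * `|r| ^+ 3) * S) => s su.
    rewrite (le_trans _ (ler_wpM2l _ (SP s su))) ?mulr_ge0 ?exprn_ge0 ?(ltW c0) //.
    rewrite mulr_sumr [leRHS]big_mkcond /=; apply: ler_sum => k _.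
    by case: eqP.
  - move=> k z zr; have r0 : 0 <= r by rewrite (le_trans _ zr) ?normc_ge0.
    rewrite /lattice_factor; case: eqVneq => [->|k0].
      by rewrite X0 subrr normc0.
    case: ifP => _.
      by rewrite subrr normc0 !mulr_ge0 ?invr_ge0 ?exprn_ge0 ?normc_ge0 ?(ltW c0).
    have l1 := lattice_normc_ge1 k0.
    have l0 : 0 < normc (lam k) by rewrite (lt_le_trans ltr01).
    have zl : normc (z / lam k) <= r.
      rewrite normcM normcV ler_pdivrMr // (le_trans zr) // ler_peMr //.
    rewrite (le_trans (cP _ zl)) // normcM normcV exprMn exprVn -mulrA.
    rewrite ler_pM2l // ler_wpM2r ?invr_ge0 ?exprn_ge0 ?normc_ge0 //.
    by rewrite lerXn2r ?nnegrE ?normc_ge0 // ger0_norm.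
have [G [G1 G2 G3]] := infinite_product H1 H2.
exists G; split=> // z zX; apply: G3 => k; rewrite /lattice_factor.
case: ifPn => [_|kX]; first exact: oner_neq0.
apply: primary_factor_neq0; apply: contra (zX k kX) => /eqP zl.
have l0 : lam k != 0.
  by rewrite lattice_pt_eq0; apply: contraNneq kX => ->.
by rewrite -(divfK l0 z) zl mul1r.
Qed.

Lemma sigma_lim (G : C -> C) :
  (forall z e, 0 < e -> exists D0 : {fset int * int}, forall D : {fset int * int},
    (D0 `<=` D)%fset ->
    normc (G z - \prod_(k <- D) lattice_factor (pred1 (0, 0)) k z) <= e) ->
  forall z, sigma z = z * G z.
Proof.
move=> GP z; congr (_ * _).
apply: (cvgC_lim totally_filter) => e /(GP z)[D0 HD]; exists D0 => // D /= /HD.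
rewrite [X in _ -> normc (_ - X) <= _]big_mkcond /=.
suff -> : \prod_(i <- D) (if i != (0, 0) then sigma_factor z i else 1) =
  \prod_(k <- D) lattice_factor (pred1 (0, 0)) k z by [].
apply: eq_bigr => k _; rewrite /lattice_factor inE; by case: eqP.
Qed.

(** Simplicity of the zeros: h is the product over the other lattice points,
    which does not vanish at the point of index k. *)
Lemma sigma_factorization k : exists h : C -> C, [/\ disc_approx h,
  forall z, sigma z = (z - lam k) * h z &
  forall z, (forall j, j != k -> z != lam j) -> h z != 0].
Proof.
have [G [G1 G2 G3]] := lattice_product (X := pred1 (0, 0)) (eqxx _).
have [->|k0] := eqVneq k (0, 0).
  by exists G; split=> // z; rewrite (sigma_lim G2) lattice_pt0 subr0.
have [H [H1 H2 H3]] := lattice_product (X := pred2 (0, 0) k) (predU1l _ (erefl _)).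
have l0 : lam k != 0 by rewrite lattice_pt_eq0.
have GH z : G z = primary_factor (z / lam k) * H z.
  apply: normc_eps_eq => e e0; set a := primary_factor _.
  have e20 : 0 < e / 2 by rewrite divr_gt0.
  have a0 : 0 < normc a + 1 by rewrite ltr_wpDl ?normc_ge0.
  have [D0 HD0] := G2 z (e / 2) e20.
  have [D1 HD1] := H2 z (e / 2 / (normc a + 1)) (divr_gt0 e20 a0).
  pose D := (k |` (D0 `|` D1))%fset.
  have sub0 : (D0 `<=` D)%fset.
    by rewrite (fsubset_trans (fsubsetUl D0 D1)) // fsubsetUr.
  have sub1 : (D1 `<=` D)%fset.
    by rewrite (fsubset_trans (fsubsetUr D0 D1)) // fsubsetUr.
  have kD : k \in (D : seq _) by rewrite fset1U1.
  have PE : \prod_(j <- D) lattice_factor (pred1 (0, 0)) j z =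
      a * \prod_(j <- D) lattice_factor (pred2 (0, 0) k) j z.
    rewrite (big_rem k kD) [in RHS](big_rem k kD) /=.
    rewrite {1}/lattice_factor inE (negPf k0) -/a; congr (_ * _).
    rewrite [lattice_factor (pred2 _ _) k z]/lattice_factor !inE eqxx orbT mul1r.
    rewrite big_seq [RHS]big_seq; apply: eq_bigr => j.
    rewrite mem_rem_uniq ?fset_uniq // inE => /andP[jk _].
    by rewrite /lattice_factor !inE (negPf jk) orbF.
  have := HD0 _ sub0; rewrite PE.
  set P := \prod_(j <- D) _ => h.
  rewrite (le_trans (normc_dist_triangle _ (a * P) _)) //.
  rewrite (splitr e) lerD // -mulrBr normcM mulrC normc_distC.
  rewrite -[leRHS](@divfK _ (normc a + 1)) ?gt_eqF //.
  by rewrite ler_pM ?normc_ge0 ?HD1 ?lerDl.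
pose p : {poly C} := (lam k)^-1 *: 'X + (2^-1 * (lam k)^-1 ^+ 2) *: 'X^2.
have pE z : p.[z] = z / lam k + 2^-1 * (z / lam k) ^+ 2.
  by rewrite
    !(hornerD, hornerN, hornerZ, hornerXn, hornerX, hornerC); ring.
exists (fun z => (- (lam k)^-1 *: 'X).[z] * cexp p.[z] * H z); split.
- apply: disc_approxM => //; apply: disc_approxM; first exact: disc_approx_poly.
  exact: disc_approx_comp (@cexp_approx R).
- by move=> z; rewrite (sigma_lim G2) GH /primary_factor -pE
    !(hornerD, hornerN, hornerZ, hornerXn, hornerX, hornerC); field.
- move=> z zP; have z0 : z != 0.
    by rewrite -lattice_pt0; apply: (zP (0, 0)); rewrite eq_sym.
  rewrite !mulf_neq0 ?cexp_neq0 //.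
    by rewrite !hornerE mulf_neq0 // oppr_eq0 invr_eq0.
  by apply: H3 => j; rewrite !inE negb_or => /andP[_ /zP].
Qed.

Lemma sigma_approx : disc_approx (@sigma R).
Proof.
have [h [hH hE _]] := sigma_factorization (0, 0).
move=> r e e0; have [p pr] := disc_approxM (disc_approx_poly 'X) hH r e0.
by exists p => z /pr; rewrite hE lattice_pt0 subr0 hornerX.
Qed.

Lemma sigma_lattice k : sigma (lam k) = 0.
Proof. by have [h [_ -> _]] := sigma_factorization k; rewrite subrr mul0r. Qed.

Lemma sigma_eq0 z : sigma z = 0 -> exists k, z = lam k.
Proof.
move=> sz; apply: contrapT => nz.
have zP k : z != lam k by apply/eqP => zk; apply: nz; exists k.
have [h [_ hE h0]] := sigma_factorization (0, 0).
move/eqP: sz; rewrite hE mulf_eq0 subr_eq0 (negPf (zP _)) /=.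
by rewrite (negPf (h0 _ (fun j _ => zP j))).
Qed.

Lemma lattice_pt_neq j k : j != k -> lam k != lam j.
Proof.
case: j k => p q [p' q'] /=; apply: contra => /eqP/lattice_pt_inj[-> ->].
exact: eqxx.
Qed.

Lemma sigma_simple_zeros : simple_zeros (@sigma R).
Proof.
move=> mu /sigma_eq0[k ->]; have [h [hH hE h0]] := sigma_factorization k.
by exists h; split=> //; apply: h0 => j; apply: lattice_pt_neq.
Qed.

(** At the removed zero, where sigma_quot is defined as a limit, continuity of
    the cofactor h gives the value. *)
Lemma sigma_quotE k : exists h : C -> C, [/\ disc_approx h,
  forall z, sigma_quot k.1 k.2 z = h z & forall j, (h (lam j) == 0) = (j != k)].
Proof.
have [h [hH hE h0]] := sigma_factorization k; exists h; split=> //; last first.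
  move=> j; have [->|jk] := eqVneq j k.
    by apply: negbTE; apply: h0 => i; apply: lattice_pt_neq.
  have := sigma_lattice j; rewrite hE => /eqP; rewrite mulf_eq0 subr_eq0.
  by rewrite eq_sym (negPf (lattice_pt_neq jk)).
move=> z; rewrite /sigma_quot /div_root; have [->|zk] := eqVneq z (lam k); last first.
  by rewrite hE mulrAC divff ?mul1r // subr_eq0.
apply: cvgC_lim => e e0.
have [d d0 dP] := disc_approx_cont (lam k) hH e0.
have : \forall w \near ((lam k : C^o))^', `|(lam k : C^o) - w| < d%:C /\ w != lam k.
  near=> w; split; last by near: w; exact: nbhs_dnbhs_neq.
  near: w; apply: nbhs_dnbhs; apply: nbhsx_ballx => /=.
  by rewrite ltcR.
apply: filterS => w [wd wk].
rewrite hE mulrAC divff ?mul1r ?subr_eq0 // normc_distC dP //.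
by move: wd; rewrite normr_normc ltcR normc_distC => /ltW.
Unshelve. all: by end_near.
Qed.

End SigmaFunction.

(** * Gradings of a vector space *)

Section Gradings.
Variables (K : fieldType) (E : vectType K) (J : choiceType).
Implicit Types (I : J -> {vspace E}) (pr : J -> 'End(E)) (D : seq J).
Implicit Types (x y : E) (P Q : set J) (j k : J).

(** I k is the component of degree k and pr k the projection onto it along the
    others; D is a finite list of degrees that contains all the nonzero ones. *)
Record grading I pr D : Prop := Grading {
  gr_uniq : uniq D;
  gr_mem : forall k x, pr k x \in I k;
  gr_sum : forall x, x = \sum_(k <- D) pr k x;
  gr_delta : forall k j x, x \in I k -> pr j x = if j == k then x else 0 }.

(** Uniqueness of the decomposition makes its components linear in x. *)
Lemma grading_exists I D : uniq D ->
  (forall x, exists c : J -> E, (forall k, c k \in I k) /\ x = \sum_(k <- D) c k) ->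
  (forall c : J -> E, (forall k, c k \in I k) -> \sum_(k <- D) c k = 0 ->
    {in D, forall k, c k = 0}) ->
  (forall k, k \notin D -> I k = 0%VS) ->
  exists pr, grading I pr D.
Proof.
move=> Du /choice[c cP] indep I0.
have cI x k : c x k \in I k by have [] := cP x.
have cS x : x = \sum_(k <- D) c x k by have [] := cP x.
have c_uniq x (d : J -> E) : (forall k, d k \in I k) -> x = \sum_(k <- D) d k ->
    forall k, c x k = d k.
  move=> dI dS k; have [kD|/I0 Ik] := boolP (k \in D); last first.
    by have := cI x k; have := dI k; rewrite Ik !memv0 => /eqP-> /eqP->.
  apply/eqP; rewrite -subr_eq0; apply/eqP.
  apply: (indep (fun k => c x k - d k)) => // [j|]; first exact: memvB.
  by rewrite sumrB -cS -dS subrr.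
have cL k : linear (fun x => c x k).
  move=> a x y; apply: (c_uniq _ (fun k => a *: c x k + c y k)) => [j|].
    by rewrite memvD ?memvZ.
  by rewrite big_split -scaler_sumr -!cS.
pose cA k := GRing.isLinear.Build _ _ _ _ _ (cL k).
pose cLin k : {linear E -> E} := HB.pack (fun x => c x k) (cA k).
exists (fun k => linfun (cLin k)); split=> //.
- by move=> k x; rewrite lfunE /=; apply: cI.
- by move=> x; under eq_bigr do rewrite lfunE /=.
move=> k j x xk; rewrite lfunE /=; apply: (c_uniq x (fun j => if j == k then x else 0)).
  by move=> i; case: eqP => [->|_]; rewrite ?mem0v.
have [kD|kD] := boolP (k \in D); last first.
  by have := xk; rewrite I0 // memv0 => /eqP->; rewrite big1 // => i _; case: ifP.
rewrite (big_rem k kD) /= eqxx big_seq big1 ?addr0 // => i.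
by rewrite mem_rem_uniq // inE => /andP[/negPf->].
Qed.

Lemma finite_support_mem P I k : k \in finite_support 0%VS P I -> P k.
Proof.
have [fin|inf] := pselect (finite_set (P `&` I @^-1` [set~ 0%VS])).
  by rewrite in_finite_support // inE => -[].
by rewrite no_finite_support.
Qed.

Lemma fsum_addv_sub P I (U : {vspace E}) :
  (forall k, P k -> (I k <= U)%VS) -> (\big[addv/0%VS]_(k \in P) I k <= U)%VS.
Proof.
move=> IU; rewrite big_seq; apply: (big_ind (fun V => (V <= U)%VS)).
- exact: sub0v.
- by move=> V1 V2 ? ?; rewrite subv_add; apply/andP.
by move=> k /finite_support_mem/IU.
Qed.

(** Without the finiteness condition the sum is 0 by convention. *)
Lemma fsum_addv_sup P I k : finite_set [set j | P j /\ I j <> 0%VS] -> P k ->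
  (I k <= \big[addv/0%VS]_(j \in P) I j)%VS.
Proof.
move=> fin Pk; have [->|/eqP Ik] := eqVneq (I k) 0%VS; first exact: sub0v.
have kS : k \in finite_support 0%VS P I by rewrite in_finite_support // inE.
by rewrite (big_rem k kS) /= addvSl.
Qed.

Variables (I0 : J -> {vspace E}) (pr : J -> 'End(E)) (D : seq J).
Hypothesis G : grading I0 pr D.

Lemma gr_id k x : x \in I0 k -> pr k x = x.
Proof. by move=> /(gr_delta G k) ->; rewrite eqxx. Qed.

Lemma gr_neq k j x : x \in I0 k -> j != k -> pr j x = 0.
Proof. by move=> /(gr_delta G j) -> /negPf->. Qed.

Lemma gr_pr k j x : pr j (pr k x) = if j == k then pr k x else 0.
Proof. exact: (gr_delta G _ (gr_mem G _ _)). Qed.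

Lemma gr_supp k x : pr k x != 0 -> k \in D.
Proof.
apply: contraNT => kD; rewrite (gr_sum G (pr k x)) big_seq big1 // => j jD.
by rewrite gr_pr; case: eqP => // jk; rewrite -jk jD in kD.
Qed.

Lemma gr_eq x y : (forall k, pr k x = pr k y) -> x = y.
Proof. by move=> xy; rewrite (gr_sum G x) (gr_sum G y); apply: eq_bigr. Qed.

Lemma gr_memP k x : reflect (forall j, j != k -> pr j x = 0) (x \in I0 k).
Proof.
apply: (iffP idP) => [xk j|x0]; first exact: gr_neq.
suff -> : x = pr k x by exact: (gr_mem G).
apply: gr_eq => j; rewrite gr_pr; case: eqP => [->//|/eqP/x0//].
Qed.

(** Membership in a sum of components, in a form in which the combinatorics of
    indices is visible; see gr_fsumP. *)
Definition supported P x : Prop := forall k, pr k x != 0 -> P k.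

Lemma supported_sub P Q x : P `<=` Q -> supported P x -> supported Q x.
Proof. by move=> PQ Px k /Px/PQ. Qed.

Lemma supportedD P x y : supported P x -> supported P y -> supported P (x + y).
Proof.
move=> Px Py k; rewrite linearD /=.
by have [->|/Px//] := eqVneq (pr k x) 0; rewrite add0r => /Py.
Qed.

Lemma supportedZ P a x : supported P x -> supported P (a *: x).
Proof. by move=> Px k; rewrite linearZ /= scaler_eq0 negb_or => /andP[_ /Px]. Qed.

Lemma supportedB P x y : supported P x -> supported P y -> supported P (x - y).
Proof. by move=> Px Py; apply: supportedD => //; rewrite -scaleN1r; exact: supportedZ. Qed.

Lemma supported_sum (T : Type) (s : seq T) (q : pred T) P (u : T -> E) :
  (forall t, q t -> supported P (u t)) -> supported P (\sum_(t <- s | q t) u t).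
Proof.
move=> Pu; apply: (big_ind (supported P)) => //; last exact: supportedD.
by move=> k; rewrite linear0 eqxx.
Qed.

Lemma supported_mem P k x : x \in I0 k -> P k -> supported P x.
Proof.
move=> xk Pk j; have [->//|jk] := eqVneq j k.
by rewrite (gr_neq xk jk) eqxx.
Qed.

Lemma supported_split P k x : supported P x ->
  supported [set j | P j /\ j != k] (x - pr k x).
Proof.
move=> Px j; rewrite linearB /= gr_pr; have [->|jk] := eqVneq j k.
  by rewrite subrr eqxx.
by rewrite subr0 => /Px.
Qed.

Lemma grading_finite P : finite_set [set k | P k /\ I0 k <> 0%VS].
Proof.
apply: (@sub_finite_set _ _ [set` D]); last exact: finite_seq.
move=> k [_ /eqP Ik] /=; have x0 : vpick (I0 k) != 0 by rewrite vpick0.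
by apply: (@gr_supp k (vpick (I0 k))); rewrite gr_id ?memv_pick.
Qed.

Lemma gr_fsumP P x :
  x \in (\big[addv/0%VS]_(k \in P) I0 k)%VS <-> supported P x.
Proof.
split=> [|Px].
  move: x; rewrite big_seq.
  apply: (big_ind (fun U : {vspace E} => forall x, x \in U -> supported P x)).
  - by move=> x; rewrite memv0 => /eqP-> k; rewrite linear0 eqxx.
  - by move=> U1 U2 P1 P2 x /memv_addP[u /P1 ? [v /P2 ? ->]]; apply: supportedD.
  by move=> k /finite_support_mem Pk x xk; apply: supported_mem Pk.
rewrite (gr_sum G x); apply: memv_suml => k _.
have [->|/Px Pk] := eqVneq (pr k x) 0; first exact: mem0v.
by apply: (subvP (fsum_addv_sup (grading_finite P) Pk)); apply: (gr_mem G).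
Qed.

End Gradings.

(** * Complex conjugation and pairs of indices *)

Section Conjugation.
Variables (R : realType) (V : vectType R).
Local Notation C := R[i].
Implicit Types (x y : cplx V).

Lemma cconjK : involutive (@cconj R V).
Proof. by case=> y z; rewrite /cconj /= opprK. Qed.

Lemma cconjD x y : cconj (x + y) = cconj x + cconj y.
Proof. by case: x y => [? ?] [? ?]; rewrite /cconj /= opprD. Qed.

Lemma cconjZ (a : C) x : cconj (a *: x) = conjc a *: cconj x.
Proof.
case: a x => a b [u v]; rewrite /cconj /GRing.scale /= /cplx_scale /=.
congr (_, _); first by rewrite scaleNr scalerN opprK.
by rewrite scalerN scaleNr opprD.
Qed.

Lemma cconj0 : cconj (0 : cplx V) = 0.
Proof. by rewrite /cconj /= oppr0. Qed.

Lemma cconjN x : cconj (- x) = - cconj x.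
Proof. by apply/eqP; rewrite -addr_eq0 -cconjD addNr cconj0. Qed.

Lemma cconjB x y : cconj (x - y) = cconj x - cconj y.
Proof. by rewrite cconjD cconjN. Qed.

Lemma cconj_sum (T : Type) (s : seq T) (P : pred T) (u : T -> cplx V) :
  cconj (\sum_(t <- s | P t) u t) = \sum_(t <- s | P t) cconj (u t).
Proof. by apply: big_morph => //; [exact: cconjD|exact: cconj0]. Qed.

End Conjugation.

Definition swap (k : int * int) : int * int := (k.2, k.1).

Definition below (k : int * int) : set (int * int) :=
  [set j | j.1 < k.1 /\ j.2 < k.2].

Lemma swapK : involutive swap.
Proof. by case. Qed.

Lemma below_swap j k : below k j -> below (swap k) (swap j).
Proof. by case. Qed.

Lemma below_trans i j k : below k j -> below j i -> below k i.
Proof. by move=> [a b] [c d]; split; [apply: lt_trans c a|apply: lt_trans d b]. Qed.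

Lemma conjc_lattice_pt (R : realType) (p q : int) :
  conjc (lattice_pt R p q) = lattice_pt R q p.
Proof.
rewrite !lattice_ptE /=; apply/eqP; rewrite eq_complex /= opprB.
by rewrite [q%:~R + _]addrC !eqxx.
Qed.

Lemma int_pair_bounded (D : seq (int * int)) : exists M : int,
  forall k : int * int, k \in D -> [/\ - M < k.1, k.1 < M, - M < k.2 & k.2 < M].
Proof.
exists (1 + \sum_(k <- D) (`|k.1| + `|k.2|)) => k kD.
rewrite (big_rem k kD) /=; set S := \sum_(j <- _) _.
have S0 : 0 <= S by rewrite sumr_ge0 // => j _; rewrite addr_ge0.
by case: k kD S S0 => [p q] _ /= S S0; split; lia.
Qed.

(** * Sigma-operators as gradings by pairs of integers *)

Section SigmaOperators.
Variables (R : realType) (E : vectType R[i]).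
Local Notation C := R[i].
Local Notation lam k := (lattice_pt R k.1 k.2).
Implicit Types (A : 'End(E)) (x y : E) (j k : int * int).

Lemma eigen_pqP A k x : reflect (A x = lam k *: x) (x \in eigen_pq A k).
Proof.
by rewrite memv_ker subr_scalarE subr_eq0; exact: eqP.
Qed.

Lemma lattice_pt_pair_inj : injective (fun k : int * int => lam k).
Proof. by move=> [p q] [p' q'] /= /lattice_pt_inj[-> ->]. Qed.

(** The eigenvalues are zeros of sigma, hence lattice points, and distinct
    indices give distinct eigenvalues. *)
Lemma sigma_operator_grading A : sigma_operator A ->
  exists pr D, grading (eigen_pq A) pr D.
Proof.
move=> /(annihilator_decomp (@sigma_approx R) (@sigma_simple_zeros R))[s [su sZ sD]].
pose idx (mu : C) : int * int := xget (0, 0) [set k | lam k = mu].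
have idxK k : idx (lam k) = k.
  apply: lattice_pt_pair_inj; apply: (xgetPex (0, 0) (P := [set j | lam j = lam k])).
  by exists k.
have lamK mu : mu \in s -> lam (idx mu) = mu.
  by move=> /sZ/sigma_eq0[k ->]; rewrite idxK.
pose D := [seq idx mu | mu <- s].
have Du : uniq D.
  rewrite map_inj_in_uniq // => mu nu mus nus e.
  by rewrite -(lamK mu mus) -(lamK nu nus) e.
have DS (c : C -> E) : \sum_(k <- D) c (lam k) = \sum_(mu <- s) c mu.
  by rewrite big_map big_seq [RHS]big_seq; apply: eq_bigr => mu /lamK ->.
suff [pr prG] : exists pr, grading (eigen_pq A) pr D by exists pr, D.
apply: grading_exists => // [x|c cE cS k kD|k kD].
- have [c [cA ->]] := sD x; exists (fun k => c (lam k)); split; last by rewrite DS.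
  by move=> k; apply/eigen_pqP/cA.
- pose c' mu := if lam (idx mu) == mu then c (idx mu) else 0.
  have c'E j : c' (lam j) = c j by rewrite /c' idxK eqxx.
  have c'A mu : A (c' mu) = mu *: c' mu.
    rewrite /c'; case: eqP => [{2}<-|_]; last by rewrite linear0 scaler0.
    by apply/eigen_pqP/cE.
  have c'S : \sum_(mu <- s) c' mu = 0.
    by rewrite -DS -[RHS]cS; apply: eq_bigr => j _; rewrite c'E.
  rewrite -c'E; apply: (eigen_independent su c'A c'S).
  by case/mapP: kD => mu mus ->; rewrite lamK.
apply/eqP; rewrite -subv0; apply/subvP => x /eigen_pqP xk.
have [c [cA xS]] := sD x.
have ks : lam k \notin s.
  by apply: contra kD => ks; rewrite -(idxK k) map_f.
(* An eigenvector outside D would be a combination of the others. *)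
pose c' mu := if mu == lam k then - x else c mu.
have c'A mu : A (c' mu) = mu *: c' mu.
  by rewrite /c'; case: eqP => [->|_]; rewrite ?cA // linearN /= xk scalerN.
have c'S : \sum_(mu <- lam k :: s) c' mu = 0.
  rewrite big_cons {1}/c' eqxx {1}xS; apply/eqP; rewrite addrC subr_eq0; apply/eqP.
  rewrite big_seq [RHS]big_seq; apply: eq_bigr => mu mus; rewrite /c'.
  by case: eqP => // muk; rewrite -muk mus in ks.
have su' : uniq (lam k :: s) by rewrite /= ks.
have := eigen_independent su' c'A c'S (mem_head _ _).
by rewrite /c' eqxx => /eqP; rewrite oppr_eq0 memv0.
Qed.

Lemma grading_sigma_operator A pr D :
  grading (eigen_pq A) pr D -> sigma_operator A.
Proof.
move=> G; apply/lfunP => x; rewrite zero_lfunE (gr_sum G x) linear_sum big1 // => k _.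
have /eigen_pqP Ax := gr_mem G k x.
by rewrite /= (entire_app_eigen (@sigma_approx R) Ax) sigma_lattice scale0r.
Qed.

(** A multiplies the component of index k by the lattice point of index k;
    distinct components have distinct eigenvalues, so they are the full
    eigenspaces. *)
Lemma grading_operator I pr D : grading I pr D ->
  exists A, eigen_pq A = I /\ grading (eigen_pq A) pr D.
Proof.
move=> G; pose A : 'End(E) := \sum_(k <- D) lam k *: pr k.
suff AI : eigen_pq A = I by exists A; rewrite AI.
have AE x : A x = \sum_(k <- D) lam k *: pr k x.
  by rewrite sum_lfunE; apply: eq_bigr => k _; rewrite scale_lfunE.
have prA k x : pr k (A x) = lam k *: pr k x.
  rewrite AE linear_sum /=.
  have [kD|kD] := boolP (k \in D).
    rewrite (big_rem k kD) /= linearZ /= (gr_pr G) eqxx big_seq big1 ?addr0 // => j.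
    rewrite mem_rem_uniq ?(gr_uniq G) // inE => /andP[jk _].
    by rewrite linearZ /= (gr_pr G) eq_sym (negPf jk) scaler0.
  have pr0 y : pr k y = 0 by apply: contraNeq kD => /(gr_supp G).
  by rewrite pr0 scaler0 big1 // => j _; rewrite pr0.
apply/funext => k; apply/vspaceP => x; apply/eigen_pqP/(gr_memP G) => [Ax j jk|x0].
  have := prA j x; rewrite Ax linearZ /= => /eqP; rewrite -subr_eq0 -scalerBl.
  rewrite scaler_eq0 subr_eq0 => /predU1P[/lattice_pt_pair_inj kj|/eqP//].
  by rewrite kj eqxx in jk.
apply: (gr_eq G) => j; rewrite prA linearZ /=.
by have [->//|/x0->] := eqVneq j k; rewrite !scaler0.
Qed.

Lemma grading_op_pr A pr D k x : grading (eigen_pq A) pr D ->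
  pr k (A x) = lam k *: pr k x.
Proof.
move=> G; rewrite {1}(gr_sum G x) !linear_sum /=.
rewrite (eq_bigr (fun j => lam k *: pr k (pr j x))) => [|j _].
  by rewrite -scaler_sumr -linear_sum -(gr_sum G).
have /eigen_pqP -> := gr_mem G j x; rewrite linearZ /= (gr_pr G).
by case: eqP => [->|_]; rewrite ?scaler0.
Qed.

(** The cofactor of sigma at the point of index k vanishes at all the other
    lattice points and nowhere else on the lattice. *)
Lemma sigma_quot_op A pr D k : grading (eigen_pq A) pr D ->
  exists2 c, c != 0 & entire_app (@sigma_quot R k.1 k.2) A = c *: pr k.
Proof.
move=> G; have [h [hH hE h0]] := sigma_quotE R k.
have -> : @sigma_quot R k.1 k.2 = h by apply/funext.
exists (h (lam k)); first by rewrite h0 negbK.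
apply/lfunP => x; rewrite scale_lfunE {1}(gr_sum G x) linear_sum /=.
rewrite (eq_bigr (fun j => h (lam k) *: pr k (pr j x))) => [|j _].
  by rewrite -scaler_sumr -linear_sum -(gr_sum G).
have /eigen_pqP Ax := gr_mem G j x.
rewrite (entire_app_eigen hH Ax) (gr_pr G) eq_sym; have [->//|jk] := eqVneq j k.
have /eqP -> : h (lam j) == 0 by rewrite h0.
by rewrite scaler0 scale0r.
Qed.

Lemma operator_eq_of_eigen_le A B (prA prB : int * int -> 'End(E)) D D' :
  grading (eigen_pq A) prA D -> grading (eigen_pq B) prB D' ->
  (forall k, (eigen_pq A k <= eigen_pq B k)%VS) -> A = B.
Proof.
move=> GA GB AB; apply/lfunP => x; rewrite (gr_sum GA x) !linear_sum.
apply: eq_bigr => k _; have xk := gr_mem GA k x.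
by rewrite /= (eigen_pqP _ _ _ xk) (eigen_pqP _ _ _ (subvP (AB k) _ xk)).
Qed.

End SigmaOperators.

(** * Strong pseudo-reality and the conjugate of the grading *)

Section StronglyPseudoReal.
Variables (R : realType) (V : vectType R).
Local Notation C := R[i].
Local Notation lam k := (lattice_pt R k.1 k.2).
Local Notation E := (cplx V).
Implicit Types (A : 'End(E)) (x y : E) (j k : int * int).
Implicit Types (I : int * int -> {vspace E}) (pr : int * int -> 'End(E)).

(** Deligne's congruence: the conjugate of I^{p,q} lies in I^{q,p} up to
    components that are strictly smaller in both indices. *)
Definition deligne_split I pr : Prop := forall k x, x \in I k ->
  supported pr [set j | j = swap k \/ below (swap k) j] (cconj x).

(** The effect of conjugation on supports. *)
Lemma deligne_conj I pr D (P Q : set (int * int)) x : grading I pr D ->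
  deligne_split I pr ->
  (forall k j, P k -> j = swap k \/ below (swap k) j -> Q j) ->
  supported pr P x -> supported pr Q (cconj x).
Proof.
move=> G dI PQ Px; rewrite (gr_sum G x) cconj_sum; apply: supported_sum => k _.
have [->|/Px Pk] := eqVneq (pr k x) 0.
  by rewrite cconj0 => j; rewrite linear0 eqxx.
apply: supported_sub (dI k _ (gr_mem G _ _)) => j; exact: PQ Pk.
Qed.

Lemma conj_end_eigen A k y : A (cconj y) = lam (swap k) *: cconj y ->
  conj_end A y = lam k *: y.
Proof. by rewrite conj_endE => ->; rewrite cconjZ conjc_lattice_pt cconjK. Qed.

(** The endomorphisms sigma_{m,n}(A) are nonzero multiples of the
    projections. *)
Lemma strongly_pseudo_realP A pr D : grading (eigen_pq A) pr D ->
  strongly_pseudo_real A <-> (forall j k x, k.1 <= j.1 \/ k.2 <= j.2 ->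
    pr j ((conj_end A - A) (pr k x)) = 0).
Proof.
move=> G; split=> [spr [r s] [p q] x kj|H p q r s kj].
  have [c c0 cE] := sigma_quot_op (r, s) G.
  have [d d0 dE] := sigma_quot_op (p, q) G.
  have := spr p q r s kj; rewrite [entire_app _ _]cE [entire_app _ _]dE.
  move=> /lfunP/(_ x); rewrite comp_lfunE zero_lfunE scale_lfunE => /eqP.
  rewrite scaler_eq0 (negPf c0) /= comp_lfunE scale_lfunE !linearZ /=.
  by rewrite scaler_eq0 (negPf d0) => /eqP.
have [c c0 cE] := sigma_quot_op (r, s) G.
have [d d0 dE] := sigma_quot_op (p, q) G.
rewrite [entire_app _ _]cE [X in (_ \o (_ \o X))%VF]dE; apply/lfunP => x.
rewrite comp_lfunE zero_lfunE scale_lfunE comp_lfunE scale_lfunE !linearZ /=.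
by rewrite (H (r, s) (p, q)) // !scaler0.
Qed.

(** The conjugate y of an element of I_k is an eigenvector of conj(A) for the
    index swap k.  Comparing components in conj(A)y, each nonzero component of y
    at an index other than swap k comes from one at an index strictly larger in
    both entries.  The indices being bounded, the chain ends at swap k. *)
Lemma pseudo_real_deligne A pr D : grading (eigen_pq A) pr D ->
  (forall j k x, k.1 <= j.1 \/ k.2 <= j.2 ->
    pr j ((conj_end A - A) (pr k x)) = 0) ->
  deligne_split (eigen_pq A) pr.
Proof.
move=> G H k x /eigen_pqP xk; set y := cconj x; set k' := swap k.
have By : conj_end A y = lam k' *: y.
  by apply: conj_end_eigen; rewrite /y cconjK.
have step j : pr j y != 0 -> j <> k' -> exists2 i, below i j & pr i y != 0.
  move=> yj jk; apply: contrapT => noi; move/eqP: yj; apply.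
  have N0 : pr j ((conj_end A - A) y) = 0.
    rewrite (gr_sum G y) !linear_sum /= big1 // => i _.
    have [->|yi] := eqVneq (pr i y) 0; first by rewrite !linear0.
    apply: H; rewrite !leNgt; apply/orP; rewrite -negb_and; apply/negP => /andP[a b].
    by apply: noi; exists i.
  have := N0; rewrite add_lfunE opp_lfunE By linearB /= linearZ /= (grading_op_pr _ _ G).
  move=> /eqP; rewrite -scalerBl scaler_eq0 subr_eq0.
  move=> /predU1P[e|/eqP//]; case: jk.
  exact/esym/(@lattice_pt_pair_inj R k' j e).
have [M MP] := int_pair_bounded D.
suff chain (n : nat) j : M <= j.1 + n%:Z -> pr j y != 0 -> j = k' \/ below k' j.
  move=> j; apply: (chain (`|M - j.1|)%N).
  by rewrite -lerBlDl abszE ler_norm.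
elim: n j => [|n IH] j jn yj.
  by have [_ j1 _ _] := MP j (gr_supp G yj); move: jn; rewrite addr0 leNgt j1.
have [->|/eqP jk] := eqVneq j k'; first by left.
right; have [i [ji1 ji2] yi] := step j yj jk.
have [|<-|ik] := IH i _ yi; last exact: below_trans ik _.
  by rewrite (le_trans jn) // -addn1 PoszD addrCA addrC lerD2r -ltzD1 ltrD2r.
by split.
Qed.

(** Conjugating the congruence writes x in I_k as an eigenvector of conj(A) for
    the same eigenvalue plus an element strictly below k.  Both A and conj(A)
    preserve the space of elements strictly below k. *)
Lemma deligne_pseudo_real A pr D : grading (eigen_pq A) pr D ->
  deligne_split (eigen_pq A) pr ->
  (forall j k x, k.1 <= j.1 \/ k.2 <= j.2 ->
    pr j ((conj_end A - A) (pr k x)) = 0).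
Proof.
move=> G dA j k x kj; have xk := gr_mem G k x; move: (pr k x) xk => {}x xk.
pose x' := pr (swap k) (cconj x); pose l' := cconj x - x'.
have l'S : supported pr (below (swap k)) l'.
  apply: supported_sub (supported_split G (dA k x xk)) => i /= [[]//->].
  by rewrite eqxx.
have lowC (i : int * int) y : supported pr (below (swap i)) y ->
    supported pr (below i) (cconj y).
  apply: (deligne_conj G dA) => a b ai [->|bi].
    by have := below_swap ai; rewrite swapK.
  by apply: (below_trans _ bi); have := below_swap ai; rewrite swapK.
have lS : supported pr (below k) (cconj l') by apply: lowC.
have BlS : supported pr (below k) (conj_end A (cconj l')).
  rewrite conj_endE cconjK; apply: lowC => i.
  by rewrite (grading_op_pr _ _ G) scaler_eq0 negb_or => /andP[_ /l'S].
have xE : x = cconj x' + cconj l' by rewrite -cconjD addrC subrK cconjK.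
have Bx' : conj_end A (cconj x') = lam k *: cconj x'.
  by apply: conj_end_eigen; rewrite cconjK; apply/eigen_pqP; apply: (gr_mem G).
have BE : (conj_end A - A) x = conj_end A (cconj l') - lam k *: cconj l'.
  rewrite add_lfunE opp_lfunE; have /eigen_pqP -> := xk.
  by rewrite {1 2}xE linearD /= Bx' scalerDr opprD addrACA subrr add0r.
have S : supported pr (below k) (conj_end A (cconj l') - lam k *: cconj l').
  by apply: supportedB => //; apply: supportedZ.
rewrite BE; apply/eqP; apply: contraPT kj => /S[a b].
by rewrite !leNgt a b => -[].
Qed.

Lemma spr_sigma_deligne A pr D : grading (eigen_pq A) pr D ->
  strongly_pseudo_real A <-> deligne_split (eigen_pq A) pr.
Proof.
move=> G; split=> [/(strongly_pseudo_realP G)|]; first exact: pseudo_real_deligne G.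
by move=> dA; apply/(strongly_pseudo_realP G); exact: deligne_pseudo_real G dA.
Qed.

End StronglyPseudoReal.

(** * Real subspaces and purity of the graded pieces *)

Section RealStructures.
Variables (R : realType) (V : vectType R).
Local Notation C := R[i].
Implicit Types (x y f g : cplx V) (U : {vspace cplx V}) (W : int -> {vspace V}).
Implicit Types (F : int -> {vspace cplx V}).

Lemma cplxv_conj (U : {vspace V}) x : (cconj x \in cplxv U) = (x \in cplxv U).
Proof. by rewrite !mem_cplxv /= rpredN. Qed.

Lemma cplxvS (U U' : {vspace V}) : (U <= U')%VS -> (cplxv U <= cplxv U')%VS.
Proof.
move=> UU; apply/subvP => x; rewrite !mem_cplxv => /andP[a b].
by rewrite !(subvP UU).
Qed.

Lemma cplxv_leP (U U' : {vspace V}) : (cplxv U <= cplxv U')%VS -> (U <= U')%VS.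
Proof.
move=> UU; apply/subvP => v vU; have := subvP UU (of_real v).
by rewrite !mem_cplxv /= vU !mem0v => /(_ isT)/andP[].
Qed.

Lemma cplxv_inj : injective (@cplxv R V).
Proof. by move=> U U' e; apply: subv_anti; rewrite !cplxv_leP // e. Qed.

Lemma cplxv0 : cplxv (0%VS : {vspace V}) = 0%VS.
Proof. by apply/vspaceP => -[a b]; rewrite mem_cplxv !memv0. Qed.

Lemma cplxvf : cplxv (fullv : {vspace V}) = fullv.
Proof. by apply/vspaceP => x; rewrite mem_cplxv !memvf. Qed.

(** Galois descent from C to R. *)
Lemma real_descent U : (forall x, x \in U -> cconj x \in U) ->
  exists W : {vspace V}, cplxv W = U.
Proof.
move=> Uconj; pose b := vbasis U.
pose W := <<[seq x.1 | x <- b] ++ [seq x.2 | x <- b]>>%VS; exists W.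
have re x : x \in U -> of_real x.1 \in U.
  move=> xU; have -> : of_real x.1 = 2^-1 *: (x + cconj x); last first.
    by rewrite memvZ // memvD // Uconj.
  apply: (@scalerI _ _ (2 : C)); first by rewrite pnatr_eq0.
  rewrite scalerA mulfV ?pnatr_eq0 // scale1r scaler_nat mulr2n.
  by rewrite [LHS]surjective_pairing [RHS]surjective_pairing /= subrr addr0.
have im x : x \in U -> of_real x.2 \in U.
  move=> xU; have := re (- 'i *: x) (memvZ _ xU).
  by rewrite /GRing.scale /= /cplx_scale /= oppr0 scale0r sub0r scaleN1r opprK.
have WU v : v \in W -> of_real v \in U.
  move=> vW; pose X := in_tuple ([seq x.1 | x <- b] ++ [seq x.2 | x <- b]).
  have -> : v = \sum_i coord X i v *: X`_i by exact: coord_span.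
  pose P (v : V) := of_real v \in U.
  apply: (big_ind P) => [|u w uU wU|i _].
  - exact: mem0v.
  - rewrite /P; have -> : of_real (u + w) = of_real u + of_real w by rewrite [RHS]surjective_pairing /= addr0.
    exact: memvD.
  rewrite /P; have -> : of_real (coord X i v *: X`_i) = (coord X i v)%:C *: of_real X`_i.
    by rewrite /of_real /GRing.scale /= /cplx_scale /= !scaler0 scale0r subr0 addr0.
  apply: memvZ; have : X`_i \in (X : seq V) by rewrite mem_nth.
  by rewrite mem_cat => /orP[] /mapP[x /vbasis_mem xU ->]; [apply: re|apply: im].
apply/vspaceP => x; rewrite mem_cplxv; apply/andP/idP => [[x1 x2]|xU].
  have -> : x = of_real x.1 + 'i *: of_real x.2.
    case: x {x1 x2} => x1 x2; rewrite /of_real /GRing.scale /= /cplx_scale /=.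
    by congr (_, _) => /=; rewrite !(scaler0, scale0r, scale1r, subr0, addr0, add0r).
  by rewrite memvD ?memvZ ?WU.
pose P (y : cplx V) := y.1 \in W /\ y.2 \in W.
rewrite (coord_vbasis xU); apply: (big_ind P) => [|y z [? ?] [? ?]|i _].
- by split; apply: mem0v.
- by split; apply: memvD.
have bi : b`_i \in (b : seq _) by rewrite mem_nth // size_tuple.
have b1 : (b`_i).1 \in W by rewrite memv_span // mem_cat map_f.
have b2 : (b`_i).2 \in W by rewrite memv_span // mem_cat (map_f snd) ?orbT.
by split; rewrite /= ?memvB ?memvD ?memvZ.
Qed.

Section GradedPieces.
Variables (W : int -> {vspace V}) (n : int).
Let pi := cplx_hom (gr_proj W n).

Lemma gr_cplx_eq0 x : x \in cplxv (W n) -> (pi x == 0) = (x \in cplxv (W (n - 1))).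
Proof.
rewrite !mem_cplxv => /andP[x1 x2]; rewrite /pi cplx_homE.
by rewrite -(gr_proj_eq0 x1) -(gr_proj_eq0 x2).
Qed.

Lemma gr_cplx_onto (y : cplx (Gr W n)) : exists2 x, x \in cplxv (W n) & pi x = y.
Proof.
case: y => y1 y2; have [v1 v1W v1E] := gr_proj_onto y1.
have [v2 v2W v2E] := gr_proj_onto y2.
exists ((v1, v2) : cplx V); first by rewrite mem_cplxv v1W v2W.
by rewrite /pi cplx_homE v1E v2E.
Qed.

Lemma gr_cplx_conj x : pi (cconj x) = cconj (pi x).
Proof. by rewrite /pi !cplx_homE /cconj /= linearN. Qed.

End GradedPieces.

(** hodge_sum and hodge_cap state purity of the graded pieces in V_C itself,
    modulo W_{n-1}, without quotient spaces. *)
Definition hodge_sum W F : Prop := forall n p q : int, p + q = n + 1 ->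
  forall x, x \in cplxv (W n) -> exists f g,
    [/\ f \in (F p :&: cplxv (W n))%VS, cconj g \in (F q :&: cplxv (W n))%VS &
        x - f - g \in cplxv (W (n - 1))].

Definition hodge_cap W F : Prop := forall n p q : int, p + q = n + 1 ->
  forall f g, f \in (F p :&: cplxv (W n))%VS -> cconj g \in (F q :&: cplxv (W n))%VS ->
    f - g \in cplxv (W (n - 1)) -> f \in cplxv (W (n - 1)).

Lemma gr_hodgeP W F : increasing_filtration W -> finite_decreasing_filtration F ->
  (forall n, pure_real_hodge n (gr_hodge W F n)) <-> hodge_sum W F /\ hodge_cap W F.
Proof.
move=> Winc [Fdec [a Fa] [b Fb]]; split=> [pure|[Hsum Hcap] n].
  split=> n p q pq.
    move=> x xW; pose pi := cplx_hom (gr_proj W n).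
    have [_ /(_ p q pq)[full _]] := pure n.
    have : pi x \in (gr_hodge W F n p + conjv (gr_hodge W F n q))%VS.
      by rewrite full memvf.
    case/memv_addP => u /memv_imgP[f fF uE] [v]; rewrite mem_conjv.
    case/memv_imgP => g gF vE xE; exists f, (cconj g); rewrite cconjK; split=> //.
    rewrite -gr_cplx_eq0; last first.
      by move: fF gF; rewrite !memv_cap => /andP[_ fW] /andP[_ gW]; rewrite !memvB ?cplxv_conj.
    rewrite !linearB /= -/pi xE uE gr_cplx_conj -/pi -vE cconjK.
    by rewrite -addrA -opprD subrr.
  move=> f g fF gF fg; have [_ /(_ p q pq)[_ cap]] := pure n.
  pose pi := cplx_hom (gr_proj W n).
  have fW : f \in cplxv (W n) by move: fF; rewrite memv_cap => /andP[].
  have gW : g \in cplxv (W n) by move: gF; rewrite memv_cap cplxv_conj => /andP[].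
  rewrite -gr_cplx_eq0 // -memv0 -cap memv_cap memv_img // mem_conjv -/pi.
  have -> : pi f = pi g.
    by apply/eqP; rewrite -subr_eq0 -linearB /= gr_cplx_eq0 // memvB.
  by rewrite -gr_cplx_conj memv_img.
pose pi := cplx_hom (gr_proj W n).
split; [split|].
- by move=> p q pq; apply/limgS/capvS => //; apply: Fdec.
- exists a => p /Fa Fp; apply/vspaceP => y; rewrite memvf.
  have [x xW <-] := gr_cplx_onto y.
  by apply: memv_img; rewrite Fp memv_cap memvf.
- by exists b => p /Fb Fp; rewrite /gr_hodge Fp cap0v limg0.
move=> p q pq; split.
  apply/vspaceP => y; rewrite memvf; have [x xW <-] := gr_cplx_onto y.
  have [f [g [fF gF xfg]]] := Hsum n p q pq x xW.
  have fW : f \in cplxv (W n) by move: fF; rewrite memv_cap => /andP[].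
  have gW : g \in cplxv (W n) by move: gF; rewrite memv_cap cplxv_conj => /andP[].
  have -> : pi x = pi f + pi g.
    apply/eqP; rewrite -subr_eq0 opprD addrA -!linearB /= gr_cplx_eq0 //.
    by rewrite !memvB.
  by apply: memv_add; rewrite ?mem_conjv -?gr_cplx_conj memv_img.
apply/eqP; rewrite -subv0; apply/subvP => y; rewrite memv_cap mem_conjv memv0.
case/andP => /memv_imgP[f fF ->] /memv_imgP[g gF gE].
have fW : f \in cplxv (W n) by move: fF; rewrite memv_cap => /andP[].
have gW : g \in cplxv (W n) by move: gF; rewrite memv_cap => /andP[].
rewrite gr_cplx_eq0 //; apply: (Hcap n p q pq f (cconj g)); rewrite ?cconjK //.
rewrite -gr_cplx_eq0 ?memvB ?cplxv_conj //.
by rewrite linearB /= gr_cplx_conj -gE cconjK subrr.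
Qed.

End RealStructures.

(** * The Deligne splitting of a mixed Hodge structure *)

Definition int_range (M : nat) : seq int := [seq i%:Z - M%:Z | i <- iota 0 (M + M).+1].

Lemma mem_int_range M (i : int) : `|i| <= M%:Z -> i \in int_range M.
Proof.
move=> iM; apply/mapP; exists (absz (i + M%:Z)); last first.
  rewrite gez0_abs ?addrK // -lerBlDr sub0r.
  by move: iM; rewrite ler_norml => /andP[].
by rewrite mem_iota add0n; move: iM; lia.
Qed.

Section DeligneSplitting.
Variables (R : realType) (V : vectType R).
Variables (W : int -> {vspace V}) (F : int -> {vspace cplx V}).
Local Notation E := (cplx V).
Implicit Types (x y z f g t w : E) (p q m n s : int) (k j : int * int).

Hypothesis Wfin : finite_increasing_filtration W.
Hypothesis Ffin : finite_decreasing_filtration F.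
Hypothesis Hsum : hodge_sum W F.
Hypothesis Hcap : hodge_cap W F.

Local Notation WC n := (cplxv (W n)).
Local Notation Fn p n := (F p :&: cplxv (W n))%VS.
Local Notation Gn q n := (conjv (F q) :&: cplxv (W n))%VS.

Lemma weight_le m n : m <= n -> (WC m <= WC n)%VS.
Proof. by have [Winc _ _] := Wfin => mn; apply/cplxvS/Winc. Qed.

Lemma hodge_le p q n : p <= q -> (Fn q n <= Fn p n)%VS.
Proof. by have [Fdec _ _] := Ffin => pq; apply/capvS => //; apply: Fdec. Qed.

Lemma hodgeW_le p m n : m <= n -> (Fn p m <= Fn p n)%VS.
Proof. by move=> mn; apply/capvS/weight_le. Qed.

Lemma memGn q n x : (x \in Gn q n) = (cconj x \in Fn q n).
Proof. by rewrite !memv_cap mem_conjv cplxv_conj. Qed.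

Lemma conj_le p q m n : p <= q -> m <= n -> (Gn q m <= Gn p n)%VS.
Proof.
move=> pq mn; apply/subvP => x; rewrite !memGn => xq.
exact: (subvP (hodgeW_le p mn)) (subvP (hodge_le m pq) _ xq).
Qed.

Lemma filtration_bounds : exists M : nat,
  [/\ forall n, n <= - M%:Z -> WC n = 0%VS, forall n, M%:Z <= n -> WC n = fullv,
      forall p, p <= - M%:Z -> F p = fullv & forall p, M%:Z <= p -> F p = 0%VS].
Proof.
have [_ [a Wa] [b Wb]] := Wfin; have [_ [c Fc] [d Fd]] := Ffin.
exists (`|a| + `|b| + (`|c| + `|d|))%N; split=> n nM.
- by rewrite Wa ?cplxv0 //; lia.
- by rewrite Wb ?cplxvf //; lia.
- by apply: Fc; lia.
- by apply: Fd; lia.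
Qed.

(** The part of W_m opposite to F^p.  For a Deligne bigrading it is the sum of
    the I^{r,s} with r < p and r + s <= m. *)
Definition opp_hodge p m : {vspace E} :=
  (\big[addv/0%VS]_(s \in [set s : int | (s <= m + 1 - p)%R]) Gn s (s + p - 1)%R)%VS.

Definition opp_hodge_full p : {vspace E} :=
  (\big[addv/0%VS]_(s \in [set: int]) Gn s (s + p - 1)%R)%VS.

Lemma opp_hodge_finite (P : set int) p :
  finite_set [set s | P s /\ (Gn s (s + p - 1)%R)%VS <> 0%VS].
Proof.
have [M [W0 _ _ F0]] := filtration_bounds.
apply: (@sub_finite_set _ _ [set` int_range (M + `|p|).+1]); last exact: finite_seq.
move=> s [_ Gs] /=; apply: mem_int_range.
have [sM|sM] := leP M%:Z s.
  case: Gs; apply/eqP; rewrite -subv0; apply/subvP => x.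
  rewrite memGn F0 // cap0v !memv0 => /eqP cx.
  by rewrite -(cconjK x) cx cconj0.
have [sp|sp] := leP (s + p - 1) (- M%:Z); last by lia.
by case: Gs; rewrite W0 // capv0.
Qed.

Lemma opp_hodge_sup p m s : s <= m + 1 - p -> (Gn s (s + p - 1)%R <= opp_hodge p m)%VS.
Proof.
exact: (@fsum_addv_sup _ _ _ [set s : int | (s <= m + 1 - p)%R]
  (fun s => Gn s (s + p - 1)%R)%VS s (opp_hodge_finite _ p)).
Qed.

Lemma opp_hodge_full_sup p s : (Gn s (s + p - 1)%R <= opp_hodge_full p)%VS.
Proof.
exact: (@fsum_addv_sup _ _ _ [set: int]
  (fun s => Gn s (s + p - 1)%R)%VS s (opp_hodge_finite _ p)).
Qed.

Lemma opp_hodge_le p m n : m <= n -> (opp_hodge p m <= opp_hodge p n)%VS.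
Proof.
by move=> mn; apply: fsum_addv_sub => s /= sm; apply: opp_hodge_sup; lia.
Qed.

Lemma opp_hodge_weight p m : (opp_hodge p m <= WC m)%VS.
Proof.
apply: fsum_addv_sub => s /= sm; apply: (subv_trans (capvSr _ _)).
by apply: weight_le; lia.
Qed.

Lemma opp_hodge_rec p m :
  opp_hodge p m = (Gn (m + 1 - p)%R m + opp_hodge p (m - 1)%R)%VS.
Proof.
apply: subv_anti; apply/andP; split.
  apply: fsum_addv_sub => s /= sm; have [->|sne] := eqVneq s (m + 1 - p).
    have -> : m + 1 - p + p - 1 = m by lia.
    exact: addvSl.
  apply: subv_trans (addvSr _ _); apply: opp_hodge_sup.
  by rewrite subrK; move: sm sne; lia.
rewrite subv_add opp_hodge_le ?gerBl // andbT.
have -> : Gn (m + 1 - p)%R m = Gn (m + 1 - p)%R (m + 1 - p + p - 1)%R.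
  by congr (_ :&: cplxv (W _))%VS; lia.
exact: opp_hodge_sup.
Qed.

Lemma opp_hodge_fullS p m : (opp_hodge p m <= opp_hodge_full p)%VS.
Proof. by apply: fsum_addv_sub => s _; apply: opp_hodge_full_sup. Qed.

Lemma opp_hodge_full_le p q : p <= q -> (opp_hodge_full p <= opp_hodge_full q)%VS.
Proof.
move=> pq; apply: fsum_addv_sub => s _; apply: subv_trans (opp_hodge_full_sup q s).
by apply: conj_le => //; lia.
Qed.

(** Induction on the weight, started where the weight filtration vanishes. *)
Lemma weight_index_ind (Q : int -> Prop) :
  (forall m, WC m = 0%VS -> Q m) -> (forall m, Q (m - 1) -> Q m) -> forall m, Q m.
Proof.
move=> Q0 QS m; have [M [W0 _ _ _]] := filtration_bounds.
suff H (i : nat) m' : m' <= i%:Z - M%:Z -> Q m'.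
  by apply: (H (absz (m + M%:Z))); lia.
elim: i m' => [|i IH] m' mi; first by apply/Q0/W0; lia.
by apply/QS/IH; lia.
Qed.

(** Purity at weight m and Hodge index p splits W_m up to W_{m-1}, to which the
    induction applies. *)
Lemma weight_decomp p m : (WC m <= Fn p m + opp_hodge p m)%VS.
Proof.
elim/weight_index_ind: m => [m ->|m IH]; first exact: sub0v.
apply/subvP => x xm; have pq : p + (m + 1 - p) = m + 1 by lia.
have [f [g [fF gF]]] := Hsum pq xm.
move=> /(subvP IH)/memv_addP[f' f'F [t tT xE]].
have -> : x = (f + f') + (g + t).
  by rewrite addrACA -[f' + t]xE -[x - f - g]addrA -opprD addrC subrK.
apply: memv_add; first by rewrite memvD // (subvP (hodgeW_le p (gerBl m 1 : m - 1 <= m))).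
by rewrite opp_hodge_rec memv_add // memGn.
Qed.

(** By purity an element of the intersection has smaller weight, and then so has
    its component in conj(F^{m+1-p}), which is therefore among the summands
    of opp_hodge p (m - 1). *)
Lemma hodge_opp_cap p m x : x \in Fn p m -> x \in opp_hodge p m -> x = 0.
Proof.
elim/weight_index_ind: m x => [m W0|m IH] x xF.
  by move: xF; rewrite W0 capv0 memv0 => /eqP.
rewrite opp_hodge_rec => /memv_addP[g gG [t tT xE]].
have pq : p + (m + 1 - p) = m + 1 by lia.
have tW := subvP (opp_hodge_weight p (m - 1)) _ tT.
have xW : x \in WC (m - 1).
  by apply: (Hcap pq xF (g := g)); rewrite -?memGn // xE addrAC subrr add0r.
have gW : g \in WC (m - 1) by rewrite -(addrK t g) -xE memvB.
have xF' : x \in Fn p (m - 1) by move: xF; rewrite !memv_cap => /andP[-> _].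
apply: (IH x xF'); rewrite xE memvD //.
have sm : m - p <= m - 1 + 1 - p by lia.
apply: (subvP (opp_hodge_sup sm)).
have -> : m - p + p - 1 = m - 1 by lia.
have le1 : m - p <= m + 1 - p by lia.
apply: (subvP (conj_le le1 (lexx (m - 1)))).
by move: gG; rewrite !memv_cap gW => /andP[-> _].
Qed.

Lemma hodge_opp_full_cap p x : x \in F p -> x \in opp_hodge_full p -> x = 0.
Proof.
move=> xF xT; have [M [_ W1 _ F0]] := filtration_bounds.
pose m : int := M%:Z + `|p|.
have Wm : WC m = fullv by apply: W1; lia.
apply: (@hodge_opp_cap p m); first by rewrite Wm capvf.
apply: subvP xT; apply: fsum_addv_sub => s _.
have [sM|sM] := leP M%:Z s; last by apply: opp_hodge_sup; lia.
apply/subvP => y; rewrite memGn F0 // cap0v !memv0 => /eqP cy.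
by rewrite -(cconjK y) cy cconj0 mem0v.
Qed.

(** Deligne's formula for I^{p,q}. *)
Definition deligne_piece k : {vspace E} :=
  (Fn k.1 (k.1 + k.2)%R :&:
    (Gn k.2 (k.1 + k.2)%R + opp_hodge k.1 (k.1 + k.2 - 1)%R))%VS.

(** The purity decomposition of x for the index p + 1, corrected in weight n - 1
    by weight_decomp, leaves a remainder that lies both in F^p and in the opposite
    part: an element of I^{p,n-p}. *)
Lemma hodge_step p n :
  (Fn p n <= deligne_piece (p, n - p)%R + (Fn (p + 1)%R n + Fn p (n - 1)%R))%VS.
Proof.
apply/subvP => x xF; have pq : (p + 1) + (n - p) = n + 1 by lia.
have xW : x \in WC n by move: xF; rewrite memv_cap => /andP[].
have [f [g [fF gF]]] := Hsum pq xW.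
move=> /(subvP (weight_decomp p (n - 1)))/memv_addP[f' f'F [t tT xE]].
have -> : x = (x - f - f') + (f + f') by rewrite -[x - f - f']addrA -opprD subrK.
apply: memv_add; last exact: memv_add.
have pn : p + (n - p) = n by lia.
rewrite memv_cap /= pn; apply/andP; split.
  rewrite !memvB //; first exact: (subvP (hodge_le n (lerDl p 1 : p <= p + 1))) fF.
  exact: (subvP (hodgeW_le p (gerBl n 1 : n - 1 <= n))) f'F.
have -> : x - f - f' = g + t.
  by rewrite -(subrK g (x - f)) xE -[f' + t + g]addrA [f' + _]addrC addrK addrC.
by rewrite memv_add // memGn.
Qed.

(** By purity x has weight less than n, hence lies in the intersection of F^p and
    its opposite. *)
Lemma deligne_piece_sep k x : x \in deligne_piece k ->
  x \in (Fn (k.1 + 1)%R (k.1 + k.2)%R + WC (k.1 + k.2 - 1)%R)%VS -> x = 0.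
Proof.
case: k => p q /=; set n := p + q => /memv_capP[/= xF /memv_addP[g gG [t tT xE]]].
move=> /memv_addP[f fF [w wW xE']].
have pq : (p + 1) + q = n + 1 by rewrite /n; lia.
have tW := subvP (opp_hodge_weight p (n - 1)) _ tT.
have fW : f \in WC (n - 1).
  apply: (Hcap pq fF (g := g)); first by rewrite -memGn.
  have -> : f - g = t - w.
    by apply/eqP; rewrite subr_eq addrAC eq_sym subr_eq addrC -xE xE'.
  exact: memvB.
have xW : x \in WC (n - 1) by rewrite xE' memvD.
have gW : g \in WC (n - 1) by rewrite -(addrK t g) -xE memvB.
apply: (@hodge_opp_cap p (n - 1)).
  by move: xF; rewrite !memv_cap xW => /andP[->].
rewrite xE memvD //; have sm : q <= n - 1 + 1 - p by rewrite /n; lia.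
apply: (subvP (opp_hodge_sup sm)).
have -> : q + p - 1 = n - 1 by rewrite /n; lia.
by move: gG; rewrite !memv_cap gW => /andP[->].
Qed.

Lemma deligne_piece_hodge k : (deligne_piece k <= Fn k.1 (k.1 + k.2)%R)%VS.
Proof. exact: capvSl. Qed.

Lemma deligne_piece_support : exists M : nat,
  forall k, deligne_piece k <> 0%VS -> k \in allpairs pair (int_range M) (int_range M).
Proof.
have [M [W0 W1 F1 F0]] := filtration_bounds; exists (M + M).+2 => -[p q] /eqP.
rewrite -vpick0; set x := vpick _ => x0.
have xI : x \in deligne_piece (p, q) by exact: memv_pick.
have [xF xW] : x \in F p /\ x \in WC (p + q).
  by apply/memv_capP; exact: subvP (deligne_piece_hodge _) _ xI.
have pM : p < M%:Z.
  by rewrite ltNge; apply: contra x0 => /F0 Fp; move: xF; rewrite Fp memv0.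
have nM : - M%:Z < p + q.
  by rewrite ltNge; apply: contra x0 => /W0 Wp; move: xW; rewrite Wp memv0.
have pM' : - M%:Z < p + 1.
  rewrite ltNge; apply: contra x0 => /F1 Fp; apply/eqP/(deligne_piece_sep xI) => /=.
  by apply: (subvP (addvSl _ _)); rewrite Fp memv_cap memvf.
have nM' : p + q - 1 < M%:Z.
  rewrite ltNge; apply: contra x0 => /W1 Wp; apply/eqP/(deligne_piece_sep xI) => /=.
  by apply: (subvP (addvSr _ _)); rewrite Wp memvf.
by apply/allpairsP; exists (p, q); split=> //=; apply: mem_int_range; lia.
Qed.

Lemma deligne_piece_finite (P : set (int * int)) :
  finite_set [set k | P k /\ deligne_piece k <> 0%VS].
Proof.
have [M MP] := deligne_piece_support.
apply: (@sub_finite_set _ _ [set` allpairs pair (int_range M) (int_range M)]).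
  by move=> k [_ /MP].
exact: finite_seq.
Qed.

(** Iterating hodge_step, which either raises the Hodge index or lowers the
    weight. *)
Lemma hodge_span p n : (Fn p n <= \big[addv/0%VS]_(k \in
  [set k : int * int | (p <= k.1 /\ k.1 + k.2 <= n)%R]) deligne_piece k)%VS.
Proof.
have [M [W0 _ _ F0]] := filtration_bounds.
suff H (i : nat) p' n' : (M%:Z - p') + (n' + M%:Z) <= i%:Z ->
    (Fn p' n' <= \big[addv/0%VS]_(k \in
    [set k : int * int | (p' <= k.1 /\ k.1 + k.2 <= n')%R]) deligne_piece k)%VS.
  by apply: (H (absz ((M%:Z - p) + (n + M%:Z)))); lia.
elim: i p' n' => [|i IH] p' n' pn.
  have [Mp|pM] := leP M%:Z p'; first by rewrite F0 // cap0v sub0v.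
  by rewrite W0 ?capv0 ?sub0v //; lia.
have mono (P Q : set (int * int)) : P `<=` Q ->
    (\big[addv/0%VS]_(k \in P) deligne_piece k <=
     \big[addv/0%VS]_(k \in Q) deligne_piece k)%VS.
  move=> PQ; apply: fsum_addv_sub => k /PQ Qk.
  exact: fsum_addv_sup (deligne_piece_finite Q) Qk.
apply: subv_trans (hodge_step p' n') _; rewrite !subv_add; apply/and3P; split.
- by apply: fsum_addv_sup (deligne_piece_finite _) _ => /=; lia.
- by apply: subv_trans (IH _ _ _) (mono _ _ _) => [|k /=]; lia.
- by apply: subv_trans (IH _ _ _) (mono _ _ _) => [|k /=]; lia.
Qed.

Lemma fsum_decomp (I : int * int -> {vspace E}) (P : set (int * int)) D x : uniq D ->
  (forall k, k \notin D -> I k = 0%VS) ->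
  x \in (\big[addv/0%VS]_(k \in P) I k)%VS ->
  exists c : int * int -> E, (forall k, c k \in I k) /\ x = \sum_(k <- D) c k.
Proof.
move=> Du I0; move: x; apply: (big_ind (fun U : {vspace E} => forall x, x \in U ->
  exists c : int * int -> E, (forall k, c k \in I k) /\ x = \sum_(k <- D) c k)).
- move=> x; rewrite memv0 => /eqP->; exists (fun=> 0); split; last by rewrite big1.
  by move=> k; exact: mem0v.
- move=> U1 U2 H1 H2 x /memv_addP[u /H1[c [cI ->]] [v /H2[d [dI ->]] ->]].
  exists (fun k => c k + d k); split; last by rewrite big_split.
  by move=> k; apply: memvD.
move=> k _ x xk; exists (fun j => if j == k then x else 0); split.
  by move=> j; case: eqP => [->|_]; rewrite ?mem0v.
have [kD|/I0 Ik] := boolP (k \in D).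
  rewrite (big_rem k kD) /= eqxx big_seq big1 ?addr0 // => j.
  by rewrite mem_rem_uniq // inE => /andP[/negPf->].
move: xk; rewrite Ik memv0 => /eqP->; rewrite big1 // => j _.
by case: ifP.
Qed.

(** By descending weight, and for a given weight by ascending first index: the
    remaining terms of the relation lie in the space from which
    deligne_piece_sep separates the current one. *)
Lemma deligne_independent D (c : int * int -> E) : uniq D ->
  (forall k, c k \in deligne_piece k) -> \sum_(k <- D) c k = 0 ->
  {in D, forall k, c k = 0}.
Proof.
move=> Du cI cS; have [N NP] := int_pair_bounded D.
pose M : int := N + N.
suff H (i : nat) k : k \in D -> M - i%:Z <= k.1 + k.2 -> c k = 0.
  move=> k kD; have := H (absz (M - (k.1 + k.2))%R) k kD; apply.
  by rewrite lerBlDr -lerBlDl abszE ler_norm.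
elim: i k => [|i IH] k kD.
  by have [] := NP k kD; rewrite /M; lia.
move=> ki; have [kI|kI] := leP (M - i%:Z) (k.1 + k.2); first exact: IH.
have [n kn] : exists n : int, k.1 + k.2 = n by exists (k.1 + k.2).
have ni : n = M - i%:Z - 1 by lia.
suff H' (l : nat) j : j \in D -> j.1 + j.2 = n -> j.1 <= l%:Z - N -> c j = 0.
  by have := H' (absz (k.1 + N)) k kD kn; apply; lia.
elim: l j {k kD ki kI kn} => [|l IHl] j jD jn jl.
  by have [] := NP j jD; lia.
apply: (deligne_piece_sep (cI j)); rewrite jn.
have -> : c j = - \sum_(k <- rem j D) c k.
  by apply/eqP; rewrite -addr_eq0; move: cS; rewrite (big_rem j jD) /= => ->.
suff cJ (k : int * int) : k != j -> k \in D ->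
    c k \in (Fn (j.1 + 1)%R n + WC (n - 1)%R)%VS.
  rewrite memvN big_seq; apply: memv_suml => k.
  by rewrite mem_rem_uniq // inE => /andP[]; apply: cJ.
move=> kj kD.
have ck := subvP (deligne_piece_hodge k) _ (cI k).
have [kn|kn|kn] := ltgtP (k.1 + k.2) n.
- apply: (subvP (addvSr _ _)); move: ck; rewrite memv_cap => /andP[_].
  by apply: subvP; apply: weight_le; lia.
- by rewrite (IH k) ?mem0v //; lia.
have [kj1|kj1|kj1] := ltgtP k.1 j.1.
- by rewrite (IHl k) ?mem0v //; lia.
- apply: (subvP (addvSl _ _)); rewrite -kn; apply: (subvP (hodge_le _ _)) ck; lia.
case/eqP: kj; rewrite [k]surjective_pairing [j]surjective_pairing kj1.
by congr (_, _); move: jn kn; rewrite kj1; lia.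
Qed.

Lemma deligne_grading : exists pr D, grading deligne_piece pr D.
Proof.
have [M MP] := deligne_piece_support; pose D := undup (allpairs pair (int_range M) (int_range M)).
have D0 k : k \notin D -> deligne_piece k = 0%VS.
  by rewrite mem_undup => kD; apply/eqP; apply: contraNT kD => /eqP/MP.
suff [pr prG] : exists pr, grading deligne_piece pr D by exists pr, D.
apply: grading_exists => //; first exact: undup_uniq.
- move=> x; have [N [_ W1 F1 _]] := filtration_bounds.
  apply: (fsum_decomp (undup_uniq _) D0); apply: (subvP (hodge_span (- N%:Z) N%:Z)).
  by rewrite F1 // W1 // memv_cap !memvf.
by move=> c; apply: deligne_independent; exact: undup_uniq.
Qed.

(** The pieces with r < p span opp_hodge_full p and those with r >= p span F^p.
    For x in I^{p,q}, split the conjugate of x along W_n = F^q + opp_hodge q n: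
    the first part falls in I^{q,p} by definition, and the second has first
    indices less than q.  Conjugating the formula that defines I^{p,q} bounds the
    second indices by p in the same way. *)
Lemma deligne_splitting : exists I pr D, [/\ grading I pr D, deligne_split I pr,
  forall n, (\big[addv/0%VS]_(k \in [set k : int * int | (k.1 + k.2 <= n)%R]) I k)%VS = WC n &
  forall p, (\big[addv/0%VS]_(k \in [set k : int * int | (p <= k.1)%R]) I k)%VS = F p].
Proof.
have [pr [D G]] := deligne_grading; exists deligne_piece, pr, D.
have [M [W0 W1 F1 F0]] := filtration_bounds.
have pieceF p n k : p <= k.1 -> k.1 + k.2 <= n -> (deligne_piece k <= Fn p n)%VS.
  move=> pk kn; apply: subv_trans (deligne_piece_hodge k) _.
  exact: subv_trans (hodge_le _ pk) (hodgeW_le _ kn).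
have Fsupp p n x : x \in Fn p n ->
    supported pr [set k | p <= k.1 /\ k.1 + k.2 <= n] x.
  by move=> xF; apply/(gr_fsumP G); exact: subvP (hodge_span p n) _ xF.
have full_supp p x : x \in opp_hodge_full p -> supported pr [set k | k.1 < p] x.
  move=> xT; have piece_opp k : k.1 < p -> (deligne_piece k <= opp_hodge_full p)%VS.
    move=> kp; apply: subv_trans (capvSr _ _) _; rewrite subv_add; apply/andP; split.
      apply: subv_trans (opp_hodge_full_sup p k.2); apply: conj_le => //; lia.
    exact: subv_trans (opp_hodge_fullS _ _) (opp_hodge_full_le (ltW kp)).
  pose f := \sum_(k <- D | p <= k.1) pr k x.
  have fE : f = x - \sum_(k <- D | ~~ (p <= k.1)) pr k x.
    have := gr_sum G x; rewrite (bigID (fun k : int * int => p <= k.1)) /= -/f => xE.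
    by rewrite {1}xE addrK.
  have f0 : f = 0.
    apply: (@hodge_opp_full_cap p).
      apply: memv_suml => k pk.
      have := subvP (pieceF p (k.1 + k.2) k pk (lexx _)) _ (gr_mem G k x).
      by rewrite memv_cap => /andP[].
    rewrite fE memvB // memv_suml // => k; rewrite -ltNge => /piece_opp kp.
    exact: subvP kp _ (gr_mem G k x).
  move: fE; rewrite f0 => /esym/subr0_eq -> k.
  rewrite linear_sum /= => nz; rewrite ltNge; apply: contra nz => pk.
  rewrite big1 // => j; rewrite (gr_pr G); case: eqP => // <-.
  by rewrite pk.
have opp_conj p m t : t \in opp_hodge p m ->
    supported pr [set k | k.2 < p] (cconj t).
  move=> tT; apply/(gr_fsumP G); rewrite -mem_conjv.
  apply: subvP tT; apply: fsum_addv_sub => s _; apply/subvP => y.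
  rewrite memGn mem_conjv => /Fsupp yS; apply/(gr_fsumP G).
  by apply: supported_sub yS => k /=; lia.
split=> // [[p q] x /memv_capP[/= xF /memv_addP[g gG [t tT xE]]]|n|p].
- set n := p + q in xF gG tT.
  have zW : cconj x \in WC n by move: xF; rewrite cplxv_conj memv_cap => /andP[].
  have /memv_addP[f fF [u uT zE]] := subvP (weight_decomp q n) _ zW.
  have fI : f \in deligne_piece (q, p).
    have qp : q + p = n by rewrite addrC.
    rewrite memv_cap /= qp fF /=; have -> : f = cconj x - u by rewrite zE addrK.
    move: uT; rewrite opp_hodge_rec => /memv_addP[v vG [u' u'T ->]].
    rewrite opprD addrA memv_add ?memvN // memvB //.
      by rewrite memGn cconjK.
    have pn : p <= n + 1 - q by rewrite /n; lia.
    exact: subvP (conj_le pn (lexx n)) _ vG.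
  have supp1 : supported pr [set k | k = (q, p) \/ k.1 < q] (cconj x).
    rewrite zE; apply: supportedD.
      by apply: (supported_mem G fI); left.
    apply: supported_sub (full_supp q u _); first by move=> k; right.
    exact: subvP (opp_hodge_fullS q n) _ uT.
  have supp2 : supported pr [set k | k = (q, p) \/ k.2 < p] (cconj x).
    rewrite xE cconjD; apply: supportedD.
      move: gG; rewrite memGn => /Fsupp; apply: supported_sub => -[a b] /= [qa ab].
      have [bp|bp] := ltP b p; [by right|left].
      by congr (_, _); move: qa ab bp; rewrite /n; lia.
    by apply: supported_sub (opp_conj p _ t tT) => k; right.
  move=> k kz /=; have /= := supp1 k kz; have /= := supp2 k kz.
  by case=> [->|k2]; [left|case=> [->|k1]; [left|right]].
- apply: subv_anti; apply/andP; split.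
    apply: fsum_addv_sub => k /= kn.
    by apply: subv_trans (pieceF k.1 n k (lexx _) kn) (capvSr _ _).
  apply/subvP => x xW; apply/(gr_fsumP G).
  have : x \in Fn (- M%:Z) n by rewrite memv_cap F1 // memvf.
  by move=> /Fsupp; apply: supported_sub => k /= [].
apply: subv_anti; apply/andP; split.
  apply: fsum_addv_sub => k /= pk.
  by apply: subv_trans (pieceF p (k.1 + k.2) k pk (lexx _)) (capvSl _ _).
apply/subvP => x xF; apply/(gr_fsumP G).
have : x \in Fn p M%:Z by rewrite memv_cap xF W1 // memvf.
by move=> /Fsupp; apply: supported_sub => k /= [].
Qed.

End DeligneSplitting.

(** * The correspondence *)

Section MixedHodgeOfSigmaOperator.
Variables (R : realType) (V : vectType R).
Local Notation E := (cplx V).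
Implicit Types (A B : 'End(E)) (W : int -> {vspace V}) (F : int -> {vspace E}).
Implicit Types (x y f g : E) (k j : int * int) (n p q : int).

Section OneOperator.
Variables (A : 'End(E)) (pr : int * int -> 'End(E)) (D : seq (int * int)).
Hypothesis G : grading (eigen_pq A) pr D.
Hypothesis dA : deligne_split (eigen_pq A) pr.

Lemma weight_ofP n x : x \in weight_of A n <->
  supported pr [set k : int * int | k.1 + k.2 <= n] x.
Proof. exact: (gr_fsumP G). Qed.

Lemma hodge_ofP p x : x \in hodge_of A p <->
  supported pr [set k : int * int | p <= k.1] x.
Proof. exact: (gr_fsumP G). Qed.

Lemma weight_of_conj n x : x \in weight_of A n -> cconj x \in weight_of A n.
Proof.
move=> /weight_ofP xn; apply/weight_ofP; apply: (deligne_conj G dA) xn => k j /= kn.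
by case=> [->|[/= a b]] /=; lia.
Qed.

Lemma weight_of_le m n : m <= n -> (weight_of A m <= weight_of A n)%VS.
Proof.
move=> mn; apply/subvP => x /weight_ofP xm; apply/weight_ofP.
by apply: supported_sub xm => k /= km; apply: le_trans mn.
Qed.

(** Purity of the piece of weight n: an element is the sum of its components with
    first index at least p, which lie in F^p, and of those with first index less
    than p, which modulo W_{n-1} are conjugates of elements of F^q since their
    second index is at least q. *)
Lemma sigma_operator_mhs W : (forall n, cplxv (W n) = weight_of A n) ->
  real_mhs W (hodge_of A).
Proof.
move=> WA; have [M MP] := int_pair_bounded D.
have supp0 (P : set (int * int)) x : (forall k, k \in D -> ~ P k) ->
    supported pr P x -> x = 0.
  move=> DP xP; rewrite (gr_sum G x) big_seq big1 // => k kD; apply/eqP.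
  by apply: contraPT (DP k kD) => /xP Pk; apply.
have suppT (P : set (int * int)) x : (forall k, k \in D -> P k) ->
    supported pr P x by move=> DP k /(gr_supp G)/DP.
have Wfin : finite_increasing_filtration W.
  split=> [m n mn||].
  - by apply: cplxv_leP; rewrite !WA weight_of_le.
  - exists (- M - M) => n nM; apply: cplxv_inj; rewrite cplxv0 WA.
    apply/eqP; rewrite -subv0; apply/subvP => x /weight_ofP xn; rewrite memv0.
    by apply/eqP; apply: supp0 xn => k /MP[a _ b _] /=; lia.
  exists (M + M) => n nM; apply: cplxv_inj; rewrite cplxvf WA.
  apply/vspaceP => x; rewrite memvf; apply/weight_ofP.
  by apply: suppT => k /MP[_ a _ b] /=; lia.
have Ffin : finite_decreasing_filtration (hodge_of A).
  split=> [p q pq||].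
  - apply/subvP => x /hodge_ofP xq; apply/hodge_ofP.
    by apply: supported_sub xq => k /=; apply: le_trans.
  - exists (- M) => p pM; apply/vspaceP => x; rewrite memvf; apply/hodge_ofP.
    by apply: suppT => k /MP[a _ _ _] /=; lia.
  exists M => p pM; apply/eqP; rewrite -subv0; apply/subvP => x /hodge_ofP xp.
  by rewrite memv0; apply/eqP; apply: supp0 xp => k /MP[_ a _ _] /=; lia.
split=> //; apply/gr_hodgeP => //; first by case: Wfin.
split=> n p q pq.
  move=> x; rewrite WA => /weight_ofP xn.
  (* The conjugates u k replace the weight n components with k.1 < p, modulo W_(n-1). *)
  pose u k := if k.1 + k.2 == n then cconj (pr (swap k) (cconj (pr k x))) else 0.
  pose f := \sum_(k <- D | p <= k.1) pr k x.
  pose g := \sum_(k <- D | ~~ (p <= k.1)) u k.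
  have comp (k : int * int) (P : set (int * int)) :
      (k.1 + k.2 <= n -> P k) -> supported pr P (pr k x).
    move=> kP; have [->|/xn kn] := eqVneq (pr k x) 0; last first.
      by apply: (supported_mem G (gr_mem G k x)); apply: kP.
    by move=> j; rewrite linear0 eqxx.
  exists f, g; split.
  - rewrite memv_cap; apply/andP; split; [apply/hodge_ofP|apply/weight_ofP].
      by apply: supported_sum => k pk; apply: comp.
    by apply: supported_sum => k pk; apply: comp.
  - have gS : supported pr [set k | q <= k.1 /\ k.1 + k.2 <= n] (cconj g).
      rewrite cconj_sum; apply: supported_sum => k pk; rewrite /u.
      case: eqP => kn; last by rewrite cconj0 => j; rewrite linear0 eqxx.
      rewrite cconjK; apply: (supported_mem G (gr_mem G _ _)) => /=.
      by move: pk kn pq; rewrite -ltNge; lia.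
    rewrite memv_cap; apply/andP; split; [apply/hodge_ofP|apply/weight_ofP].
      by apply: supported_sub gS => k [].
    by apply: supported_sub gS => k [].
  rewrite WA; apply/weight_ofP.
  have -> : x - f - g = \sum_(k <- D | ~~ (p <= k.1)) (pr k x - u k).
    rewrite sumrB -/g; congr (_ - _); rewrite {1}(gr_sum G x).
    by rewrite (bigID (fun k : int * int => p <= k.1)) /= -/f addrC addrK.
  apply: supported_sum => k _; rewrite /u; case: eqP => kn; last first.
    by rewrite subr0; apply: comp => /= kn'; move: kn; lia.
  have xk := gr_mem G k x; move: (pr k x) xk => y yk.
  rewrite -{1}(cconjK y) -cconjB.
  apply: (deligne_conj G dA (P := below (swap k))).
    by move=> i j [/= a b] [->|[/= c d]] /=; lia.
  apply: supported_sub (supported_split G (dA yk)) => i /= [[]//->].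
  by rewrite eqxx.
move=> f g /memv_capP[fF fW] /memv_capP[gF gW]; rewrite WA => /weight_ofP fg.
apply/weight_ofP => k fk.
move: fW gW; rewrite !WA => /weight_ofP fW /weight_ofP gW.
move/hodge_ofP: fF => fF; move/hodge_ofP: gF => gF.
have kp := fF k fk; have kn := fW k fk; rewrite /= in kp kn.
rewrite /= leNgt; apply/negP => nk.
have gk : pr k g = 0.
  apply/eqP; apply: contraT => gk.
  have gS : supported pr [set j | q <= j.1 /\ j.1 + j.2 <= n] (cconj g).
    by move=> j gj; split; [exact: gF|exact: gW].
  have : supported pr [set j | j.1 < p \/ j.1 + j.2 <= n - 1] (cconj (cconj g)).
    apply: (deligne_conj G dA) gS => i j [/= qi iN] [->|[/= a b]] /=; last by right; lia.
    have [ij|ij] := leP (i.1 + i.2) (n - 1); [right; lia|left; lia].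
  by rewrite cconjK => /(_ k gk) /=; lia.
have := fg k; rewrite linearB /= gk subr0 fk => /(_ isT); lia.
Qed.

End OneOperator.

(** For x in I_A^{p,q}, membership in F^p and W_{p+q} bounds the components of x
    with respect to B from one side.  Applying the same remark to the
    A-components of the conjugate of x, and conjugating back, leaves only the
    index (p,q) and first indices less than p. *)
Lemma eigen_le_of_filtrations A B prA prB DA DB :
  grading (eigen_pq A) prA DA -> deligne_split (eigen_pq A) prA ->
  grading (eigen_pq B) prB DB -> deligne_split (eigen_pq B) prB ->
  (forall n, weight_of A n = weight_of B n) ->
  (forall p, hodge_of A p = hodge_of B p) ->
  forall k, (eigen_pq A k <= eigen_pq B k)%VS.
Proof.
move=> GA dA GB dB wAB hAB k; apply/subvP => x xk.
have suppB i y : y \in eigen_pq A i ->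
    supported prB [set j | i.1 <= j.1 /\ j.1 + j.2 <= i.1 + i.2] y.
  move=> yi; have yF : y \in hodge_of B i.1.
    by rewrite -hAB; apply/(hodge_ofP GA)/(supported_mem GA yi) => /=.
  have yW : y \in weight_of B (i.1 + i.2).
    by rewrite -wAB; apply/(weight_ofP GA)/(supported_mem GA yi) => /=.
  move/(hodge_ofP GB): yF => yF; move/(weight_ofP GB): yW => yW.
  by move=> j yj; split; [exact: yF|exact: yW].
have S2 : supported prB [set j | j = k \/ j.1 < k.1] x.
  rewrite -(cconjK x) (gr_sum GA (cconj x)) cconj_sum.
  apply: supported_sum => i _.
  have [->|xi] := eqVneq (prA i (cconj x)) 0.
    by rewrite cconj0 => j; rewrite linear0 eqxx.
  apply: (deligne_conj GB dB) (suppB i _ (gr_mem GA _ _)) => j l [/= ij sj].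
  have /= := dA k x xk i xi; case: k {xk} xi => p q /= xi [iE|[/= i1 i2]].
    rewrite iE /= in ij sj => -[->|[/= l1 l2]]; last by right; lia.
    have [jp|jp] := ltP j.2 p; [by right|left].
    by congr (_, _) => /=; lia.
  by move=> [->|[/= l1 l2]] /=; right; lia.
apply/(gr_memP GB) => j jk; apply/eqP; apply: contraT => xj.
have [j1 _] := suppB k x xk j xj.
by case: (S2 j xj) => /= [jE|]; [rewrite jE eqxx in jk|rewrite ltNge j1].
Qed.

Lemma spr_sigma_grading A : strongly_pseudo_real_sigma_operators A ->
  exists pr D, grading (eigen_pq A) pr D /\ deligne_split (eigen_pq A) pr.
Proof.
move=> [/sigma_operator_grading[pr [D G]] spr]; exists pr, D; split=> //.
by apply/(spr_sigma_deligne G).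
Qed.

Definition real_weight A n : {vspace V} :=
  xget 0%VS [set U | cplxv U = weight_of A n].

Lemma real_weightE A : strongly_pseudo_real_sigma_operators A ->
  forall n, cplxv (real_weight A n) = weight_of A n.
Proof.
move=> /spr_sigma_grading[pr [D [G dA]]] n.
apply: (xgetPex 0%VS (P := [set U | cplxv U = weight_of A n])).
by apply: real_descent => x; apply: (weight_of_conj G dA).
Qed.

Lemma real_weight_mhs A : strongly_pseudo_real_sigma_operators A ->
  real_mhs (real_weight A) (hodge_of A).
Proof.
move=> Aspr; have [pr [D [G dA]]] := spr_sigma_grading Aspr.
exact: (sigma_operator_mhs G dA (real_weightE Aspr)).
Qed.

Lemma spr_sigma_inj A B : strongly_pseudo_real_sigma_operators A ->
  strongly_pseudo_real_sigma_operators B ->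
  real_weight A = real_weight B -> hodge_of A = hodge_of B -> A = B.
Proof.
move=> Aspr Bspr wAB hAB.
have [prA [DA [GA dA]]] := spr_sigma_grading Aspr.
have [prB [DB [GB dB]]] := spr_sigma_grading Bspr.
apply: (operator_eq_of_eigen_le GA GB) => k.
apply: (eigen_le_of_filtrations GA dA GB dB) => [n|p]; last by rewrite hAB.
by rewrite -(real_weightE Aspr) -(real_weightE Bspr) wAB.
Qed.

Lemma spr_sigma_surj W F : real_mhs W F ->
  exists2 A, strongly_pseudo_real_sigma_operators A &
    real_weight A = W /\ hodge_of A = F.
Proof.
move=> [Wfin Ffin pure]; have Winc : increasing_filtration W by case: Wfin.
have [Hsum Hcap] := (gr_hodgeP Winc Ffin).1 pure.
have [I [pr [D [G dI IW IF]]]] := deligne_splitting Wfin Ffin Hsum Hcap.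
have [A [AI GA]] := grading_operator G.
have Aspr : strongly_pseudo_real_sigma_operators A.
  split; first exact: grading_sigma_operator GA.
  by apply/(spr_sigma_deligne GA); rewrite AI.
exists A => //; split; apply/funext => n; last by rewrite -IF -AI.
by apply: cplxv_inj; rewrite real_weightE // -IW -AI.
Qed.

End MixedHodgeOfSigmaOperator.
Theorem theorem1p6 (R : realType) (V : vectType R) :
  exists WR : 'End(cplx V) -> int -> {vspace V},
    [/\ forall A, strongly_pseudo_real_sigma_operators A ->
          unique (fun W : int -> {vspace V} => increasing_filtration W /\
                    forall n : int, cplxv (W n) = weight_of A n) (WR A),
        forall A, strongly_pseudo_real_sigma_operators A -> real_mhs (WR A) (hodge_of A) &
        set_bij (@strongly_pseudo_real_sigma_operators R V)
          [set WF : (int -> {vspace V}) * (int -> {vspace cplx V}) |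
             real_mhs WF.1 WF.2]
          (fun A => (WR A, hodge_of A))].
Proof.
exists (@real_weight R V); split=> [A Aspr|A|].
- split=> [|W [_ WA]].
    split; last exact: real_weightE.
    by have [[]] := real_weight_mhs Aspr.
  by apply/funext => n; apply: cplxv_inj; rewrite real_weightE.
- exact: real_weight_mhs.
split=> [A Aspr|A B /set_mem Aspr /set_mem Bspr AB|[W F] mhs].
- exact: real_weight_mhs.
- exact: spr_sigma_inj Aspr Bspr (congr1 fst AB) (congr1 snd AB).
have {}mhs : real_mhs W F := mhs.
have [A Aspr [<- <-]] := spr_sigma_surj mhs.
by exists A.
Qed.
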